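(* Let $\mathfrak g$ be one of $sl(\infty)$, $o(\infty)$, $sp(\infty)$ and let $\lambda,\mu\in\Theta$. Then $\mathrm{Ext}^1_{\mathfrak g}(V_\mu,V_\lambda)\neq0$ if and only if $\mu<\lambda$. If $\mu<\lambda$, then $\dim\mathrm{Ext}^1_{\mathfrak g}(V_\mu,V_\lambda)=\mathrm{card}\,2^{\mathbb Z}$.
   Context: The ground field is $\mathbb C$. $sl(\infty)=\bigcup_i sl(i)$, $o(\infty)=\bigcup_i o(i)$, $sp(\infty)=\bigcup_i sp(2i)$ via the natural inclusions; $\mathfrak g=\bigcup_i\mathfrak g_i$ is the fixed exhaustion. $\mathrm{Ext}^1_{\mathfrak g}$ is taken in the category of $\mathfrak g$-modules. $2^{\mathbb Z}$ is the power set of $\mathbb Z$. $V=\varinjlim V_i$ is the natural $\mathfrak g$-module (direct limit of the natural representations $V_i$ of $\mathfrak g_i$), $V_*=\varinjlim V_i^*$ is the conatural module ($V_*\simeq V$ for $o(\infty),sp(\infty)$), and $T^{p,q}=V^{\otimes p}\otimes(V_* )^{\otimes q}$. A simple tensor module is a simple $\mathfrak g$-module isomorphic to a submodule (equivalently, a subquotient) of some $T^{p,q}$, $p,q\in\mathbb Z_{\ge0}$. It is known that there are nested Borel subalgebras $\mathfrak b_i\subset\mathfrak g_i$ (with nested Cartan subalgebras) such that all simple tensor modules are highest weight modules with respect to $\mathfrak b=\varinjlim\mathfrak b_i$; fix such a choice. $\Theta$ is the set of all $\mathfrak b$-highest weights of simple tensor modules; for $\lambda\in\Theta$, $V_\lambda$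 is the simple tensor module with highest weight $\lambda$, and $V^i_\lambda$ is the simple $\mathfrak g_i$-module with $\mathfrak b_i$-highest weight $\lambda$ (considered as a weight of $\mathfrak g_i$). Partial order on $\Theta$: $\mu\le\lambda$ if for any sufficiently large $i$ there exists $j>i$ such that $\mathrm{Hom}_{\mathfrak g_i}(V^i_\mu,V^j_\lambda)\neq0$; $\mu<\lambda$ means $\mu\le\lambda$ and $\mu\ne\lambda$. *)

(* Defs.v *)
From HB Require Import structures.
From mathcomp Require Import all_boot all_order all_algebra.
From mathcomp Require Import all_classical reals complex.

Set Implicit Arguments.
Unset Strict Implicit.
Unset Printing Implicit Defensive.

Import GRing.Theory.

Local Open Scope classical_set_scope.
Local Open Scope ring_scope.

(* fseq M, the finitely supported sequences in M, is the direct sum of copies of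
   M indexed by nat. *)
Section FinitelySupported.
Variables (F : fieldType) (M : lmodType F).

Definition fsupp : {pred nat -> M} :=
  [pred f | `[< exists n, forall k, (n <= k)%N -> f k = 0 >]].

Record fseq := FSeq { fseq_fun :> nat -> M; fseq_supp : fseq_fun \in fsupp }.

HB.instance Definition _ := [isSub for fseq_fun].
HB.instance Definition _ := [Choice of fseq by <:].

Lemma fsupp_submod_closed : submod_closed fsupp.
Proof.
split; first by apply/asboolP; exists 0%N.
move=> a f g /asboolP[n fn] /asboolP[m gm]; apply/asboolP.
exists (maxn n m) => k; rewrite geq_max => /andP[nk mk].
by rewrite -[LHS]/(a *: f k + g k) fn // gm // scaler0 addr0.
Qed.

HB.instance Definition _ :=
  GRing.isSubmodClosed.Build F (nat -> M) fsupp fsupp_submod_closed.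
HB.instance Definition _ := [SubChoice_isSubLmodule of fseq by <:].

Lemma fseqP (f g : fseq) : (forall k, f k = g k) -> f = g.
Proof. by move=> fg; apply/val_inj/funext. Qed.

Lemma fseq_bound (f : fseq) : exists n, forall k, (n <= k)%N -> f k = 0.
Proof. by case: f => f /= /asboolP. Qed.

Lemma fseq_lin a (f g : fseq) k : (a *: f + g) k = a *: f k + g k.
Proof. by []. Qed.

Lemma fsbig_bound (G : nat -> M) n : (forall c, (n <= c)%N -> G c = 0) ->
  \sum_(c \in [set: nat]) G c = \sum_(c < n) G c.
Proof.
move=> Gn; rewrite fsbig_ord; apply/esym/fsbig_widen => //= c [_ /negP].
by rewrite -leqNgt => /Gn.
Qed.
End FinitelySupported.

Section GlInfinity.
Variable F : fieldType.

(* Infinite matrices with finitely many nonzero entries: [x a b] is the entry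
   in row [a] and column [b]. *)
Definition glinf := fseq (fseq F^o).

Lemma glinf_bound (x : glinf) :
  exists n, forall a b, (n <= a)%N || (n <= b)%N -> x a b = 0.
Proof.
have [n xn] := fseq_bound x.
have /choice[m xm] a := fseq_bound (x a).
exists (maxn n (\max_(a < n) m a)) => a b.
rewrite !geq_max; have [na|an] := leqP n a; first by rewrite xn.
by move=> /= /andP[_ /bigmax_leqP mb]; apply: xm; exact: (mb (Ordinal an)).
Qed.

Definition glmul_fun (x y : glinf) a : fseq F^o :=
  \sum_(c \in [set: nat]) (x a c : F) *: y c.

Lemma glmul_subproof x y : glmul_fun x y \in @fsupp F (fseq F^o).
Proof.
have [n xn] := glinf_bound x; apply/asboolP; exists n => a na.
by apply: fsbig1 => c _; rewrite xn ?na // scale0r.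
Qed.

Definition glmul x y : glinf := FSeq (glmul_subproof x y).
Definition glbr (x y : glinf) : glinf := glmul x y - glmul y x.

Lemma glmulE x y a b :
  glmul x y a b = \sum_(c \in [set: nat]) (x a c : F) * y c b.
Proof.
have [n xn] := glinf_bound x.
rewrite (@fsbig_bound _ F^o _ n) => [|c nc]; last by rewrite xn ?nc ?orbT // mul0r.
rewrite /= /glmul_fun (@fsbig_bound _ _ _ n) => [|c nc]; last first.
  by rewrite xn ?nc ?orbT // scale0r.
by apply: (big_ind2 (fun (u : fseq F^o) v => u b = v)) => // u1 v1 u2 v2 <- <-.
Qed.

(* Representations of gl(oo) on a space with basis e_0, e_1, ..., where x acts
   by the finitary matrix [coef x]: x e_c = \sum_k (coef x k c) e_k. *)
Record matrep := MatRep {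
  coef : glinf -> nat -> nat -> F;
  coef_fin : forall x,
    exists n, forall k c, (n <= k)%N || (n <= c)%N -> coef x k c = 0;
  coef_lin : forall a x y k c,
    coef (a *: x + y) k c = a * coef x k c + coef y k c;
  coef_br : forall x y k c, coef (glbr x y) k c =
    \sum_(d \in [set: nat]) coef x k d * coef y d c -
    \sum_(d \in [set: nat]) coef y k d * coef x d c }.

Lemma nat_coef_br (x y : glinf) k c : glbr x y k c =
    \sum_(d \in [set: nat]) (x k d : F) * y d c -
    \sum_(d \in [set: nat]) (y k d : F) * x d c.
Proof. by rewrite -!glmulE. Qed.

Lemma conat_coef_fin (x : glinf) :
  exists n, forall k c, (n <= k)%N || (n <= c)%N -> - x c k = 0 :> F.
Proof.
have [n xn] := glinf_bound x; exists n => k c kc.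
by rewrite xn ?oppr0 // orbC.
Qed.

Lemma conat_coef_lin a (x y : glinf) k c :
  - (a *: x + y) c k = a * - x c k + - y c k :> F.
Proof. by rewrite mulrN -opprD. Qed.

Lemma conat_coef_br (x y : glinf) k c : - glbr x y c k =
    \sum_(d \in [set: nat]) (- x d k : F) * - y c d -
    \sum_(d \in [set: nat]) (- y d k : F) * - x c d.
Proof.
rewrite nat_coef_br opprB; congr (_ - _);
  by apply: eq_fsbigr => d _; rewrite mulrNN mulrC.
Qed.

Definition nat_rep := @MatRep (fun x k c => x k c) glinf_bound
  (fun _ _ _ _ _ => erefl) nat_coef_br.
Definition conat_rep := @MatRep (fun x k c => - x c k) conat_coef_fin
  conat_coef_lin conat_coef_br.

End GlInfinity.

Arguments nat_rep {F}.
Arguments conat_rep {F}.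

Section LieModules.
Variable F : fieldType.
Local Notation gl := (glinf F).

(* Modules over a Lie subalgebra K of gl(oo).  The operators [lact x] for x
   outside K are irrelevant: every notion below only uses x in K. *)
Record lieModule (K : set gl) := LieModule {
  lcar :> lmodType F;
  lact : gl -> lcar -> lcar;
  lact_linear : forall x, linear (lact x);
  lact_lin : forall a x y v, K x -> K y ->
    lact (a *: x + y) v = a *: lact x v + lact y v;
  lact_br : forall x y v, K x -> K y ->
    lact (glbr x y) v = lact x (lact y v) - lact y (lact x v) }.

(* M and N may be modules over subalgebras larger than K. *)
Definition is_hom (K K1 K2 : set gl) (M : lieModule K1) (N : lieModule K2)
    (f : M -> N) :=
  linear f /\ forall x, K x -> forall v, f (lact x v) = lact x (f v).

Definition is_submodule (K : set gl) (M : lieModule K) (S : set M) :=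
  [/\ S 0, forall a u v, S u -> S v -> S (a *: u + v) &
      forall x v, K x -> S v -> S (lact x v)].

Definition is_simple (K : set gl) (M : lieModule K) :=
  (exists v : M, v <> 0) /\
  forall S : set M, is_submodule S -> S = [set 0] \/ S = [set: M].

Section Trivial.
Variable K : set gl.

Lemma triv_linear (x : gl) : linear (fun _ : F^o => 0 : F^o).
Proof. by move=> a u v; rewrite scaler0 addr0. Qed.

Definition triv_mod : lieModule K.
Proof.
refine (@LieModule K F^o (fun _ _ => 0) triv_linear _ _) => *.
- by rewrite scaler0 addr0.
- by rewrite subr0.
Defined.
End Trivial.

Section Tensor.
Variables (K : set gl) (M : lieModule K) (W : matrep F).

(* M (x) W, an element \sum_k m_k (x) e_k being the sequence (m_k)_k. *)
Definition tens_fun (x : gl) (f : fseq M) (k : nat) : M :=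
  lact x (f k) + \sum_(c \in [set: nat]) coef W x k c *: f c.

Lemma lact0 (x : gl) : lact x (0 : M) = 0.
Proof.
have := lact_linear x 1 0 (0 : M); rewrite !scale1r addr0 => /esym e.
by apply: (addrI (lact x 0)); rewrite e addr0.
Qed.

Lemma tens_sumE x (f : nat -> M) n k :
  (forall k c, (n <= k)%N || (n <= c)%N -> coef W x k c = 0) ->
  \sum_(c \in [set: nat]) coef W x k c *: f c =
  \sum_(c < n) coef W x k c *: f c.
Proof. by move=> xn; apply: fsbig_bound => c nc; rewrite xn ?nc ?orbT ?scale0r. Qed.

Lemma tens_subproof x f : tens_fun x f \in @fsupp F M.
Proof.
have [m fm] := fseq_bound f; have [n xn] := coef_fin W x.
apply/asboolP; exists (maxn m n) => k; rewrite geq_max => /andP[mk nk].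
rewrite /tens_fun fm // lact0 add0r; apply: fsbig1 => c _.
by rewrite xn ?nk // scale0r.
Qed.

Definition tens_act x f : fseq M := FSeq (tens_subproof x f).

Lemma tens_linear x : linear (tens_act x).
Proof.
move=> a f g; apply: fseqP => k; rewrite fseq_lin /= /tens_fun.
have [n xn] := coef_fin W x; rewrite !(tens_sumE _ _ xn) lact_linear.
rewrite scalerDr addrACA scaler_sumr -big_split/=; congr (_ + _).
by apply: eq_bigr => c _; rewrite scalerDr !scalerA mulrC.
Qed.

Lemma coef_fin2 x y : exists n,
  (forall k c, (n <= k)%N || (n <= c)%N -> coef W x k c = 0) /\
  (forall k c, (n <= k)%N || (n <= c)%N -> coef W y k c = 0).
Proof.
have [n xn] := coef_fin W x; have [m ym] := coef_fin W y.
by exists (maxn n m); split=> k c; rewrite !geq_max => h; [apply: xn|apply: ym];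
  case/orP: h => /andP[h1 h2]; rewrite ?h1 ?h2 ?orbT.
Qed.

Lemma tens_lin a x y f : K x -> K y ->
  tens_act (a *: x + y) f = a *: tens_act x f + tens_act y f.
Proof.
move=> Kx Ky; apply: fseqP => k; rewrite fseq_lin /= /tens_fun lact_lin //.
have [n [xn yn]] := coef_fin2 x y.
rewrite (tens_sumE _ _ xn) (tens_sumE _ _ yn) (@tens_sumE _ _ n); last first.
  by move=> {}k c kc; rewrite coef_lin xn // yn // mulr0 addr0.
rewrite scalerDr addrACA scaler_sumr -big_split/=; congr (_ + _).
by apply: eq_bigr => c _; rewrite coef_lin scalerDl scalerA.
Qed.

Lemma lactD x (u v : M) : lact x (u + v) = lact x u + lact x v.
Proof. by rewrite -[u]scale1r lact_linear !scale1r. Qed.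

Lemma lactZ x a (u : M) : lact x (a *: u) = a *: lact x u.
Proof. by rewrite -[a *: u]addr0 lact_linear lact0 addr0. Qed.

Lemma tens_act2 x y f k n :
  (forall k c, (n <= k)%N || (n <= c)%N -> coef W x k c = 0) ->
  (forall k c, (n <= k)%N || (n <= c)%N -> coef W y k c = 0) ->
  tens_act x (tens_act y f) k = lact x (lact y (f k)) +
    (\sum_(c < n) coef W y k c *: lact x (f c) +
     \sum_(c < n) coef W x k c *: lact y (f c)) +
    \sum_(c < n) (\sum_(d < n) coef W x k d * coef W y d c) *: f c.
Proof.
move=> xn yn; rewrite /= /tens_fun (tens_sumE _ _ xn) /= /tens_fun.
rewrite (tens_sumE _ _ yn) lactD -!addrA; congr (_ + _); rewrite addrA.
have -> : lact x (\sum_(c < n) coef W y k c *: f c) =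
    \sum_(c < n) coef W y k c *: lact x (f c).
  by elim/big_ind2: _ => [|u1 v1 u2 v2 <- <-|c _]; rewrite ?lact0 ?lactD ?lactZ.
rewrite -!addrA; congr (_ + _).
rewrite (eq_bigr (fun c : 'I_n => coef W x k c *: lact y (f c) +
   \sum_(d < n) (coef W x k c * coef W y c d) *: f d)) => [|c _]; last first.
  rewrite scalerDr (tens_sumE _ _ yn) scaler_sumr; congr (_ + _).
  by apply: eq_bigr => d _; rewrite scalerA.
rewrite big_split/=; congr (_ + _); rewrite exchange_big/=.
by apply: eq_bigr => c _; rewrite scaler_suml.
Qed.

Lemma tens_br x y f : K x -> K y -> tens_act (glbr x y) f =
  tens_act x (tens_act y f) - tens_act y (tens_act x f).
Proof.
move=> Kx Ky; apply: fseqP => k; have [n [xn yn]] := coef_fin2 x y.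
have brE d c : coef W (glbr x y) d c = \sum_(e < n) coef W x d e * coef W y e c -
    \sum_(e < n) coef W y d e * coef W x e c.
  by rewrite coef_br !(@fsbig_bound _ F^o _ n) // => e ne;
    rewrite ?(xn d) ?(yn d) ?ne ?orbT ?mul0r.
rewrite -[RHS]/(tens_act x (tens_act y f) k - tens_act y (tens_act x f) k).
rewrite !(@tens_act2 _ _ _ _ n) //= /tens_fun lact_br //.
rewrite (@tens_sumE _ _ n); last first.
  move=> d c /orP[nd|nc]; rewrite brE !big1 ?subr0 // => e _.
  - by rewrite (yn d e) ?nd ?mul0r.
  - by rewrite (xn d e) ?nd ?mul0r.
  - by rewrite (xn e c) ?nc ?orbT ?mulr0.
  - by rewrite (yn e c) ?nc ?orbT ?mulr0.
have -> : \sum_(c < n) coef W (glbr x y) k c *: f c =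
    \sum_(c < n) (\sum_(e < n) coef W x k e * coef W y e c) *: f c -
    \sum_(c < n) (\sum_(e < n) coef W y k e * coef W x e c) *: f c.
  by rewrite -sumrB; apply: eq_bigr => c _; rewrite brE scalerBl.
set S := \sum_(c < n) _; set S' := \sum_(c < n) _.
set T := _ + \sum_(c < n) coef W x k c *: lact y (f c).
rewrite [X in _ = _ - (_ + X + _)]addrC -/T.
rewrite (addrAC _ T S) (addrAC _ T S') opprD [RHS]addrACA subrr addr0.
by rewrite opprD addrACA.
Qed.

Definition tens : lieModule K := LieModule tens_linear tens_lin tens_br.
End Tensor.

(* T^{p,q}: the p-th tensor power of V times the q-th tensor power of V_*. *)
Definition tensor_module (K : set gl) (p q : nat) : lieModule K :=
  iter q (fun M => tens M conat_rep) (iter p (fun M => tens M nat_rep)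
    (triv_mod K)).

Definition simple_tensor (K : set gl) (M : lieModule K) :=
  is_simple M /\
  exists p q (f : M -> tensor_module K p q), is_hom K f /\ injective f.
End LieModules.

Section Subalgebras.
Variable F : fieldType.
Local Notation gl := (glinf F).
Implicit Types A B S g b h : set gl.

Definition subspace S := S 0 /\ forall a x y, S x -> S y -> S (a *: x + y).

Definition subalgebra S :=
  subspace S /\ forall x y, S x -> S y -> S (glbr x y).

(* the linear span [A, B] of the brackets of elements of A with elements of B *)
Definition brspan A B : set gl :=
  [set z | forall S, subspace S ->
     (forall x y, A x -> B y -> S (glbr x y)) -> S z].

Definition solvable S := exists n, iter n (fun D => brspan D D) S `<=` [set 0].
Definition nilpotent S := exists n, iter n (brspan S) S `<=` [set 0].

Definition is_borel g b :=
  [/\ subalgebra b, b `<=` g, solvable b &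
      forall s, subalgebra s -> s `<=` g -> solvable s -> b `<=` s -> s = b].

Definition is_cartan g h :=
  [/\ subalgebra h, h `<=` g, nilpotent h &
      forall x, g x -> (forall y, h y -> h (glbr x y)) -> h x].

Definition weight h := {x : gl | h x} -> F.

Definition res_weight h h' (hh' : h `<=` h') (la : weight h') : weight h :=
  fun x => la (exist _ (sval x) (hh' _ (svalP x))).

(* M is a highest weight K-module with respect to the Borel subalgebra b with
   Cartan subalgebra h; for such h and b, the nilpotent radical of b is
   [b, b]. *)
Definition is_hw_module (K h b : set gl) (M : lieModule K) (la : weight h) :=
  exists v : M,
  [/\ v <> 0,
      forall x (hx : h x), lact x v = la (exist _ x hx) *: v,
      forall x, brspan b b x -> lact x v = 0 &
      forall S : set M, is_submodule S -> S v -> S = [set: M]].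

End Subalgebras.

Inductive classical_type := SLinf | Oinf | SPinf.

Section ClassicalAlgebras.
Variable F : fieldType.
Local Notation gl := (glinf F).
Variable t : classical_type.

Definition corner n (x : gl) : 'M[F]_n := \matrix_(a, b) x a b.
Definition in_corner n (x : gl) :=
  forall a b, (n <= a)%N || (n <= b)%N -> x a b = 0.

(* omega (e_2k, e_2k+1) = 1 = - omega (e_2k+1, e_2k), other values being 0 *)
Definition omega_mx n : 'M[F]_n :=
  \matrix_(a, b) (if odd a then - (b.+1 == a :> nat)%:R
                  else (b == a.+1 :> nat)%:R).

(* sl(i), o(i), sp(2i), the form on F^i preserved by o(i) being
   \sum_k x_k y_k *)
Definition galg (i : nat) : set gl :=
  match t with
  | SLinf => [set x | in_corner i x /\ \tr (corner i x) = 0]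
  | Oinf => [set x | in_corner i x /\ (corner i x)^T = - corner i x]
  | SPinf => [set x | in_corner i.*2 x /\
      (corner i.*2 x)^T *m omega_mx i.*2 + omega_mx i.*2 *m corner i.*2 x = 0]
  end.

Definition ginf : set gl := \bigcup_i galg i.

Section Weights.
Variables h b : nat -> set gl.
Let hinf : set gl := \bigcup_i h i.
Let binf : set gl := \bigcup_i b i.

Record nested_borels : Prop := NestedBorels {
  nb_borel : forall i, is_borel (galg i) (b i);
  nb_cartan : forall i, is_cartan (galg i) (h i);
  nb_sub : forall i, h i `<=` b i;
  nb_borelS : forall i, b i `<=` b i.+1;
  nb_cartanS : forall i, h i `<=` h i.+1;
  nb_hw : forall M : lieModule ginf, simple_tensor M ->
    exists la : weight hinf, is_hw_module binf M la }.

(* M is V_la *)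
Definition is_V (la : weight hinf) (M : lieModule ginf) :=
  simple_tensor M /\ is_hw_module binf M la.

Definition Theta : set (weight hinf) := [set la | exists M, is_V la M].

Lemma h_sub i : h i `<=` hinf.
Proof. exact: bigcup_sup. Qed.

(* M is V^i_la *)
Definition is_Vi (i : nat) (la : weight hinf) (M : lieModule (galg i)) :=
  is_simple M /\ is_hw_module (b i) M (res_weight (@h_sub i) la).

(* Hom_{g_i}(V^i_mu, V^j_la) <> 0; V^i_mu and V^j_la are determined up to
   isomorphism by is_Vi. *)
Definition hom_nonzero i j (mu la : weight hinf) :=
  exists (M : lieModule (galg i)) (N : lieModule (galg j)) (f : M -> N),
    [/\ is_Vi mu M, is_Vi la N, is_hom (galg i) f & exists v, f v <> 0].

Definition wle (mu la : weight hinf) :=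
  exists i0, forall i, (i0 <= i)%N ->
    exists j, (i < j)%N /\ hom_nonzero i j mu la.

Definition wlt mu la := wle mu la /\ mu <> la.

End Weights.
End ClassicalAlgebras.

Section Dimension.
Variables (F : fieldType) (V : lmodType F).

Definition is_basis (B : set V) :=
  forall v : V, exists! c : V -> F,
    [/\ finite_set [set b | c b != 0], (forall b, c b != 0 -> B b) &
        v = \sum_(b \in B) c b *: b].

Definition dim_is T (X : set T) := exists B : set V, is_basis B /\ (B #= X)%card.
End Dimension.

Section Ext1.
Variables (F : fieldType) (K : set (glinf F)) (M N : lieModule K).

(* short exact sequences 0 -> N -> E -> M -> 0 *)
Record extension := Extension {
  ext_mid :> lieModule K;
  ext_in : N -> ext_mid;
  ext_out : ext_mid -> M;
  ext_in_hom : is_hom K ext_in;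
  ext_out_hom : is_hom K ext_out;
  ext_in_inj : injective ext_in;
  ext_out_surj : forall m, exists e, ext_out e = m;
  ext_exact : forall e, ext_out e = 0 <-> exists n, e = ext_in n }.

(* There is a morphism of extensions E -> E' which is a * id on N and id on M,
   i.e., E' is the pushout of E along a * id_N. *)
Definition is_ext_scale a (E E' : extension) :=
  exists f : E -> E', [/\ is_hom K f,
    forall n, f (ext_in E n) = ext_in E' (a *: n) &
    forall e, ext_out (f e) = ext_out e].

Definition ext_equiv (E E' : extension) :=
  exists f : E -> E', [/\ is_hom K f,
    forall n, f (ext_in E n) = ext_in E' n &
    forall e, ext_out (f e) = ext_out e].

(* E is the Baer sum of E1 and E2, i.e., the pushout along the addition
   N + N -> N of the fibre product of E1 and E2 over M.  The map f below is
   only constrained on that fibre product. *)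
Definition is_baer_sum (E1 E2 E : extension) :=
  exists f : E1 -> E2 -> E,
  [/\ forall a u1 u2 v1 v2, ext_out u1 = ext_out u2 -> ext_out v1 = ext_out v2 ->
        f (a *: u1 + v1) (a *: u2 + v2) = a *: f u1 u2 + f v1 v2,
      forall x u1 u2, K x -> ext_out u1 = ext_out u2 ->
        f (lact x u1) (lact x u2) = lact x (f u1 u2),
      forall n1 n2, f (ext_in E1 n1) (ext_in E2 n2) = ext_in E (n1 + n2) &
      forall u1 u2, ext_out u1 = ext_out u2 -> ext_out (f u1 u2) = ext_out u1].

(* The vector space Ext^1(M, N) of equivalence classes of extensions; these
   conditions determine [ext1_car] and [ext1_class] up to a unique
   isomorphism. *)
Record ext1_space := Ext1Space {
  ext1_car :> lmodType F;
  ext1_class : extension -> ext1_car;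
  ext1_surj : forall w, exists E, ext1_class E = w;
  ext1_eq : forall E E', ext1_class E = ext1_class E' <-> ext_equiv E E';
  ext1_add : forall E1 E2 E,
    is_baer_sum E1 E2 E -> ext1_class E = ext1_class E1 + ext1_class E2;
  ext1_scale : forall a E E',
    is_ext_scale a E E' -> ext1_class E' = a *: ext1_class E }.

End Ext1.

(* Main.v *)
(* A simple tensor module is unitary and is an increasing union of
   finite-dimensional g_i-modules.  If v is the highest weight vector of V_mu, let
   S_i be the space of the vectors of V_la on which b_i acts as on v; these spaces
   decrease, mu <= la means that no S_i vanishes, and then mu = la exactly when
   their intersection is nonzero.

   In an extension of V_mu by V_la, the lifts of v that generate over g_i a module
   meeting V_la trivially form, for large i, a nonempty set (Whitehead's lemma for
   g_i, obtained from a Casimir operator and unitarity) and a coset of S_i.  These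
   cosets decrease, so if the S_i become constant they have a common element and
   the extension splits.  The S_i do become constant unless mu < la: if mu = la,
   this is because g_i-multiplicities in a tensor module are controlled by
   shorter tensor words.

   If mu < la, pick f_k in S_(i_k), nonzero, leaving every fixed finite-dimensional
   subspace as k grows.  For every scalar sequence a, the formal sum of the a_k D_k,
   where D_k is the coboundary of an extension of the partial homomorphism
   v |-> f_k, is locally finite, hence a cocycle; it is a coboundary only if a is
   finitely supported.  An almost disjoint family of 2^N subsets of N then gives
   2^N independent classes, and a cocycle is determined by countably many complex
   numbers. *)

(* The Borel and Cartan subalgebras are known only through maximal solvability, nilpotency and
   self-normalization, so the structure usually read off from roots must be extracted from these
   properties. Lie's theorem gives a flag stable under b_i; integer labels on the flag give an
   element H of b_i such that g_i is spanned by b_i and by ad H-eigenvectors of negative eigenvalue;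
   and b_i = h_i + [b_i, b_i] makes a weight determine the action of all of b_i on a highest weight
   vector. In a cyclic module the eigenvalue of H alone then recognizes the highest weight vector.

   Homomorphisms are obtained as graphs: the module generated by (v, w) in M x N is a graph when v
   and w generate simple modules and b_i acts on both by the same character. Equivariance is then
   automatic, and no classification of simple modules enters.

   From level 5 on, g_i is centreless in all three types, hence perfect by orthogonality for the
   trace form; unitarity supplies what else Whitehead's lemma requires. Classes are handled as
   cocycles, because infinite sums make sense for cocycles evaluated at one element and one vector,
   but not for extensions. *)
Require Import Defs.
From mathcomp Require Import all_boot all_order all_algebra.
From mathcomp Require Import all_classical reals complex.
From HB Require Import structures.
From mathcomp Require Import ring zify.

Set Implicit Arguments.
Unset Strict Implicit.
Unset Printing Implicit Defensive.

Import Order.TTheory GRing.Theory Num.Theory.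

Local Open Scope classical_set_scope.
Local Open Scope ring_scope.

(** * Linear algebra *)

Section LinearMaps.
Variables (F : fieldType) (V W : lmodType F) (f : V -> W).
Hypothesis fL : linear f.

Lemma linD u v : f (u + v) = f u + f v.
Proof. by rewrite -[u]scale1r fL !scale1r. Qed.

Lemma lin0 : f 0 = 0.
Proof. by apply: (addrI (f 0)); rewrite -linD !addr0. Qed.

Lemma linZ a u : f (a *: u) = a *: f u.
Proof. by rewrite -[a *: u]addr0 fL lin0 addr0. Qed.

Lemma linN u : f (- u) = - f u.
Proof. by rewrite -scaleN1r linZ scaleN1r. Qed.

Lemma linB u v : f (u - v) = f u - f v.
Proof. by rewrite linD linN. Qed.

Lemma lin_sum I (r : seq I) (P : pred I) (g : I -> V) :
  f (\sum_(i <- r | P i) g i) = \sum_(i <- r | P i) f (g i).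
Proof. by elim/big_rec2: _ => [|i u v _ <-]; rewrite ?lin0 ?linD. Qed.
End LinearMaps.

Lemma linear_comp (F : fieldType) (U V W : lmodType F) (f : V -> W)
  (g : U -> V) : linear f -> linear g -> linear (f \o g).
Proof. by move=> fL gL a u v; rewrite /= gL fL. Qed.

Lemma linear_iter (F : fieldType) (V : lmodType F) (f : V -> V) k :
  linear f -> linear (iter k f).
Proof. by move=> fL; elim: k => // k IH a u v /=; rewrite IH fL. Qed.

Definition lsubspace (F : fieldType) (V : lmodType F) (S : set V) :=
  S 0 /\ forall a u v, S u -> S v -> S (a *: u + v).

Section Subspaces.
Variables (F : fieldType) (V : lmodType F).
Implicit Types S R C : set V.

Lemma lsubD S u v : lsubspace S -> S u -> S v -> S (u + v).
Proof. by move=> [_ SL] Su Sv; rewrite -[u]scale1r; apply: SL. Qed.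

Lemma lsubZ S a u : lsubspace S -> S u -> S (a *: u).
Proof. by move=> [S0 SL] Su; rewrite -[_ *: _]addr0; apply: SL. Qed.

Lemma lsubN S u : lsubspace S -> S u -> S (- u).
Proof. by move=> SL Su; rewrite -scaleN1r; apply: lsubZ. Qed.

Lemma lsubB S u v : lsubspace S -> S u -> S v -> S (u - v).
Proof. by move=> SL Su Sv; apply: lsubD => //; apply: lsubN. Qed.

Lemma lsub_sum S I (r : seq I) (P : pred I) (f : I -> V) : lsubspace S ->
  (forall i, P i -> S (f i)) -> S (\sum_(i <- r | P i) f i).
Proof.
move=> SL Sf; elim/big_ind: _ => //; first by case: SL.
by move=> u v Su Sv; apply: lsubD.
Qed.

Lemma lsub_set0 : lsubspace [set 0 : V].
Proof. by split=> // a u v -> ->; rewrite scaler0 addr0. Qed.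

Lemma lsub_setT : lsubspace [set: V].
Proof. by []. Qed.

Lemma lsubI S R : lsubspace S -> lsubspace R -> lsubspace (S `&` R).
Proof.
move=> SL RL; split; first by split; [case: SL|case: RL].
by move=> a u v [Su Ru] [Sv Rv]; split; [apply: SL.2|apply: RL.2].
Qed.

(** Finite dimension of S modulo R, encoded without bases by a linear map to row vectors whose
    kernel on S lies in R. Finite dimension of S itself is the case R = 0. *)
Definition fdim_mod S R := exists d (j : V -> 'rV[F]_d),
  linear j /\ forall v, S v -> j v = 0 -> R v.

Lemma fdim_modS S S' R : S' `<=` S -> fdim_mod S R -> fdim_mod S' R.
Proof.
by move=> S'S [d [j [jL jR]]]; exists d, j; split=> // v /S'S; apply: jR.
Qed.

(** The images of one vector too many form a matrix with more rows than columns; a nonzero row of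
    its kernel is the relation. *)
Lemma fdim_dep S R : lsubspace S -> fdim_mod S R -> exists d,
  forall u : nat -> V, (forall i, (i < d)%N -> S (u i)) ->
  exists c : nat -> F,
    (exists2 i, (i < d)%N & c i != 0) /\ R (\sum_(i < d) c i *: u i).
Proof.
move=> SL [d [j [jL jR]]]; exists d.+1 => u uS.
pose A : 'M_(d.+1, d) := \matrix_i j (u i).
have : kermx A != 0.
  by rewrite kermx_eq0 /row_free neq_ltn ltnS rank_leq_col.
case/matrix0Pn=> i [k ik0]; exists (fun m => kermx A i (inord m)).
split; first by exists k => //; rewrite inord_val.
apply: jR.
  by apply: lsub_sum => // m _; apply: lsubZ => //; apply: uS.
rewrite lin_sum //.
have /row_matrixP/(_ i) : kermx A *m A = 0 by rewrite mulmx_ker.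
rewrite row_mul row0 mulmx_sum_row => E; rewrite -[RHS]E; apply: eq_bigr => m _.
by rewrite (linZ jL) rowK [in RHS]mxE inord_val.
Qed.

(** Descent on a strict bound k for the length of free families in U: in a strictly smaller U' the
    bound drops by one, because a vector of U outside U' extends any free family of U'. *)
Lemma min_subspace S (P : set (set V)) U0 : lsubspace S ->
  fdim_mod S [set 0] -> (forall U, P U -> lsubspace U /\ U `<=` S) -> P U0 ->
  exists U, P U /\ forall U', P U' -> U' `<=` U -> U' = U.
Proof.
move=> SL fS PS PU0; have [d dep] := fdim_dep SL fS.
pose Q (U : set V) k := exists u : nat -> V, (forall i, (i < k)%N -> U (u i)) /\
  forall c : nat -> F, \sum_(i < k) c i *: u i = 0 -> forall i, (i < k)%N -> c i = 0.
suff H k U : P U -> ~ Q U k ->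
    exists U, P U /\ forall U', P U' -> U' `<=` U -> U' = U.
  apply: (H d _ PU0) => -[u [uU uI]].
  have [i id|c [[i id /eqP ci] /uI]] := dep u; last by move/(_ i id).
  by apply/(PS _ PU0).2/uU.
elim: k U => [|k IH] U PU nQ; first by case: nQ; exists (fun=> 0); split.
have [mU|] := pselect (forall U', P U' -> U' `<=` U -> U' = U).
  by exists U.
move=> /existsNP[U' /not_implyP[PU' /not_implyP[U'U neU]]].
apply: (IH U' PU') => -[u [uU uI]].
have [w Uw U'w] : exists2 w, U w & ~ U' w.
  apply: contrapT => nw; apply: neU; apply/seteqP; split=> // w Uw.
  by apply: contrapT => U'w; apply: nw; exists w.
apply: nQ; exists (fun i => if i == k then w else u i); split=> [i|c].
  by rewrite ltnS leq_eqVlt; case: eqP => //= _ /uU /U'U.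
rewrite big_ord_recr /= eqxx.
under eq_bigr => i _ do rewrite (ltn_eqF (ltn_ord i)).
have L' := (PS _ PU').1.
have [ck0|ck0] := eqVneq (c k) 0.
  rewrite ck0 scale0r addr0 => /uI h i; rewrite ltnS leq_eqVlt.
  by case/orP => [/eqP->|/h].
move=> /eqP; rewrite addrC addr_eq0 => /eqP e; case: U'w.
rewrite -[w](scalerK ck0) e; apply: lsubZ => //; apply: lsubN => //; apply: lsub_sum => // i _.
by apply: lsubZ => //; apply: uU.
Qed.

Lemma chain_stationary S (U : nat -> set V) i0 : lsubspace S ->
  fdim_mod S [set 0] -> (forall i, lsubspace (U i)) ->
  (forall i, U i.+1 `<=` U i) -> U i0 `<=` S ->
  exists2 i1, (i0 <= i1)%N & forall i, (i1 <= i)%N -> U i = U i1.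
Proof.
move=> SL fS UL Udec U0S.
have UU i k : U (i + k)%N `<=` U i.
  by elim: k => [|k IH]; rewrite ?addn0 // addnS => v /Udec /IH.
have [||_ [[i1 i01 <-] mU]] := @min_subspace S
    [set W | exists2 i, (i0 <= i)%N & U i = W] (U i0) SL fS.
- move=> _ [i i0i <-]; split=> // v; rewrite -(subnKC i0i) => /UU; exact: U0S.
- by exists i0.
exists i1 => // i i1i; apply: mU; last by rewrite -(subnKC i1i); apply: UU.
by exists i => //; apply: leq_trans i01 i1i.
Qed.

(** Take a relation, modulo R, between the iterates of A on v, and let k be the lowest index with a
    nonzero coefficient. Dividing by c_k and splitting off the term v gives z and y; the relation
    itself is c_k A^k z. *)
Lemma fitting S R (A : V -> V) v : lsubspace S -> lsubspace R -> linear A ->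
  (forall u, S u -> S (A u)) -> fdim_mod S R -> S v ->
  exists k z y, [/\ S z, S y, v = z + A y & R (iter k A z)].
Proof.
move=> SL RL AL AS fS Sv; have [d dep] := fdim_dep SL fS.
have SA k : S (iter k A v) by elim: k => //= k; apply: AS.
have [//|c [[i0 i0d ci0] Rc]] := dep (fun i => iter i A v).
have ex : exists i, c i != 0 by exists i0.
have [k ck0 kmin] := ex_minnP ex.
have kd : (k < d)%N by apply: leq_ltn_trans i0d; apply: kmin.
pose m := (d - k.+1)%N; have dE : d = (k + m.+1)%N by rewrite /m; lia.
exists k, ((c k)^-1 *: \sum_(i < m.+1) c (k + i)%N *: iter i A v),
  (- (c k)^-1 *: \sum_(i < m) c (k + i.+1)%N *: iter i A v); split.
- by apply: lsubZ => //; apply: lsub_sum => // i _; apply: lsubZ.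
- by apply: lsubZ => //; apply: lsub_sum => // i _; apply: lsubZ.
- rewrite (linZ AL) (lin_sum AL) scaleNr -scalerBr big_ord_recl addn0 /=.
  rewrite -addrA -sumrB big1 ?addr0 ?scalerA ?mulVf ?scale1r //.
  by move=> i _; rewrite (linZ AL) subrr.
- have iL := linear_iter k AL.
  rewrite (linZ iL); apply: lsubZ => //; rewrite (lin_sum iL).
  move: Rc; rewrite dE big_split_ord /= big1 ?add0r => [|i _]; last first.
    apply/eqP; rewrite scaler_eq0; apply/orP; left; apply: contraT => /kmin.
    by rewrite leqNgt ltn_ord.
  by congr R; apply: eq_bigr => i _; rewrite (linZ iL) -iterD.
Qed.

Lemma complement S : lsubspace S -> exists C, [/\ lsubspace C,
  forall v, S v -> C v -> v = 0 &
  forall v, exists s c, [/\ S s, C c & v = s + c]].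
Proof.
move=> SL.
pose P C := C = set0 \/ (lsubspace C /\ forall v, S v -> C v -> v = 0).
have [G GP Gtot|A [PA Amax]] := @Zorn_bigcup V P.
  have [[X0 GX0 [x X0x]]|nX] := pselect (exists2 X, G X & X !=set0); last first.
    left; apply/seteqP; split=> // x [X GX Xx]; apply: nX.
    by exists X => //; exists x.
  right; split; last first.
    move=> v Sv [X GX Xv]; have [X0'|[_]] := GP _ GX; last exact.
    by rewrite X0' in Xv.
  split.
    exists X0 => //; have [X0'|[[//]]] := GP _ GX0.
    by rewrite X0' in X0x.
  move=> a u v [X GX Xu] [Y GY Yv].
  wlog XY : X Y GX GY Xu Yv / X `<=` Y => [H|].
    have [XY|YX] := Gtot _ _ GX GY; first exact: H XY.
    exists X => //; have [X'|[[_ XL] _]] := GP _ GX; first by rewrite X' in Xu.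
    by apply: XL => //; apply: YX.
  exists Y => //; have [Y'|[[_ YL] _]] := GP _ GY; first by rewrite Y' in Yv.
  by apply: YL => //; apply: XY.
have [A0|[AL AS]] := PA.
  case: (Amax [set 0]).
    by rewrite A0; split=> // /(_ 0) h; case: h.
  by right; split=> [|v _ //]; apply: lsub_set0.
exists A; split=> // v; apply: contrapT => nv.
case: (Amax [set x | exists a u, A u /\ x = a *: v + u]).
  split=> [u Au|sub]; first by exists 0, u; rewrite scale0r add0r.
  apply: nv; exists 0, v; split; [by case: SL| |by rewrite add0r].
  by apply: sub; exists 1, 0; rewrite scale1r addr0; case: AL.
right; split; [split|].
- by exists 0, 0; rewrite scale0r addr0; case: AL.
- move=> a _ _ [b [u [Au ->]]] [c [w [Aw ->]]]; exists (a * b + c), (a *: u + w).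
  by split; [apply: AL.2|rewrite scalerDr scalerA addrACA scalerDl].
- move=> x Sx [a [u [Au xE]]]; rewrite xE in Sx *.
  have [a0|a0] := eqVneq a 0.
    by move: Sx; rewrite a0 scale0r add0r => /AS; apply.
  case: nv; exists (a^-1 *: (a *: v + u)), (- (a^-1 *: u)); split.
  + exact: lsubZ.
  + by apply: lsubN => //; apply: lsubZ.
  + by rewrite scalerDr scalerK // addrK.
Qed.
End Subspaces.

(** Lets homomorphisms be defined by generating their graph as a submodule of a product. *)
Lemma functional_linear (F : fieldType) (M N : lmodType F) (G : set (M * N)) :
  lsubspace G -> (forall n, G (0, n) -> n = 0) -> (forall m, exists n, G (m, n)) ->
  exists f : M -> N, linear f /\ forall m n, G (m, n) <-> n = f m.
Proof.
move=> GL G0 Gt; have [f fG] := choice Gt.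
have uni m n n' : G (m, n) -> G (m, n') -> n = n'.
  move=> h h'; apply/eqP; rewrite -subr_eq0; apply/eqP/G0.
  by rewrite -(subrr m); apply: (lsubB GL h h').
exists f; split; last by move=> m n; split=> [/uni|->//]; apply.
move=> a u v; apply: (uni (a *: u + v)); first exact: fG.
exact: (GL.2 a (u, f u) (v, f v)) (fG u) (fG v).
Qed.

(** The partial map is continued by zero on a complement of its domain. *)
Lemma functional_extend (F : fieldType) (M N : lmodType F) (G : set (M * N)) :
  lsubspace G -> (forall n, G (0, n) -> n = 0) ->
  exists f : M -> N, linear f /\ forall m n, G (m, n) -> n = f m.
Proof.
move=> GL G0; pose D := [set m | exists n, G (m, n)].
have DL : lsubspace D.
  split; first by exists 0; case: GL.
  move=> a u v [n Gn] [n' Gn']; exists (a *: n + n').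
  exact: (GL.2 a (u, n) (v, n')) Gn Gn'.
have [C [CL DC DCT]] := complement DL.
pose H := [set x : M * N | exists c, C c /\ G (x.1 - c, x.2)].
have [| | |f [fL fH]] := @functional_linear F M N H.
- split; first by exists 0; rewrite /= subr0; split; [case: CL|case: GL].
  move=> a u v [c [Cc Gc]] [c' [Cc' Gc']]; exists (a *: c + c').
  split; first exact: CL.2.
  have := GL.2 a _ _ Gc Gc'; congr G; congr pair => /=.
  by rewrite scalerBr addrACA -opprD.
- move=> n [c [Cc]]; rewrite /= sub0r => Gc.
  have c0 : c = 0.
    apply: (DC) => //; rewrite -[c]opprK; apply: lsubN => //; by exists n.
  by move: Gc; rewrite c0 oppr0; apply: G0.
- move=> m; have [s [c [[n sn] Cc ->]]] := DCT m; exists n, c.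
  by rewrite /= addrK.
exists f; split=> // m n mn; apply/fH; exists 0; rewrite /= subr0.
by split=> //; case: CL.
Qed.

Lemma linear_section (F : fieldType) (E M : lmodType F) (p : E -> M) :
  linear p -> (forall m, exists e, p e = m) ->
  exists s : M -> E, linear s /\ forall m, p (s m) = m.
Proof.
move=> pL ps.
have kL : lsubspace [set e | p e = 0].
  split; first exact: (lin0 pL).
  by move=> a u v /= pu pv; rewrite pL pu pv scaler0 addr0.
have [C [CL KC KCT]] := complement kL.
have [| | |s [sL sC]] := @functional_linear F M E
    [set x | C x.2 /\ p x.2 = x.1].
- split=> [|a u v [Cu pu] [Cv pv]]; first by split; [case: CL|apply: lin0].
  by split; [apply: CL.2|rewrite /= pL pu pv].
- by move=> n [/= Cn /KC]; apply.
- move=> m; have [e pe] := ps m; have [k [c [k0 Cc ec]]] := KCT e.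
  by exists c; split=> //=; rewrite -pe ec linD // k0 add0r.
by exists s; split=> // m; have /sC[] : s m = s m by [].
Qed.

Section Eigenvectors.
Variables (F : closedFieldType) (V : lmodType F) (S : set V) (A : V -> V).

(** A dependency between the iterates of A gives a polynomial p with p(A) v = 0. If a is a root of
    p, either (A - a) z = 0, or (A - a) z is a nonzero vector killed by the quotient of p by X - a;
    so the degree decreases until an eigenvector appears. *)
Lemma stable_eigenvector : linear A -> lsubspace S ->
  (forall u, S u -> S (A u)) -> fdim_mod S [set 0] ->
  (exists2 v, S v & v <> 0) ->
  exists z, [/\ S z, z <> 0 & exists a, A z = a *: z].
Proof.
move=> AL SL AS fS [v Sv v0]; have [d dep] := fdim_dep SL fS.
have SA k : S (iter k A v) by elim: k => //= k; apply: AS.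
have [//|c [[i0 i0d ci0] Rc]] := dep (fun i => iter i A v).
suff H n (p : {poly F}) z : (size p <= n)%N -> p != 0 -> S z -> z <> 0 ->
    \sum_(i < n) p`_i *: iter i A z = 0 ->
    exists z, [/\ S z, z <> 0 & exists a, A z = a *: z].
  apply: (H d (\poly_(i < d) c i) v); [exact: size_poly| |by []|by []|].
    apply/eqP => /(congr1 (fun p : {poly F} => p`_i0)).
    by rewrite coef_poly i0d coef0 => /eqP; rewrite (negPf ci0).
  rewrite -[RHS]Rc; apply: eq_bigr => i _; by rewrite coef_poly ltn_ord.
elim: n p z => [|n IH] p z sp p0 Sz z0 pz.
  by move: sp p0; rewrite leqn0 size_poly_eq0 => ->.
have [/size_poly1P[a a0 pE]|] := boolP (size p == 1)%N.
  move: pz; rewrite big_ord_recl big1 => [|i _]; last first.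
    by rewrite pE coefC scale0r.
  by rewrite pE coefC addr0 => /eqP; rewrite scaler_eq0 (negPf a0) => /eqP.
move=> /closed_rootP[a /factor_theorem[q pE]].
have q0 : q != 0 by apply: contraNneq p0 => q0; rewrite pE q0 mul0r.
have sq : (size q <= n)%N.
  by move: sp; rewrite pE size_Mmonic ?monicXsubC // size_XsubC addn2.
have [e|e] := pselect (A z - a *: z = 0).
  by exists z; split=> //; exists a; apply/eqP; rewrite -subr_eq0 e.
apply: (IH q (A z - a *: z)) => //.
  by apply: lsubB => //; [apply: AS|apply: lsubZ].
rewrite -[RHS]pz pE big_ord_recl /=.
rewrite mulrBr coefB coefMX /= mulrC coefCM sub0r.
have -> : \sum_(i < n) q`_i *: iter i A (A z - a *: z) =
    \sum_(i < n) q`_i *: iter i.+1 A z - \sum_(i < n) (a * q`_i) *: iter i A z.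
  rewrite -sumrB; apply: eq_bigr => i _.
  rewrite (linB (linear_iter i AL)) (linZ (linear_iter i AL)) scalerBr.
  by rewrite scalerA -iterSr mulrC.
have -> : \sum_(i < n) (a * q`_i) *: iter i A z =
    \sum_(i < n.+1) (a * q`_i) *: iter i A z.
  by rewrite big_ord_recr /= [q`_n]nth_default // mulr0 scale0r addr0.
rewrite big_ord_recl /= opprD addrCA scaleNr; congr (_ + _).
rewrite -sumrB; apply: eq_bigr => i _.
by rewrite coefB coefMX /= /bump /= add1n /= coefCM -scalerBl.
Qed.
End Eigenvectors.

(** * Positive definite Hermitian forms *)

Section Forms.
Variables (C : numClosedFieldType) (V : lmodType C).
Implicit Types (B : V -> V -> C) (S : set V).

Definition semiform B := [/\ forall a u v w, B (a *: u + v) w = a * B u w + B v w,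
  forall u v, B v u = (B u v)^* & forall u, 0 <= B u u].

Definition posform B := semiform B /\ forall u, B u u = 0 -> u = 0.

Section Theory.
Variables (B : V -> V -> C).
Hypothesis Bf : semiform B.

Lemma formDl u v w : B (u + v) w = B u w + B v w.
Proof. by case: Bf => BL _ _; rewrite -[u]scale1r BL mul1r scale1r. Qed.
Lemma form0l w : B 0 w = 0.
Proof. by apply: (addrI (B 0 w)); rewrite -formDl !addr0. Qed.
Lemma formZl a u w : B (a *: u) w = a * B u w.
Proof. by case: Bf => BL _ _; rewrite -[a *: u]addr0 BL form0l addr0. Qed.
Lemma formNl u w : B (- u) w = - B u w.
Proof. by rewrite -scaleN1r formZl mulN1r. Qed.
Lemma formBl u v w : B (u - v) w = B u w - B v w.
Proof. by rewrite formDl formNl. Qed.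
Lemma form_suml I (r : seq I) (P : pred I) (g : I -> V) w :
  B (\sum_(i <- r | P i) g i) w = \sum_(i <- r | P i) B (g i) w.
Proof. by elim/big_rec2: _ => [|i u v _ <-]; rewrite ?form0l ?formDl. Qed.
Lemma formC u v : B v u = (B u v)^*.
Proof. by case: Bf. Qed.
Lemma form_ge0 u : 0 <= B u u.
Proof. by case: Bf. Qed.
Lemma formDr u v w : B w (u + v) = B w u + B w v.
Proof. by rewrite formC formDl rmorphD /= -!formC. Qed.
Lemma form0r w : B w 0 = 0.
Proof. by rewrite formC form0l rmorph0. Qed.
Lemma formZr a u w : B w (a *: u) = a^* * B w u.
Proof. by rewrite formC formZl rmorphM /= -formC. Qed.
Lemma form_sumr I (r : seq I) (P : pred I) (g : I -> V) w :
  B w (\sum_(i <- r | P i) g i) = \sum_(i <- r | P i) B w (g i).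
Proof. by elim/big_rec2: _ => [|i u v _ <-]; rewrite ?form0r ?formDr. Qed.
End Theory.

(** An orthonormal family that cannot be lengthened spans S: the residue of z after projection,
    normalized, would extend it. *)
Lemma orthonormal_basis B S : posform B -> lsubspace S -> fdim_mod S [set 0] ->
  exists n (u : nat -> V), [/\ forall i, (i < n)%N -> S (u i),
    forall i j, (i < n)%N -> (j < n)%N -> B (u i) (u j) = (i == j)%:R &
    forall z, S z -> z = \sum_(i < n) B z (u i) *: u i].
Proof.
move=> [Bf Bp] SL fS; have [d dep] := fdim_dep SL fS.
pose Q n := exists u : nat -> V, (forall i, (i < n)%N -> S (u i)) /\
    forall i j, (i < n)%N -> (j < n)%N -> B (u i) (u j) = (i == j)%:R.
have nQd : ~ Q d.
  move=> [u [uS uo]]; have [//|c [[i id /eqP ci]]] := dep u.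
  move=> /(congr1 (B ^~ (u i))); rewrite /= (form0l Bf) (form_suml Bf).
  rewrite (bigD1 (Ordinal id)) //= (formZl Bf) uo // eqxx mulr1 big1 ?addr0 //.
  move=> k ki; rewrite (formZl Bf) uo // [_ == _](_ : _ = false) ?mulr0 //.
  by apply/negbTE.
have [n [Qn nQ]] : exists n, Q n /\ ~ Q n.+1.
  apply: contrapT => nn; apply: nQd; elim: d {dep} => [|d IH].
    by exists (fun=> 0).
  by apply: contrapT => nQ; apply: nn; exists d.
case: Qn => u [uS uo]; exists n, u; split=> // z Sz.
set z' := \sum_(i < n) _; apply/eqP; rewrite -subr_eq0; apply/eqP.
apply: contrapT => zz'; apply: nQ.
have zu j : (j < n)%N -> B (z - z') (u j) = 0.
  move=> jn; rewrite (formBl Bf) (form_suml Bf) (bigD1 (Ordinal jn)) //=.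
  rewrite (formZl Bf) uo // eqxx mulr1 big1 ?addr0 ?subrr // => i ij.
  by rewrite (formZl Bf) uo // [_ == _](negbTE ij) mulr0.
have s0 : B (z - z') (z - z') != 0 by apply/eqP => /Bp.
pose w := (sqrtC (B (z - z') (z - z')))^-1 *: (z - z').
have ww : B w w = 1.
  rewrite (formZl Bf) (formZr Bf) fmorphV /=.
  rewrite (CrealP (ger0_real _)) ?sqrtC_ge0 ?(form_ge0 Bf) // mulrA -invfM.
  by rewrite -expr2 sqrtCK mulVf.
have wu j : (j < n)%N -> B w (u j) = 0.
  by move=> /zu; rewrite (formZl Bf) => ->; rewrite mulr0.
exists (fun i => if i == n then w else u i); split=> [i|i j].
  rewrite ltnS leq_eqVlt; case: eqP => [_ _|_ /uS//]; apply: lsubZ => //.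
  by apply: lsubB => //; apply: lsub_sum => // k _; apply: lsubZ => //; apply: uS.
rewrite !ltnS (leq_eqVlt i) (leq_eqVlt j); have [->|ni] := eqVneq i n;
  have [->|nj] := eqVneq j n => /=.
- by rewrite ww.
- by move=> _ jn; rewrite wu // eq_sym (negbTE nj).
- by move=> iN _; rewrite (formC Bf) wu // conjC0 (negbTE ni).
- exact: uo.
Qed.

Lemma orthogonal_projection B S : posform B -> lsubspace S ->
  fdim_mod S [set 0] -> forall z, exists q,
    S q /\ forall s, S s -> B (z - q) s = 0.
Proof.
move=> Bp SL fS; have [n [u [uS uo uB]]] := orthonormal_basis Bp SL fS.
have Bf := Bp.1; move=> z; exists (\sum_(i < n) B z (u i) *: u i); split.
  by apply: lsub_sum => // i _; apply: lsubZ => //; apply: uS.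
move=> s /uB ->; rewrite (form_sumr Bf) big1 // => j _; rewrite (formZr Bf).
rewrite (formBl Bf) (form_suml Bf) (bigD1 j) //= (formZl Bf) uo // eqxx mulr1.
rewrite big1 ?addr0 ?subrr ?mulr0 // => i ij.
by rewrite (formZl Bf) uo // [_ == _](negbTE ij) mulr0.
Qed.
End Forms.

Section Subl.
Variables (F : fieldType) (V : lmodType F) (S : set V) (HS : lsubspace S).

(** The proof that S is a subspace is kept as an argument, so that inference of the module structure
    on [subl HS] can recover it from the predicate. *)
Definition subl_pred of lsubspace S : {pred V} := [pred v | `[< S v >]].

Record subl := Subl { subl_val :> V; sublP : subl_val \in subl_pred HS }.

HB.instance Definition _ := [isSub for subl_val].
HB.instance Definition _ := [Choice of subl by <:].

Lemma subl_closed : submod_closed (subl_pred HS).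
Proof.
split; first by apply/asboolP; case: HS.
move=> a f g /asboolP fn /asboolP gn; apply/asboolP; exact: (HS.2).
Qed.

HB.instance Definition _ :=
  GRing.isSubmodClosed.Build F V (subl_pred HS) subl_closed.
HB.instance Definition _ := [SubChoice_isSubLmodule of subl by <:].

Lemma subl_mem (u : subl) : S u.
Proof. by case: u => u /= /asboolP. Qed.

Definition subl_of v (Sv : S v) : subl := Subl (asboolT Sv).

Lemma subl_inj (u v : subl) : (u : V) = v -> u = v.
Proof. exact: val_inj. Qed.

Lemma subl_lin a (u v : subl) :
  subl_val (a *: u + v) = a *: subl_val u + subl_val v.
Proof. by []. Qed.
End Subl.

(** * Bases *)

Section Bases.
Variables (F : fieldType) (V : lmodType F).
Implicit Types A B : set V.

Definition lspan B : set V := [set v | forall S, lsubspace S -> B `<=` S -> S v].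

Lemma lspan_lsub B : lsubspace (lspan B).
Proof.
split=> [S [S0 _] _ //|a u v uB vB S SL BS].
by apply: SL.2; [apply: uB|apply: vB].
Qed.

Lemma lspan_sub B : B `<=` lspan B.
Proof. by move=> v Bv S _; apply. Qed.

Lemma lspanS A B : A `<=` B -> lspan A `<=` lspan B.
Proof. by move=> AB v vA S SL BS; apply: vA => // u /AB; apply: BS. Qed.

Definition independent B := forall v, B v -> ~ lspan (B `\ v) v.

(** Zorn's lemma is applied to the sets A with A ∪ B0 independent, a family that contains the empty
    union because B0 is independent. *)
Lemma independent_extend B0 : independent B0 -> exists B,
  [/\ B0 `<=` B, independent B & lspan B = [set: V]].
Proof.
move=> B0I; have [G GP Gtot|A [AI Amax]] := @Zorn_bigcup V [set A | independent (A `|` B0)].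
  move=> v Gv vspan.
  have [A0 GA0 A0v] : exists2 A, A = set0 \/ G A & (A `|` B0) v.
    by case: Gv => [[A GA Av]|B0v]; [exists A; [right|left]|exists set0; [left|right]].
  have GPI A : A = set0 \/ G A -> independent (A `|` B0).
    by case=> [->|/GP //]; rewrite set0U.
  have tot A A' : A = set0 \/ G A -> A' = set0 \/ G A' -> A `<=` A' \/ A' `<=` A.
    move=> [->|GA]; first by left.
    by case=> [->|GA']; [right|apply: Gtot].
  suff [A [GA A0A vA]] : exists A, [/\ A = set0 \/ G A, A0 `<=` A & lspan ((A `|` B0) `\ v) v].
    apply: (GPI A GA) vA; case: A0v => [/A0A|]; [by left|by right].
  have join A A' : A = set0 \/ G A -> A' = set0 \/ G A' ->
      exists A'', [/\ A'' = set0 \/ G A'', A `<=` A'' & A' `<=` A''].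
    by move=> GA GA'; case: (tot A A' GA GA') => AA'; [exists A'|exists A]; split.
  (* Spans involve finitely many vectors, so a dependency in the union already holds in one member
     of the chain. In terms of subspaces: T is one, because two members of the chain lie in a common
     third. *)
  pose T := [set u | exists A, [/\ A = set0 \/ G A, A0 `<=` A & lspan ((A `|` B0) `\ v) u]].
  apply: (vspan T) => [|u [[[A GA Au]|B0u] uv]].
  - split; first by exists A0; split=> //; case: (lspan_lsub ((A0 `|` B0) `\ v)).
    move=> a u u' [A [GA A0A Au]] [A' [GA' A0A' Au']].
    have [A'' [GA'' AA'' A'A'']] := join A A' GA GA'; exists A''; split=> //.
      by apply: subset_trans AA''.
    have mono C : C `<=` A'' -> (C `|` B0) `\ v `<=` (A'' `|` B0) `\ v.
      by move=> CA w [[/CA ?|?] wv]; split=> //; [left|right].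
    apply: (lspan_lsub _).2; [exact: lspanS (mono _ AA'') _ Au|exact: lspanS (mono _ A'A'') _ Au'].
  - have [A' [GA' AA' A0A']] := join A A0 (or_intror GA) GA0; exists A'; split=> //.
    by apply: lspan_sub; split=> //; left; apply: AA'.
  - exists A0; split=> //; apply: lspan_sub; split=> //; by right.
set B := A `|` B0 in AI; exists B; split=> //; first by move=> v; right.
apply/seteqP; split=> // v _; apply: contrapT => nv.
have nBv : ~ B v by move=> /lspan_sub.
apply: (Amax (A `|` [set v])).
  split; first by move=> u; left.
  by move=> /(_ v (or_intror erefl)) Av; apply: nBv; left.
rewrite /= (setUAC A [set v] B0) -/B.
move=> u uBv uspan; have [uv|uv] := pselect (u = v).
  by rewrite uv in uspan; apply: nv; apply: lspanS uspan => w [[]].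
have Bu : B u by case: uBv => // /uv.
have BL := lspan_lsub (B `\ u).
(* Exchange: if a is nonzero, v lies in the span of B, and otherwise u depends on the rest of B;
   both are excluded. *)
have [s [a [sB uE]]] : exists s a, lspan (B `\ u) s /\ u = s + a *: v.
  pose T := [set w | exists s a, lspan (B `\ u) s /\ w = s + a *: v].
  apply: (uspan T) => [|w [[Bw|->] wu]].
  - split; first by exists 0, 0; rewrite scale0r addr0; split=> //; case: BL.
    move=> c _ _ [s [a [sB ->]]] [s' [a' [sB' ->]]].
    exists (c *: s + s'), (c * a + a'); split; first exact: BL.2.
    by rewrite scalerDr scalerDl scalerA addrACA.
  - by exists w, 0; rewrite scale0r addr0; split=> //; apply: lspan_sub.
  - by exists 0, 1; rewrite scale1r add0r; split=> //; case: BL.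
have [a0|a0] := eqVneq a 0.
  by apply: (AI u Bu); rewrite {2}uE a0 scale0r addr0.
have BL' := lspan_lsub B; have vE : v = a^-1 *: (u - s).
  by rewrite uE addrAC subrr add0r scalerK.
apply: nv; rewrite vE; apply: (lsubZ _ BL' (lsubB BL' _ _)); first exact: lspan_sub.
by apply: lspanS sB => w [].
Qed.

Definition combination B (c : V -> F) v := [/\ finite_set [set b | c b != 0],
  (forall b, c b != 0 -> B b) & v = \sum_(b \in B) c b *: b].

Lemma combination_lin B a c c' u v : combination B c u -> combination B c' v ->
  combination B (fun b => a * c b + c' b) (a *: u + v).
Proof.
move=> [fc cB ->] [fc' cB' ->]; pose D := [set b | c b != 0] `|` [set b | c' b != 0].
have Df : finite_set D by rewrite finite_setU.
have DB : D `<=` B by move=> w [/cB|/cB'].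
have nD w : ~ D w -> c w = 0 /\ c' w = 0.
  move=> nw; split; apply/eqP; apply: contrapT => h; apply: nw; [left|right]; exact/negP.
have sumE d : (forall w, ~ D w -> d w = 0) ->
    \sum_(b \in B) d b *: b = \sum_(b \in D) d b *: b.
  move=> dD; apply/esym/fsbig_widen => // w [_ /dD] /= ->.
  by rewrite scale0r.
split.
- apply: sub_finite_set Df => w /= h; apply: contrapT => /nD[cw c'w].
  by move: h; rewrite cw c'w mulr0 addr0 eqxx.
- move=> w h; apply: DB; apply: contrapT => /nD[cw c'w].
  by move: h; rewrite cw c'w mulr0 addr0 eqxx.
rewrite !sumE => [||w /nD[]|w /nD[]] //; last by move=> w /nD[-> ->]; rewrite mulr0 addr0.
rewrite !fsbig_finite // scaler_sumr -big_split; apply: eq_bigr => w _ /=.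
by rewrite scalerDl scalerA.
Qed.

Lemma combination_span B v : lspan B v -> exists c, combination B c v.
Proof.
move=> vB; apply: (vB [set v | exists c, combination B c v]) => [|w Bw].
  split; last first.
    by move=> a u w [c uE] [c' wE]; exists (fun b => a * c b + c' b); apply: combination_lin.
  exists (fun=> 0); split=> [|b|]; rewrite ?eqxx //.
    by apply: (sub_finite_set (B := set0)) => // b /=; rewrite eqxx.
  by rewrite fsbig1 // => b _; rewrite scale0r.
exists (fun b => (b == w)%:R); split.
- apply: (sub_finite_set (B := [set w])); last exact: finite_set1.
  by move=> b /=; have [->//|_] := eqVneq b w; rewrite eqxx.
- by move=> b; have [->//|_] := eqVneq b w; rewrite eqxx.
rewrite -(@fsbig_widen _ _ 0 _ [set w] B) => [||b [_ /=]].
- by rewrite fsbig_set1 eqxx scale1r.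
- by move=> b ->.
- by move=> /eqP/negbTE ->; rewrite scale0r.
Qed.

Lemma independent_basis B : independent B -> lspan B = [set: V] -> is_basis B.
Proof.
move=> BI BT v; have [c cE] : exists c, combination B c v.
  by apply: combination_span; rewrite BT.
exists c; split=> // c' c'E.
have := combination_lin (-1) cE c'E; rewrite scaleN1r addNr.
set d : V -> F := fun b => _; move=> [fd dB d0].
suff dz w : d w = 0.
  apply/funext => w; have := dz w; rewrite /d /= mulN1r addrC => /eqP.
  by rewrite subr_eq0 eq_sym => /eqP.
apply: contrapT => /eqP dw; apply: (BI w (dB _ dw)).
pose D := [set b | d b != 0]; have BwL := lspan_lsub (B `\ w).
have : d w *: w + \sum_(b \in D `\ w) d b *: b = 0.
  apply: etrans (esym (fsbigD1 w D (fun b => d b *: b) fd dw)) _.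
  apply: etrans (esym d0); apply: fsbig_widen => // b [_ /= /negP].
  by rewrite negbK => /eqP->; rewrite scale0r.
move=> /eqP; rewrite addr_eq0 => /eqP e.
suff : lspan (B `\ w) ((d w)^-1 *: - (\sum_(b \in D `\ w) d b *: b)).
  by rewrite -e scalerK.
apply: (lsubZ _ BwL (lsubN BwL _)); rewrite fsbig_finite; last first.
  by apply: sub_finite_set fd => b [].
rewrite big_seq; apply: lsub_sum => // b; rewrite in_fset_set; last first.
  by apply: sub_finite_set fd => b' [].
rewrite inE => -[/dB Bb bw]; apply: (lsubZ _ BwL); apply: lspan_sub; by split.
Qed.
End Bases.

(** * Finitary matrices *)

Section Matrices.
Variable F : fieldType.
Implicit Types x y z : glinf F.

Lemma glinfP x y : (forall a b, x a b = y a b) -> x = y.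
Proof. by move=> xy; apply: fseqP => a; apply: fseqP => b; apply: xy. Qed.

Lemma gl_lin a x y i j : (a *: x + y : glinf F) i j = a * (x i j : F) + y i j.
Proof. by rewrite (fseq_lin a x y) (fseq_lin a (x i) (y i)). Qed.

Lemma gl0 i j : (0 : glinf F) i j = 0.
Proof. by []. Qed.

Lemma glB x y i j : (x - y : glinf F) i j = (x i j : F) - y i j.
Proof.
have -> : x - y = (-1) *: y + x by rewrite scaleN1r addrC.
by rewrite gl_lin mulN1r addrC.
Qed.

Definition gl_of_row n (r : 'rV[F]_n) (b : nat) : F^o :=
  if insub b is Some j then r 0 j else 0.

Lemma gl_of_row_subproof n (r : 'rV[F]_n) : gl_of_row r \in @fsupp F F^o.
Proof.
apply/asboolP; exists n => k nk; rewrite /gl_of_row insubF //.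
by rewrite ltnNge nk.
Qed.

Definition gl_of_fun n (A : 'M[F]_n) (a : nat) : fseq F^o :=
  if insub a is Some i then FSeq (gl_of_row_subproof (row i A)) else 0.

Lemma gl_of_subproof n (A : 'M[F]_n) : gl_of_fun A \in @fsupp F (fseq F^o).
Proof.
apply/asboolP; exists n => k nk; rewrite /gl_of_fun insubF //.
by rewrite ltnNge nk.
Qed.

Definition gl_of n (A : 'M[F]_n) : glinf F := FSeq (gl_of_subproof A).

Lemma gl_ofE n (A : 'M[F]_n) (i j : 'I_n) : gl_of A i j = A i j.
Proof. by rewrite /= /gl_of_fun valK /= /gl_of_row valK mxE. Qed.

Lemma gl_of_corner n (A : 'M[F]_n) : in_corner n (gl_of A).
Proof.
move=> a b ab; rewrite /= /gl_of_fun.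
case: insubP => [i ai _|//]; rewrite /= /gl_of_row.
case: insubP => [j bj _|//]; move: ab; rewrite leqNgt ai /= leqNgt.
by rewrite (_ : (b < n)%N).
Qed.

Lemma corner_gl_of n (A : 'M[F]_n) : corner n (gl_of A) = A.
Proof. by apply/matrixP => i j; rewrite mxE gl_ofE. Qed.

Lemma in_cornerP n x y : in_corner n x -> in_corner n y ->
  corner n x = corner n y -> x = y.
Proof.
move=> xn yn /matrixP xy; apply: glinfP => a b.
have [na|an] := leqP n a; first by rewrite xn ?yn ?na.
have [nb|bn] := leqP n b; first by rewrite xn ?yn ?nb ?orbT.
by have := xy (Ordinal an) (Ordinal bn); rewrite !mxE.
Qed.

Lemma corner_lin n a x y : corner n (a *: x + y) = a *: corner n x + corner n y.
Proof. by apply/matrixP => i j; rewrite !mxE gl_lin. Qed.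

Lemma in_corner_lin n a x y :
  in_corner n x -> in_corner n y -> in_corner n (a *: x + y).
Proof. by move=> xn yn i j ij; rewrite gl_lin xn // yn // mulr0 addr0. Qed.

Lemma in_corner0 n : in_corner n (0 : glinf F).
Proof. by move=> i j _; rewrite gl0. Qed.

Lemma in_cornerS n m x : (n <= m)%N -> in_corner n x -> in_corner m x.
Proof.
by move=> nm xn a b /orP ab; apply: xn; case: ab => /(leq_trans nm) ->;
  rewrite ?orbT.
Qed.

Lemma in_corner_common x y z : exists n,
  [/\ in_corner n x, in_corner n y & in_corner n z].
Proof.
have [n xn] := glinf_bound x; have [m ym] := glinf_bound y.
have [k zk] := glinf_bound z; exists (maxn n (maxn m k)).
split; [apply: in_cornerS xn|apply: in_cornerS ym|apply: in_cornerS zk]; lia.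
Qed.

Lemma glmul_corner n x y : in_corner n x -> in_corner n y ->
  in_corner n (glmul x y).
Proof.
move=> xn yn a b ab; rewrite glmulE; apply: fsbig1 => c _.
case/orP: ab => ab; first by rewrite xn ?ab // mul0r.
by rewrite (yn c b) ?ab ?orbT // mulr0.
Qed.

Lemma corner_mul n x y : in_corner n x ->
  corner n (glmul x y) = corner n x *m corner n y.
Proof.
move=> xn; apply/matrixP => i j; rewrite !mxE glmulE.
rewrite (@fsbig_bound _ F^o _ n) => [|c nc]; last by rewrite xn ?nc ?orbT // mul0r.
by apply: eq_bigr => c _; rewrite !mxE.
Qed.

Lemma glbr_corner n x y : in_corner n x -> in_corner n y ->
  in_corner n (glbr x y).
Proof.
by move=> xn yn a b ab; rewrite glB !(glmul_corner xn yn, glmul_corner yn xn) ?subr0.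
Qed.

Lemma corner_br n x y : in_corner n x -> in_corner n y ->
  corner n (glbr x y) = corner n x *m corner n y - corner n y *m corner n x.
Proof.
move=> xn yn; rewrite -!corner_mul //; apply/matrixP => i j.
by rewrite !mxE glB.
Qed.

Lemma glbr_linr x : linear (glbr x).
Proof.
move=> a y z; have [n [xn yn zn]] := in_corner_common x y z.
apply: (@in_cornerP n); [|apply: in_corner_lin|].
- by apply: glbr_corner => //; apply: in_corner_lin.
- exact: glbr_corner.
- exact: glbr_corner.
rewrite corner_lin !corner_br ?corner_lin //; last exact: in_corner_lin.
rewrite mulmxDr mulmxDl -scalemxAl -scalemxAr scalerBr addrACA -opprD //.
Qed.

Lemma glbrC x y : glbr y x = - glbr x y.
Proof. by rewrite /glbr opprB. Qed.

Lemma glbr_linl a x y z : glbr (a *: x + y) z = a *: glbr x z + glbr y z.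
Proof.
rewrite glbrC glbr_linr (glbrC z x) (glbrC z y).
by rewrite !scalerN !opprD !opprK.
Qed.

Lemma glbr_jacobi x y z :
  glbr (glbr x y) z = glbr x (glbr y z) - glbr y (glbr x z).
Proof.
have [n [xn yn zn]] := in_corner_common x y z.
have -> : glbr x (glbr y z) - glbr y (glbr x z) =
    (-1) *: glbr y (glbr x z) + glbr x (glbr y z) by rewrite scaleN1r addrC.
apply: (@in_cornerP n); first by do 2!apply: glbr_corner => //.
  by apply: in_corner_lin; do 2!apply: glbr_corner => //.
rewrite corner_lin !corner_br //; do ?exact: glbr_corner.
rewrite scaleN1r !mulmxBr !mulmxBl !mulmxA.
set A := corner n x; set B := corner n y; set D := corner n z.
move: (A *m B *m D) (B *m A *m D) (D *m A *m B) (D *m B *m A)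
  (A *m D *m B) (B *m D *m A) => p q r s t u.
by apply/matrixP => i j; rewrite !mxE; ring.
Qed.
End Matrices.

(** * Lie algebras of finitary matrices and their modules *)

Section LieModules.
Variables (F : fieldType).
Implicit Types (K : set (glinf F)).

Lemma lactN K (M : lieModule K) x (u : M) : lact x (- u) = - lact x u.
Proof. exact: linN (lact_linear x) _. Qed.

Lemma lactB K (M : lieModule K) x (u v : M) : lact x (u - v) = lact x u - lact x v.
Proof. exact: linB (lact_linear x) _ _. Qed.

Lemma lact_sum K (M : lieModule K) x I (r : seq I) (P : pred I) (g : I -> M) :
  lact x (\sum_(i <- r | P i) g i) = \sum_(i <- r | P i) lact x (g i).
Proof. exact: (lin_sum (lact_linear x)). Qed.

Section Scalars.
Variables (K : set (glinf F)) (M : lieModule K).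
Hypothesis KL : lsubspace K.

Lemma lact0l (v : M) : lact 0 v = 0.
Proof.
have K0 := KL.1; have := lact_lin 1 v K0 K0.
by rewrite !scale1r addr0 => /esym e; apply: (addrI (lact 0 v)); rewrite e addr0.
Qed.

Lemma lactZl a x (v : M) : K x -> lact (a *: x) v = a *: lact x v.
Proof.
by move=> Kx; rewrite -[a *: x]addr0 lact_lin ?lact0l ?addr0 //; case: KL.
Qed.

Lemma lactDl x y (v : M) : K x -> K y -> lact (x + y) v = lact x v + lact y v.
Proof. by move=> Kx Ky; rewrite -[x]scale1r lact_lin // !scale1r. Qed.

Lemma lact_suml I (r : seq I) (P : pred I) (g : I -> glinf F) (v : M) :
  (forall i, P i -> K (g i)) ->
  lact (\sum_(i <- r | P i) g i) v = \sum_(i <- r | P i) lact (g i) v.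
Proof.
move=> Kg; elim: r => [|i r IH]; first by rewrite !big_nil lact0l.
rewrite !big_cons; case: ifP => // Pi; rewrite lactDl ?IH ?Kg //.
  exact: Kg.
by apply: lsub_sum.
Qed.
End Scalars.

Definition resm K K' (KK' : K `<=` K') (M : lieModule K') : lieModule K :=
  @LieModule F K M (@lact _ _ M) (@lact_linear _ _ M)
    (fun a x y v Kx Ky => lact_lin a v (KK' _ Kx) (KK' _ Ky))
    (fun x y v Kx Ky => lact_br v (KK' _ Kx) (KK' _ Ky)).

Definition adj_mod K : lieModule K :=
  @LieModule F K (glinf F) (@glbr F) (@glbr_linr F)
    (fun a x y v _ _ => glbr_linl a x y v) (fun x y v _ _ => glbr_jacobi x y v).

(* K-stable subspaces of modules over a possibly larger algebra K0 *)
Definition stable K K0 (M : lieModule K0) (S : set M) :=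
  forall x v, K x -> S v -> S (lact x v).

(** The cyclic module U(K) v. As an intersection of stable subspaces it carries its own induction
    principle: a membership proof is applied to the set whose stability is to be checked. *)
Definition gen K K0 (M : lieModule K0) (v : M) : set M :=
  [set z | forall S, lsubspace S -> stable K S -> S v -> S z].

Section Gen.
Variables (K K0 : set (glinf F)) (M : lieModule K0).
Implicit Types (v z : M) (S : set M).

Lemma gen_id v : gen K v v.
Proof. by move=> S. Qed.

Lemma gen_lsub v : lsubspace (gen K v).
Proof.
split; first by move=> S SL _ _; case: SL.
by move=> a u w gu gw S SL KS Sv; apply: SL.2; [apply: gu|apply: gw].
Qed.

Lemma gen_stable v : stable K (gen K v).
Proof. by move=> x z Kx gz S SL KS Sv; apply: (KS) => //; apply: gz. Qed.

Lemma gen_min v S : lsubspace S -> stable K S -> S v -> gen K v `<=` S.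
Proof. by move=> SL KS Sv z; apply. Qed.

Lemma gen_trans v z : gen K v z -> gen K z `<=` gen K v.
Proof. by apply: gen_min; [apply: gen_lsub|apply: gen_stable]. Qed.
End Gen.

Lemma genS K K' K0 (M : lieModule K0) (v : M) : K `<=` K' -> gen K v `<=` gen K' v.
Proof.
move=> KK'; apply: gen_min; [exact: gen_lsub| |exact: gen_id].
by move=> x z /KK'; apply: gen_stable.
Qed.
End LieModules.

Section Bracket.
Variable F : fieldType.
Implicit Types A B S : set (glinf F).

Lemma brspan_sub A B : subspace (brspan A B).
Proof.
split; first by move=> S [].
by move=> a x y Ax Ay S SL h; apply: SL.2; [apply: Ax|apply: Ay].
Qed.

Lemma brspan_br A B x y : A x -> B y -> brspan A B (glbr x y).
Proof. by move=> Ax By S _; apply. Qed.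

Lemma brspan_min A B S : subspace S ->
  (forall x y, A x -> B y -> S (glbr x y)) -> brspan A B `<=` S.
Proof. by move=> SL h z; apply. Qed.

Lemma brspanSS A B A' B' : A `<=` A' -> B `<=` B' -> brspan A B `<=` brspan A' B'.
Proof.
move=> AA BB; apply: brspan_min; first exact: brspan_sub.
by move=> x y /AA Ax /BB By; apply: brspan_br.
Qed.

Lemma derived_sub S : subalgebra S -> brspan S S `<=` S.
Proof. by move=> [SL Sbr]; apply: brspan_min. Qed.

Lemma derived_subalgebra S : subalgebra S -> subalgebra (brspan S S).
Proof.
move=> SS; split; first exact: brspan_sub.
by move=> x y /(derived_sub SS) Sx /(derived_sub SS) Sy; apply: brspan_br.
Qed.
End Bracket.

(** * Lie's theorem *)

Section LieTheorem.
Variable F : numClosedFieldType.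

(* The span of the w, x w, ..., x^(r-1) w is stable under d, which acts on
   it by a triangular matrix with diagonal chi d; comparing the coefficients
   of x^(r-1) w in d (x^r w) replaces the usual trace argument. *)
Lemma krylov_weight (S : set (glinf F)) (M : lieModule S) (U : set M)
    (D : set (glinf F)) x (w : M) (chi : glinf F -> F) :
  lsubspace U -> fdim_mod U [set 0] -> S x ->
  (forall u, U u -> U (lact x u)) -> U w -> w <> 0 ->
  D `<=` S -> (forall d, D d -> D (glbr d x)) ->
  (forall d, D d -> lact d w = chi d *: w) ->
  forall d, D d -> chi (glbr d x) = 0.
Proof.
move=> UL fU Sx xU Uw w0 DS Dx Dw d Dd.
pose X := @lact _ _ M x; pose v k := iter k X w.
have XL : linear X := lact_linear x.
have Uv k : U (v k) by elim: k => //= k; apply: xU.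
pose L r := [set u | exists c : nat -> F, u = \sum_(j < r) c j *: v j].
have LL r : lsubspace (L r).
  split; first by exists (fun=> 0); rewrite big1 // => j _; rewrite scale0r.
  move=> a _ _ [c ->] [c' ->]; exists (fun j => a * c j + c' j).
  rewrite scaler_sumr -big_split; apply: eq_bigr => j _.
  by rewrite scalerDl scalerA.
have LS r : L r `<=` L r.+1.
  move=> _ [c ->]; exists (fun j => if (j < r)%N then c j else 0).
  rewrite big_ord_recr /= ltnn scale0r addr0; apply: eq_bigr => j _.
  by rewrite ltn_ord.
have Lmono q r u : (q <= r)%N -> L q u -> L r u.
  elim: r => [|r IH]; first by rewrite leqn0 => /eqP->.
  by rewrite leq_eqVlt => /orP[/eqP->//|/IH h /h]; apply: LS.
have LX r u : L r u -> L r.+1 (X u).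
  move=> [c ->]; exists (fun j => if j is k.+1 then c k else 0).
  rewrite big_ord_recl scale0r add0r (lin_sum XL); apply: eq_bigr => j _.
  by rewrite (linZ XL).
have Lv r : L r.+1 (v r).
  exists (fun j => (j == r)%:R); rewrite big_ord_recr /= eqxx scale1r.
  rewrite big1 ?add0r // => j _; by rewrite (ltn_eqF (ltn_ord j)) scale0r.
have LkS k u : L k.-1 u -> L k u by case: k => // k; apply: LS.
have J k : forall d', D d' -> exists2 l, L k.-1 l & lact d' (v k) =
    chi d' *: v k + (k%:R * chi (glbr d' x)) *: v k.-1 + l.
  elim: k => [|k IH] d' Dd'.
    by exists 0; [case: (LL 0%N)|rewrite mul0r scale0r !addr0 Dw].
  have [l Ll lE] := IH _ Dd'; have [l' Ll' l'E] := IH _ (Dx _ Dd').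
  exists (X l + ((k%:R * chi (glbr (glbr d' x) x)) *: v k.-1 + l')).
    apply: lsubD => //; first case: k {lE IH Ll' l'E} Ll => [[c ->]|k /LX//].
      by rewrite big_ord0 (lin0 XL); case: (LL 0%N).
    apply: lsubD => //; last exact: LkS.
    case: k {lE IH Ll Ll' l'E} => [|k]; last by apply: lsubZ => //; apply: Lv.
    by rewrite mul0r scale0r; case: (LL 0%N).
  have -> : lact d' (v k.+1) = X (lact d' (v k)) + lact (glbr d' x) (v k).
    by rewrite lact_br ?DS //; [rewrite addrC subrK|apply: DS].
  rewrite lE l'E !(linD XL) !(linZ XL) -!addrA; congr (_ + _).
  have -> : (k%:R * chi (glbr d' x)) *: X (v k.-1) = (k%:R * chi (glbr d' x)) *: v k.
    by case: (k) => //; rewrite mul0r !scale0r.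
  by rewrite [X in _ + X]addrCA addrA -scalerDl -[in RHS]natr1 mulrDl mul1r.
have [r [Lr rmin]] : exists r, L r (v r) /\ forall k, L k (v k) -> (r <= k)%N.
  have [m dep] := fdim_dep UL fU.
  have [//|c [[i0 i0m ci0] /= Rc]] := dep v.
  have ex : exists r, `[< L r (v r) >].
    apply: contrapT => nL; move/eqP: ci0; apply.
    have {}nL r : ~ L r (v r) by move=> h; apply: nL; exists r; apply/asboolP.
    elim: m i0 i0m Rc {dep} => // m IH i0 i0m; rewrite big_ord_recr /=.
    have [cm0|cm0] := eqVneq (c m) 0.
      rewrite cm0 scale0r addr0 => /IH h; move: i0m; rewrite ltnS leq_eqVlt.
      by case/orP => [/eqP->|/h].
    move=> /eqP; rewrite addrC addr_eq0 => /eqP e; case: (nL m).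
    rewrite -[v m](scalerK cm0) e; apply: lsubZ => //; apply: lsubN => //.
    by exists c.
  have [r /asboolP Lr rmin] := ex_minnP ex.
  by exists r; split=> // k Lk; apply: rmin; apply/asboolP.
case: r Lr rmin => [[c]|r Lr rmin]; first by rewrite big_ord0 /= => /w0.
have nLr : ~ L r (v r) by move=> /rmin; rewrite ltnn.
have [l Ll lE] := J r.+1 _ Dd.
have : L r (lact d (v r.+1) - chi d *: v r.+1).
  have [c cE] := Lr; rewrite {2}cE {1}cE lact_sum scaler_sumr -sumrB.
  apply: lsub_sum => // j _; rewrite lactZ scalerA mulrC -scalerA -scalerBr.
  apply: lsubZ => //; have [l' Ll' ->] := J j _ Dd.
  have LjS u : L j u -> L r u by apply: Lmono; rewrite -ltnS.
  rewrite -(addrA (chi d *: v j)) addrAC subrr add0r.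
  apply: lsubD => //; last exact/LjS/LkS.
  apply: LjS; case: (nat_of_ord j) => [|k]; last by apply: lsubZ => //; apply: Lv.
  by rewrite mul0r scale0r; case: (LL 0%N).
rewrite lE -(addrA (chi d *: v r.+1)) addrAC subrr add0r => h.
apply: contrapT => /eqP chi0; apply: nLr.
have k0 : r.+1%:R * chi (glbr d x) != 0 by rewrite mulf_neq0 // pnatr_eq0.
rewrite -[v r](scalerK k0); apply: lsubZ => //.
by rewrite -[_ *: _](addrK l); apply: lsubB.
Qed.

(** Replaces the remark that a commutator has trace zero. An eigenvector w of x is a common
    eigenvector of the set D below, which is stable under the bracket with y because [d, y] acts by
    a scalar; [krylov_weight] then shows that [x, y] has eigenvalue 0 on w. *)
Lemma commutator_scalar (S : set (glinf F)) (M : lieModule S) (U : set M) x y c :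
  lsubspace S -> lsubspace U -> fdim_mod U [set 0] -> S x -> S y ->
  (forall a b, S a -> S b -> S (glbr a b)) -> stable S U ->
  (exists2 u, U u & u <> 0) ->
  (forall u, U u -> lact (glbr x y) u = c *: u) -> c = 0.
Proof.
move=> SL UL fU Sx Sy Sbr SU nU cE.
have [w [Uw w0 [a xw]]] := stable_eigenvector (lact_linear (l := M) x) UL
  (fun u => SU x u Sx) fU nU.
pose D := [set d | [/\ S d, exists b, lact d w = b *: w &
  exists c', forall u, U u -> lact (glbr d y) u = c' *: u]].
have Dx : D x by split=> //; [exists a|exists c].
have Dbr d : D d -> D (glbr d y).
  move=> [Sd [b dw] [c' dyu]]; split; [exact: Sbr|by exists c'; apply: dyu|].
  exists 0 => u Uu; rewrite lact_br //; last exact: Sbr.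
  by rewrite !dyu //; [rewrite lactZ subrr scale0r|apply: SU].
pose chi d := xget 0 [set b | lact d w = b *: w].
have chiP d : D d -> lact d w = chi d *: w.
  by move=> [_ [b dw] _]; rewrite /chi; case: xgetP => [b' _ //|/(_ b)]; case.
have := krylov_weight UL fU Sy (fun u => SU y u Sy) Uw w0 (fun d => fun h : D d => let: And3 h1 _ _ := h in h1) Dbr chiP Dx.
move=> chi0; have := chiP _ (Dbr _ Dx); rewrite chi0 scale0r cE // => /eqP.
by rewrite scaler_eq0 => /orP[/eqP//|/eqP/w0].
Qed.

(** Induction on the derived length inside a minimal nonzero stable subspace U. The weight space of
    [S, S] found by induction is S-stable, hence all of U; so brackets act on U by scalars, and
    these scalars vanish. Then each eigenspace in U of an element of S is stable, hence equal to U,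
    and every nonzero vector of U will do. *)
Theorem lie_theorem k : forall (S : set (glinf F)) (M : lieModule S) (V : set M),
  subalgebra S -> iter k (fun D => brspan D D) S `<=` [set 0] ->
  lsubspace V -> stable S V -> fdim_mod V [set 0] ->
  (exists2 v, V v & v <> 0) ->
  exists z, [/\ V z, z <> 0 & forall x, S x -> exists a, lact x z = a *: z].
Proof.
elim: k => [|k IH] S M V SS S0 VL SV fV nV.
  have [v Vv v0] := nV; exists v; split=> // x /S0 ->; exists 0.
  by rewrite scale0r (lact0l SS.1).
have [|U [[UL UV SU nU] Umin]] := @min_subspace _ _ V
  [set U | [/\ lsubspace U, U `<=` V, stable S U & exists2 u, U u & u <> 0]]
  V VL fV (fun U h => let: And4 h1 h2 _ _ := h in conj h1 h2).
  by split.
have fU := fdim_modS UV fV.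
have SD := derived_sub SS; set S' := brspan S S in SD.
have [z0 [Uz0 z00 z0E]] : exists z, [/\ U z, z <> 0 &
    forall x, S' x -> exists a, lact x z = a *: z].
  apply: (IH S' (resm SD M) U) => //; first exact: derived_subalgebra.
    by move: S0; rewrite iterSr.
  by move=> x u /SD; apply: SU.
pose chi d := xget 0 [set b | lact d z0 = b *: z0].
have chiP d : S' d -> lact d z0 = chi d *: z0.
  by move=> /z0E[b dw]; rewrite /chi; case: xgetP => [b' _ //|/(_ b)]; case.
pose W := [set w | U w /\ forall d, S' d -> lact d w = chi d *: w].
have S'br d x : S x -> S' d -> S' (glbr d x).
  by move=> Sx /SD Sd; apply: brspan_br.
have WU : W = U.
  apply: Umin; last by move=> u [].
  split; [|by move=> u [/UV]| |by exists z0].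
    split; first by split=> [|d _]; [case: UL|rewrite lact0 scaler0].
    move=> a u w [Uu uE] [Uw wE]; split=> [|d S'd]; first exact: UL.2.
    by rewrite lact_linear uE // wE // scalerDr !scalerA mulrC.
  move=> x w Sx [Uw wE]; split=> [|d S'd]; first exact: SU.
  have -> : lact d (lact x w) = lact x (lact d w) + lact (glbr d x) w.
    by rewrite lact_br //; [rewrite addrC subrK|apply: SD].
  rewrite (wE d S'd) (wE _ (S'br d x Sx S'd)) lactZ.
  have [->|w0] := pselect (w = 0); first by rewrite lact0 !scaler0 addr0.
  rewrite (krylov_weight UL fU Sx _ Uw w0 SD _ wE) ?scale0r ?addr0 //.
    by move=> u; apply: SU.
  by move=> e; apply: S'br.
have brU x y u : S x -> S y -> U u -> lact (glbr x y) u = 0.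
  move=> Sx Sy; rewrite -WU => -[Uu uE].
  have Sxy : S' (glbr x y) by apply: brspan_br.
  rewrite uE // (@commutator_scalar S M U x y (chi (glbr x y))) ?scale0r //.
  - by case: SS.
  - by case: SS.
  - by rewrite -{1}WU => u' [_]; apply.
exists z0; split=> //; first exact: UV.
move=> x Sx; have [w [Uw w0 [a xw]]] := stable_eigenvector
  (lact_linear (l := M) x) UL (fun u => SU x u Sx) fU nU.
exists a; suff : [set u | U u /\ lact x u = a *: u] z0 by case.
rewrite (Umin [set u | U u /\ lact x u = a *: u]) //; last by move=> u [].
split; [|by move=> u [/UV]| |by exists w].
  split; first by split; [case: UL|rewrite lact0 scaler0].
  move=> b u u' [Uu uE] [Uu' u'E]; split; first exact: UL.2.
  by rewrite lact_linear uE u'E scalerDr !scalerA mulrC.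
move=> y u Sy [Uu uE]; split; first exact: SU.
have -> : lact x (lact y u) = lact y (lact x u) + lact (glbr x y) u.
  by rewrite lact_br // addrC subrK.
by rewrite brU // addr0 uE lactZ.
Qed.

Section Quotient.
Variables (S : set (glinf F)) (M : lieModule S) (p : M -> M) (V : set M).
Hypotheses (pL : linear p) (pV : forall v, V v -> p v = 0)
  (Vp : forall v, V (v - p v)) (SV : stable S V).

Lemma quot_linear x : linear (fun v => p (lact x v)).
Proof. by move=> a u v; rewrite lact_linear pL. Qed.

Lemma quot_lin a x y v : S x -> S y ->
  p (lact (a *: x + y) v) = a *: p (lact x v) + p (lact y v).
Proof. by move=> Sx Sy; rewrite lact_lin // pL. Qed.

Lemma quot_br x y v : S x -> S y -> p (lact (glbr x y) v) =
  p (lact x (p (lact y v))) - p (lact y (p (lact x v))).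
Proof.
have px z u : S z -> p (lact z (p u)) = p (lact z u).
  move=> Sz; apply/esym/eqP; rewrite -subr_eq0 -linB // -lactB.
  by apply/eqP/pV/SV.
by move=> Sx Sy; rewrite !px // -linB // lact_br.
Qed.

(** The quotient M / V carried by M itself, through a linear p that kills V and is the identity
    modulo V; the vectors of interest are those in the image of p. *)
Definition quot_mod : lieModule S := LieModule quot_linear quot_lin quot_br.
End Quotient.

Theorem lie_theorem_mod (S : set (glinf F)) (M : lieModule S) (V1 V2 : set M) :
  subalgebra S -> solvable S -> lsubspace V1 -> stable S V1 -> fdim_mod V1 [set 0] ->
  lsubspace V2 -> stable S V2 -> V2 `<=` V1 -> (exists2 v, V1 v & ~ V2 v) ->
  exists z, [/\ V1 z, ~ V2 z &
    forall x, S x -> exists a, V2 (lact x z - a *: z)].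
Proof.
move=> SS [k Sk] V1L SV1 fV1 V2L SV2 V21 [v V1v V2v].
have [C [CL VC VCT]] := complement V2L.
have [| | |p [pL pE]] := @functional_linear _ M M [set q | C q.2 /\ V2 (q.1 - q.2)].
- split; first by split; [case: CL|rewrite subr0; case: V2L].
  move=> a q q' [Cq Vq] [Cq' Vq']; split; first exact: CL.2.
  rewrite (_ : _ - _ = a *: (q.1 - q.2) + (q'.1 - q'.2)); first exact: V2L.2.
  by rewrite /= scalerBr opprD addrACA.
- move=> c /= []; rewrite sub0r => Cc /(lsubN V2L); rewrite opprK => Vc.
  exact: VC.
- move=> m; have [s [c [Vs Cc ->]]] := VCT m; exists c; split=> //=.
  by rewrite addrK.
have Cp u : C (p u) by have [_ /(_ erefl)[]] := pE u (p u).
have Vp u : V2 (u - p u) by have [_ /(_ erefl)[]] := pE u (p u).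
have pV u : V2 u -> p u = 0.
  by move=> Vu; apply/esym/pE; split; [case: CL|rewrite /= subr0].
have p1 u : V1 u -> V1 (p u).
  by move=> V1u; rewrite -[p u](subKr u); apply: lsubB => //; apply/V21.
have [||||z [[V1z Cz] z0 zE]] := @lie_theorem k S (quot_mod pL pV Vp SV2)
  (V1 `&` C) SS Sk.
- exact: lsubI.
- by move=> x u Sx [V1u Cu]; split; [apply/p1/SV1|apply: Cp].
- by apply: fdim_modS fV1 => u [].
- exists (p v); first by split; [apply: p1|apply: Cp].
  by move=> pv0; apply: V2v; have := Vp v; rewrite pv0 subr0.
exists z; split=> // [/VC/(_ Cz)//|x Sx].
by have [a /= e] := zE x Sx; exists a; rewrite -e; apply: Vp.
Qed.
End LieTheorem.

(** * Borel subalgebras are spanned by Cartan elements and commutators *)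

Section Cartan.
Variable F : numClosedFieldType.
Implicit Types g b h : set (glinf F).

Lemma corner_fdim n (S : set (glinf F)) :
  (forall x, S x -> in_corner n x) -> fdim_mod S [set 0].
Proof.
move=> Sn; exists (n * n)%N, (fun x => mxvec (corner n x)); split.
  by move=> a x y; rewrite corner_lin linearP.
move=> x Sx x0; have {}x0 : corner n x = 0.
  by rewrite -[LHS]mxvecK x0 linear0.
apply: in_cornerP (Sn _ Sx) (@in_corner0 F n) _.
by rewrite x0; apply/matrixP => i j; rewrite !mxE.
Qed.

(** Since ad x is a derivation, each of its a + c applications is spent on y or on z, so one of the
    two factors vanishes in every term. *)
Lemma ad_iter_br (x y z : glinf F) a c :
  iter a (glbr x) y = 0 -> iter c (glbr x) z = 0 ->
  iter (a + c) (glbr x) (glbr y z) = 0.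
Proof.
have L0 k : iter k (glbr x) 0 = 0 by apply/lin0/linear_iter/glbr_linr.
elim: {a c}(a + c)%N {-2}a {-2}c (erefl (a + c)%N) y z => [|n IH] a c.
  move/eqP; rewrite addn_eq0 => /andP[/eqP-> /eqP->] y z /= -> _.
  by rewrite /= (glbrC z) (lin0 (glbr_linr z)) oppr0.
case: a => [|a] E y z.
  by move=> /= -> _; rewrite glbrC (lin0 (glbr_linr z)) oppr0 L0.
case: c E => [|c] E.
  by move=> _ z0; rewrite (_ : z = 0) // (lin0 (glbr_linr y)) L0.
move=> y0 z0; rewrite addSn iterSr.
have -> : glbr x (glbr y z) = glbr (glbr x y) z + glbr y (glbr x z).
  by rewrite glbr_jacobi subrK.
rewrite (linD (linear_iter _ (glbr_linr x))).
rewrite IH; first 1 last; [lia|by rewrite -iterSr|by []|].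
by rewrite addnS -addSn add0r IH //; [lia|rewrite -iterSr].
Qed.

(* Among the ad h-stable subspaces V of b with b = V + [b, b], a minimal one
   lies in the Fitting null component of every x in h; Lie's theorem modulo
   h then forces V <= h because h is self-normalizing. *)
Lemma borel_cartan_derived n g b h : (forall x, g x -> in_corner n x) ->
  is_borel g b -> is_cartan g h -> h `<=` b ->
  forall x, b x -> exists2 y, h y & brspan b b (x - y).
Proof.
move=> gn [bS bg _ _] [hS hg [m hm] hN] hb.
have bL : lsubspace b by case: bS.
have hL : lsubspace h by case: hS.
have DL : lsubspace (brspan b b) := brspan_sub b b.
have fb : fdim_mod b [set 0] by apply: (@corner_fdim n) => x /bg /gn.
have hst : stable h (h : set (adj_mod h)) by move=> x v hx hv; apply: hS.2.
have hb_st : stable h (b : set (adj_mod h)).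
  by move=> x v /hb bx bv; apply: bS.2.
have hnil x y : h x -> h y -> iter m (glbr x) y = 0.
  move=> hx hy; apply: hm.
  by elim: (m) => //= k IH; apply: brspan_br.
have hsol : solvable h.
  exists m => x hx; apply: hm; move: x hx; elim: (m) => //= k IH.
  have sub : iter k (fun D => brspan D D) h `<=` h.
    elim: k {IH} => //= k IH; apply: brspan_min; first by case: hS.
    by move=> x y /IH hx /IH hy; apply: hS.2.
  exact: brspanSS.
have [||V [[VL VS Vb VD] Vmin]] := @min_subspace _ _ b
  [set V : set (adj_mod h) | [/\ lsubspace V, stable h V, V `<=` b &
     forall x, b x -> exists2 v, V v & brspan b b (x - v)]] b bL fb.
- by move=> U [].
- split=> // x bx; exists x => //; rewrite subrr; by case: DL.
have Vnil x z : h x -> V z -> exists k, iter k (glbr x) z = 0.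
  move=> hx Vz; pose N := [set z | exists k, iter k (glbr x) z = 0].
  have xL k := linear_iter k (glbr_linr x).
  have NL : lsubspace N.
    split; first by exists 0%N.
    move=> a u v [k uk] [l vl]; exists (k + l)%N; rewrite xL.
    by rewrite addnC {1}iterD uk addnC iterD vl !(lin0 (xL _)) scaler0 addr0.
  suff : (V `&` N) z by case.
  have -> // : V `&` N = V.
  apply: Vmin; last by move=> u [].
  split; first exact: lsubI.
  - move=> y u hy [Vu [k uk]]; split; first exact: VS.
    by exists (m + k)%N; apply: ad_iter_br => //; apply: hnil.
  - by move=> u [/Vb].
  move=> y /VD[v Vv yv].
  have [k [u [w [Vu Vw vE uk]]]] := fitting VL (@lsub_set0 _ _) (glbr_linr x)
    (fun u Vu => VS x u hx Vu) (fdim_modS Vb fb) Vv.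
  exists u; first by split=> //; exists k.
  rewrite (_ : y - u = (y - v) + glbr x w).
    exact: (lsubD DL yv (brspan_br (hb _ hx) (Vb _ Vw))).
  have E (X : zmodType) (p q r : X) : p - q = p - (q + r) + r.
    by rewrite opprD addrA subrK.
  by rewrite vE; apply: E.
suff Vh : V `<=` h by move=> x /VD[v /Vh hv xv]; exists v.
move=> v Vv; apply: contrapT => hv.
have [||||z [Vz Vhz zE]] := @lie_theorem_mod F h (adj_mod h) V (V `&` h) hS hsol
  VL VS (fdim_modS Vb fb).
- exact: lsubI.
- by move=> x u hx [Vu hu]; split; [apply: VS|apply: hst].
- by move=> u [].
- by exists v => // -[].
apply: Vhz; split=> //; apply: hN; first exact/bg/Vb.
move=> x hx; rewrite glbrC; apply: (lsubN hL).
have [a /= az] := zE x hx; have VhL := lsubI VL hL.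
have [a0|a0] := eqVneq a 0; first by move: az; rewrite a0 scale0r subr0 => -[].
have [k zk] := Vnil x z hx Vz.
(* Modulo V ∩ h the element z is an eigenvector of ad x with eigenvalue a. As some power of ad x
   kills z and a is nonzero, z itself lies in h. *)
suff H j : (V `&` h) (iter j (glbr x) z - a ^+ j *: z).
  have := H k; rewrite zk sub0r -scaleNr => /(lsubZ (- (a ^+ k)^-1) VhL).
  rewrite scalerA mulrNN mulVf ?expf_neq0 // scale1r => -[_ hz].
  exact: hS.2.
elim: j => [|j IH]; first by rewrite expr0 scale1r subrr; case: VhL.
rewrite (_ : _ - _ = glbr x (iter j (glbr x) z - a ^+ j *: z) +
    a ^+ j *: (glbr x z - a *: z)).
  apply: lsubD => //; last exact: lsubZ.
  by case: IH => Vu hu; split; [apply: VS|apply: hst].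
have E (X : lmodType F) (p r w : X) :
    p - a ^+ j.+1 *: w = p - a ^+ j *: r + a ^+ j *: (r - a *: w).
  by rewrite scalerBr scalerA -exprSr addrA subrK.
by rewrite (linB (glbr_linr x)) (linZ (glbr_linr x)); apply: E.
Qed.
End Cartan.

(** * Simultaneous triangularization *)

Section Flags.
Variable F : numClosedFieldType.
Implicit Types S : set (glinf F).

Record mxrep S n (rho : glinf F -> 'M[F]_n) : Prop := MxRep {
  rep_lin : forall a x y, S x -> S y -> rho (a *: x + y) = a *: rho x + rho y;
  rep_br : forall x y, S x -> S y ->
    rho (glbr x y) = rho x *m rho y - rho y *m rho x }.

Section RowModule.
Variables (S : set (glinf F)) (n : nat) (rho : glinf F -> 'M[F]_n).
Hypothesis R : mxrep S rho.

(** Multiplication of rows from the right reverses products; the sign turns it into a left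
    action. *)
Lemma row_mod_linear x : linear (fun v : 'rV[F]_n => - (v *m rho x)).
Proof. by move=> a u v; rewrite mulmxDl -scalemxAl opprD scalerN. Qed.

Lemma row_mod_lin a x y (v : 'rV[F]_n) : S x -> S y ->
  - (v *m rho (a *: x + y)) = a *: - (v *m rho x) + - (v *m rho y).
Proof.
by move=> Sx Sy; rewrite (rep_lin R) // mulmxDr -scalemxAr opprD scalerN.
Qed.

Lemma row_mod_br x y (v : 'rV[F]_n) : S x -> S y -> - (v *m rho (glbr x y)) =
  - (- (v *m rho y) *m rho x) - - (- (v *m rho x) *m rho y).
Proof.
by move=> Sx Sy; rewrite (rep_br R) // mulmxBr !mulNmx !opprK opprB !mulmxA.
Qed.

Definition row_mod : lieModule S :=
  LieModule row_mod_linear row_mod_lin row_mod_br.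
End RowModule.

Lemma row_eigenvector S n (rho : glinf F -> 'M[F]_n) m (U : 'M[F]_(m, n)) :
  subalgebra S -> solvable S -> mxrep S rho ->
  (forall x, S x -> (U *m rho x <= U)%MS) -> U != 0 ->
  exists e : 'rV_n, [/\ e != 0, (e <= U)%MS &
    forall x, S x -> exists a, e *m rho x = a *: e].
Proof.
move=> SS [k Sk] R SU U0.
have [||||z [Uz z0 zE]] := @lie_theorem F k S (row_mod R)
    [set v : 'rV_n | (v <= U)%MS] SS Sk.
- split=> [|a u v /= Uu Uv]; first exact: sub0mx.
  by apply: addmx_sub => //; apply: scalemx_sub.
- move=> x v Sx /= Uv; rewrite -scaleN1r; apply: scalemx_sub.
  by apply: submx_trans (SU x Sx); apply: submxMr.
- by exists n, id; split.
- have /rowV0Pn[v vU v0] := U0; exists v => //; exact/eqP.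
exists z; split=> //; first exact/eqP.
move=> x Sx; have [a /= az] := zE x Sx; exists (- a).
by rewrite scaleNr -az opprK.
Qed.

Lemma conj_rep S n (rho : glinf F -> 'M[F]_n) (P : 'M[F]_n) : P \in unitmx ->
  mxrep S rho -> mxrep S (fun x => P *m rho x *m invmx P).
Proof.
move=> uP R; split=> [a x y Sx Sy|x y Sx Sy].
  by rewrite (rep_lin R) // mulmxDr mulmxDl -scalemxAr -scalemxAl.
rewrite (rep_br R) // mulmxBr mulmxBl.
by rewrite !mulmxA !(mulmxKV uP).
Qed.

Lemma invmxM n (A B : 'M[F]_n) : A \in unitmx -> B \in unitmx ->
  invmx (A *m B) = invmx B *m invmx A.
Proof.
move=> uA uB; have uAB : A *m B \in unitmx by rewrite unitmx_mul uA.
by rewrite -[RHS](mulKmx uAB) !mulmxA (mulmxK uB) (mulmxK uA).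
Qed.

Lemma maxz_bound n (d : 'I_n -> int) : exists N : int,
  0 < N /\ forall i, - N < d i /\ d i < N.
Proof.
exists (\sum_i `|d i| + 1); split=> [|i].
  by rewrite ltr_wpDl // sumr_ge0.
rewrite (bigD1 i) //=.
have : 0 <= \sum_(j | j != i) `|d j| by apply: sumr_ge0.
by move: (\sum_(j | _) _) => s s0; split; lia.
Qed.

(** The flag is recorded by integer labels of the basis rows instead of their order, because the
    labels become, up to a common shift, the eigenvalues of a regular element. *)
Definition triangular_for S n (rho : glinf F -> 'M[F]_n) (P : 'M[F]_n)
    (d : 'I_n -> int) := [/\ P \in unitmx, injective d &
  forall x, S x -> forall i j, d i < d j -> (P *m rho x *m invmx P) i j = 0].

(** A common eigenrow e becomes the first basis row, with a label -N below all the labels obtained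
    by induction for the quotient by e. *)
Lemma triangularization S n (rho : glinf F -> 'M[F]_n) :
  subalgebra S -> solvable S -> mxrep S rho ->
  exists P d, triangular_for S rho P d.
Proof.
move=> SS SV; elim: n rho => [|n IH] rho R.
  by exists 1%:M, (fun=> 0); split=> [|[]|? _ []]//; apply: unitmx1.
have [||e [e0 _ eE]] := @row_eigenvector S n.+1 rho n.+1 1%:M SS SV R.
- by move=> x _; apply: submx1.
- by rewrite -mxrank_eq0 mxrank1.
pose P0 := row_ebase e.
have uP0 : P0 \in unitmx by apply: row_ebase_unit.
(* As e has rank one, [row_ebase] completes it to a basis whose first row is proportional to e. *)
have eP0 : exists c, row 0 P0 = c *: e.
  have re : \rank e = 1%N by apply/eqP; rewrite eqn_leq rank_leq_row lt0n mxrank_eq0.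
  have := mulmx_ebase e; rewrite re => E.
  have u1 := col_ebase_unit e.
  exists (invmx (col_ebase e) 0 0); rewrite -[X in _ *: X]E.
  rewrite -mul_scalar_mx -mx11_scalar !mulmxA mulVmx // mul1mx.
  apply/rowP => j; rewrite mxE [RHS]mxE (bigD1 ord0) //= big1 => [|k k0].
    by rewrite [pid_mx _ _ _]mxE /= mul1r addr0.
  by rewrite [pid_mx _ _ _]mxE /= [_ == _](_ : _ = false) ?mul0r //; case: k k0 => -[].
have [c cE] := eP0.
pose X x := P0 *m rho x *m invmx P0.
have X0 x j : S x -> j != 0 -> X x 0 j = 0.
  move=> Sx j0; have [a ae] := eE x Sx.
  have E : row 0 P0 *m rho x = a *: row 0 P0.
    by rewrite cE -scalemxAl ae !scalerA mulrC.
  have -> : X x 0 j = (row 0 (X x)) 0 j by rewrite [RHS]mxE.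
  rewrite /X !row_mul E -scalemxAl -row_mul mulmxV // !mxE.
  by rewrite eq_sym (negPf j0) mulr0.
have RX : mxrep S X by apply: conj_rep.
have RX1 : mxrep S (fun x => drsubmx (X x : 'M_(1 + n))).
  have E z y : S y -> drsubmx (X z *m X y : 'M_(1 + n)) =
      drsubmx (X z : 'M_(1 + n)) *m drsubmx (X y : 'M_(1 + n)).
    have dE (A : 'M[F]_(1 + n)) k l : drsubmx A k l = A (rshift 1 k) (rshift 1 l).
      by rewrite !mxE.
    move=> Sy; apply/matrixP => i j; rewrite dE [LHS]mxE.
    rewrite [RHS]mxE big_ord_recl (X0 y (rshift 1 j)) // mulr0 add0r.
    apply: eq_bigr => k _; rewrite !dE.
    by congr (X z _ _ * X y _ _); apply/val_inj.
  split=> [a x y Sx Sy|x y Sx Sy].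
    by rewrite (rep_lin RX) //; apply/matrixP => i j; rewrite !mxE.
  rewrite (rep_br RX) // -!E //; apply/matrixP => i j; by rewrite !mxE.
have [P1 [d1 [uP1 d1i P1E]]] := IH _ RX1.
have [N [N0 dN]] := maxz_bound d1.
pose Q : 'M_(1 + n) := block_mx 1%:M 0 0 P1.
pose Qi : 'M_(1 + n) := block_mx 1%:M 0 0 (invmx P1).
have QQi : Q *m Qi = 1%:M.
  by rewrite /Q /Qi mulmx_block !mulmx0 !mul0mx !mulmx1 !addr0 add0r mulmxV //
    -scalar_mx_block.
have [uQ _] := mulmx1_unit QQi.
have iQ : invmx Q = Qi by rewrite -[RHS](mulKmx uQ) QQi mulmx1.
pose d (i : 'I_(1 + n)) := match fintype.split i with inl _ => - N | inr k => d1 k end.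
exists (Q *m P0), d; split.
- by rewrite unitmx_mul uQ.
- move=> i j; rewrite /d; case: (@splitP 1 n i) => [i0 iE|i1 iE];
    case: (@splitP 1 n j) => [j0 jE|j1 jE].
  + by move=> _; apply/val_inj; rewrite /= iE jE !ord1.
  + by have := (dN j1).1 => /[swap] <-; rewrite ltxx.
  + by have := (dN i1).1 => /[swap] ->; rewrite ltxx.
  + by move=> /d1i E; apply/val_inj; rewrite /= iE jE E.
move=> x Sx i j.
have XE : X x = block_mx (ulsubmx (X x : 'M_(1 + n))) 0
    (dlsubmx (X x : 'M_(1 + n))) (drsubmx (X x : 'M_(1 + n))).
  rewrite -[LHS](@submxK _ 1 n 1 n).
  suff -> : ursubmx (X x : 'M_(1 + n)) = 0 by [].
  have uE (A : 'M[F]_(1 + n)) k l : ursubmx A k l = A (lshift n k) (rshift 1 l).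
    by rewrite !mxE.
  apply/matrixP => k l; rewrite uE [RHS]mxE -[RHS](X0 x (rshift 1 l)) //.
  by congr (X x _ _); apply/val_inj; rewrite /= ord1.
have E : @mulmx _ (1 + n) (1 + n) (1 + n) (@mulmx _ (1 + n) (1 + n) (1 + n) Q (X x))
    Qi = block_mx (ulsubmx (X x : 'M_(1 + n))) 0
    (P1 *m dlsubmx (X x : 'M_(1 + n)))
    (P1 *m drsubmx (X x : 'M_(1 + n)) *m invmx P1).
  rewrite {1}XE /Q /Qi !mulmx_block.
  by rewrite !(mulmx0, mul0mx, mul1mx, mulmx1, addr0, add0r).
have -> : Q *m P0 *m rho x *m invmx (Q *m P0) = Q *m X x *m Qi.
  by rewrite invmxM // iQ !mulmxA.
move: E; set L := (X in X = _ -> _) => E; rewrite -/L E.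
rewrite /d; case: (@splitP 1 n i) => [i0 iE|i1 iE]; case: (@splitP 1 n j) => [j0 jE|j1 jE].
- by rewrite ltxx.
- move=> _; have -> : i = lshift n i0 by apply: ord_inj.
  have -> : j = rshift 1 j1 by apply: ord_inj.
  by apply: etrans (block_mxEur _ _ _ _ _ _) _; rewrite mxE.
- by move=> /lt_trans /(_ (dN i1).1); rewrite ltxx.
- move=> dij; have -> : i = rshift 1 i1 by apply: ord_inj.
  have -> : j = rshift 1 j1 by apply: ord_inj.
  by apply: etrans (block_mxEdr _ _ _ _ _ _) _; rewrite P1E.
Qed.

(** * Triangularization adapted to a bilinear form *)

Section Skew.
Variables (n : nat) (J : 'M[F]_n) (eps : F).
Hypotheses (uJ : J \in unitmx) (JT : J^T = eps *: J) (eps2 : eps = 1 \/ eps = -1).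

Let q (u v : 'rV[F]_n) := (u *m J *m v^T) 0 0.

Lemma q_sym u v : q v u = eps * q u v.
Proof.
rewrite /q; have -> : v *m J *m u^T = eps *: (u *m J *m v^T)^T.
  by rewrite !trmx_mul trmxK JT -scalemxAl -scalemxAr scalerA -[eps * eps]expr2;
    case: eps2 => ->; rewrite ?sqrrN expr1n scale1r mulmxA.
by rewrite [LHS]mxE [X in _ * X]mxE.
Qed.

Lemma qDl a u v w : q (a *: u + v) w = a * q u w + q v w.
Proof. by rewrite /q !mulmxDl -!scalemxAl !mxE. Qed.

Lemma qDr a u v w : q w (a *: u + v) = a * q w u + q w v.
Proof. by rewrite !(q_sym _ w) qDl mulrDr mulrCA. Qed.

(** An anisotropic eigenrow w is killed by S, since q(w x, w) = - q(w, w x) and the form must be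
    symmetric. The orthogonal complement of w is stable and contains a second eigenrow w'. If w' is
    anisotropic as well, S kills the plane of w and w', and this plane contains an isotropic row
    because square roots exist. *)
Lemma isotropic_eigenvector S (rho : glinf F -> 'M[F]_n) : (1 < n)%N ->
  subalgebra S -> solvable S -> mxrep S rho ->
  (forall x, S x -> rho x *m J + J *m (rho x)^T = 0) ->
  exists e, [/\ e != 0, q e e = 0 & forall x, S x -> exists a, e *m rho x = a *: e].
Proof.
move=> n1 SS SV R sk.
have qsk x u v : S x -> q (u *m rho x) v = - q u (v *m rho x).
  move=> Sx; rewrite /q trmx_mul; apply/eqP; rewrite -addr_eq0; apply/eqP.
  have : u *m (rho x *m J + J *m (rho x)^T) *m v^T = 0 by rewrite sk // mulmx0 mul0mx.
  by move/matrixP/(_ 0 0); rewrite mulmxDr mulmxDl mxE [RHS]mxE !mulmxA.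
have [||w [w0 _ wE]] := @row_eigenvector S n rho n 1%:M SS SV R.
- by move=> x _; apply: submx1.
- by rewrite -mxrank_eq0 mxrank1 -lt0n (ltn_trans _ n1).
have [qw|qw] := eqVneq (q w w) 0; first by exists w.
have e1 : eps = 1.
  case: eps2 => // eN; move: (q_sym w w); rewrite eN mulN1r => /eqP.
  by rewrite -addr_eq0 -mulr2n mulrn_eq0 (negPf qw).
have killed v : q v v != 0 -> (forall x, S x -> exists a, v *m rho x = a *: v) ->
    forall x, S x -> v *m rho x = 0.
  move=> qv vE x Sx; have [a ax] := vE x Sx; have := qsk x v v Sx.
  rewrite ax -[a *: v]addr0 qDl qDr [q 0 v](_ : _ = 0); last first.
    by rewrite /q !mul0mx mxE.
  rewrite [q v 0](_ : _ = 0); last by rewrite /q linear0 mulmx0 mxE.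
  rewrite !addr0 => /eqP; rewrite -addr_eq0 -mulr2n mulrn_eq0 /= mulf_eq0.
  by rewrite (negPf qv) orbF => /eqP->; rewrite scale0r.
pose U := kermx (J *m w^T).
have UP v : (v <= U)%MS -> q v w = 0.
  by move=> /sub_kermxP; rewrite /q -mulmxA => ->; rewrite mxE.
have [||w' [w'0 w'U w'E]] := @row_eigenvector S n rho n U SS SV R.
- move=> x Sx; apply/sub_kermxP.
  have UJ : U *m (J *m w^T) = 0 by apply: mulmx_ker.
  have -> : U *m rho x *m (J *m w^T) = - (U *m (J *m (w *m rho x)^T)).
    have E : U *m (rho x *m J + J *m (rho x)^T) *m w^T = 0.
      by rewrite sk // mulmx0 mul0mx.
    by apply/eqP; rewrite -addr_eq0 -[X in _ == X]E mulmxDr mulmxDl trmx_mul !mulmxA.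
  have [a ->] := wE x Sx.
  by rewrite linearZ /= -!scalemxAr UJ scaler0 oppr0.
- rewrite -mxrank_eq0 mxrank_ker -lt0n subn_gt0.
  exact: leq_ltn_trans (rank_leq_col _) n1.
have [qw'|qw'] := eqVneq (q w' w') 0; first by exists w'.
pose c := sqrtC (- q w w / q w' w').
have c2 : c * c = - q w w / q w' w' by rewrite -expr2 sqrtCK.
have qww' : q w w' = 0 by rewrite q_sym UP // mulr0.
exists (c *: w' + w); split.
- apply: contraNneq qw => /eqP; rewrite addrC addr_eq0 -scaleNr => /eqP E.
  by rewrite -(UP _ (scalemx_sub (- c) w'U)) -E.
- rewrite qDl !qDr UP // qww' !mulr0 addr0 add0r mulrA c2.
  by rewrite mulfVK // addNr.
move=> x Sx; exists 0; rewrite scale0r mulmxDl -scalemxAl.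
by rewrite !killed // scaler0 addr0.
Qed.
End Skew.

(** Rows pair nontrivially only if their labels are opposite, which is what makes the diagonal
    matrix of the labels skew for the form. *)
Definition graded_form n (J P : 'M[F]_n) (d : 'I_n -> int) :=
  forall i j, d i + d j != 0 -> (P *m J *m P^T) i j = 0.

Lemma gram_entry n m (P : 'M[F]_(m, n)) (J : 'M[F]_n) i j :
  (P *m J *m P^T) i j = (row i P *m J *m (row j P)^T) 0 0.
Proof.
rewrite [LHS]mxE [RHS]mxE; apply: eq_bigr => k _; rewrite -row_mul.
by rewrite [row _ _ _ _]mxE ![(_^T) _ _]mxE [row _ _ _ _]mxE.
Qed.

Lemma rank_basis n m (A : 'M[F]_n) : \rank A = m ->
  exists2 B : 'M[F]_(m, n), row_free B & (B :=: A)%MS.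
Proof. by case: m /; exists (row_base A); [apply: row_base_free|apply: eq_row_base]. Qed.

(** A row f0 that pairs to 1 with e becomes isotropic after subtracting t / 2 times e, where t is
    the value of the form on f0; in the alternating case t is already 0. *)
Lemma hyperbolic_partner n (J : 'M[F]_n) eps (e : 'rV_n) : J \in unitmx ->
  J^T = eps *: J -> eps = 1 \/ eps = -1 -> e != 0 -> e *m J *m e^T = 0 ->
  exists2 f : 'rV_n, e *m J *m f^T = 1%:M & f *m J *m f^T = 0.
Proof.
move=> uJ JT eps2 e0 ee.
have : e *m J != 0.
  by apply: contraNneq e0 => eJ; rewrite -[e](mulmxK uJ) eJ mul0mx.
case/matrix0Pn=> i [k]; rewrite ord1 => eJk.
pose f0 : 'rV[F]_n := ((e *m J) 0 k)^-1 *: delta_mx 0 k.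
have ef0 : e *m J *m f0^T = 1%:M.
  rewrite /f0 linearZ /= -scalemxAr trmx_delta -colE [col _ _]mx11_scalar [col _ _ _ _]mxE.
  by rewrite scale_scalar_mx mulVf.
move: f0 ef0 => {eJk} f0 ef0.
pose t := (f0 *m J *m f0^T) 0 0.
have tE : f0 *m J *m f0^T = t%:M by apply: mx11_scalar.
have fe0 : f0 *m J *m e^T = eps%:M.
  have -> : f0 *m J *m e^T = eps *: (e *m J *m f0^T)^T.
    rewrite !trmx_mul trmxK JT -scalemxAl -scalemxAr scalerA mulmxA.
    by case: eps2 => ->; rewrite ?mulrNN mulr1 scale1r.
  by rewrite ef0 tr_scalar_mx scale_scalar_mx mulr1.
have tt : (1 + eps) * t = t *+ 2.
  case: (eps2) => epsE; first by rewrite epsE -mulr2n mulr_natl.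
  have : t = - t.
    rewrite {1}/t; have -> : f0 *m J *m f0^T = eps *: (f0 *m J *m f0^T)^T.
      rewrite !trmx_mul trmxK JT -scalemxAl -scalemxAr scalerA mulmxA.
      by rewrite epsE mulrNN mulr1 scale1r.
    by rewrite epsE mxE [X in _ * X]mxE mulN1r.
  by move/eqP; rewrite -addr_eq0 -mulr2n => /eqP->; rewrite epsE subrr mul0r.
have fT : (f0 - (t / 2%:R) *: e)^T = f0^T - (t / 2%:R) *: e^T.
  by rewrite linearB linearZ.
exists (f0 - (t / 2%:R) *: e); rewrite fT.
  by rewrite mulmxBr -scalemxAr ee scaler0 subr0.
rewrite !mulmxBl !mulmxBr -!scalemxAl -!scalemxAr tE fe0 ef0 ee.
rewrite !scaler0 subr0 !scale_scalar_mx -!raddfB /= mulr1 -addrA -opprD.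
rewrite -[X in _ - (_ + X)]mulr1 -mulrDr [eps + 1]addrC mulrAC [t * _]mulrC tt.
by rewrite -mulr_natr mulfK ?pnatr_eq0 // subrr raddf0.
Qed.

(** The dimension drops by two: an isotropic eigenrow e and a hyperbolic partner f get the opposite
    labels -N and N, and S acts on the quotient of the orthogonal complement of e by e. This
    quotient is modelled on the orthogonal complement K of the plane of e and f, with basis B. A
    last single row gets the label 0. *)
Lemma skew_triangularization S : subalgebra S -> solvable S ->
  forall n (rho : glinf F -> 'M[F]_n) (J : 'M[F]_n) eps, J \in unitmx ->
  J^T = eps *: J -> eps = 1 \/ eps = -1 -> mxrep S rho ->
  (forall x, S x -> rho x *m J + J *m (rho x)^T = 0) ->
  exists P d, triangular_for S rho P d /\ graded_form J P d.
Proof.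
move=> SS SV; elim/ltn_ind => -[|[|m]] IH rho J eps uJ JT eps2 R sk.
- exists 1%:M, (fun=> 0); split=> [|[]//]; split=> [|[]|? _ []]//; apply: unitmx1.
- exists 1%:M, (fun=> 0); split; last by move=> i j; rewrite addr0 eqxx.
  by split=> [|i j _|x _ i j]; rewrite ?unitmx1 ?ord1 ?ltxx.
have [//|e [e0 ee eE]] := isotropic_eigenvector JT eps2 _ SS SV R sk.
have {}ee : e *m J *m e^T = 0 by rewrite [LHS]mx11_scalar ee raddf0.
have [f ef ff] := hyperbolic_partner uJ JT eps2 e0 ee.
have flip k l (u : 'M[F]_(k, m.+2)) (v : 'M[F]_(l, m.+2)) :
    v *m J *m u^T = eps *: (u *m J *m v^T)^T.
  rewrite !trmx_mul trmxK JT -scalemxAl -scalemxAr scalerA mulmxA.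
  by case: eps2 => ->; rewrite ?mulrNN mulr1 scale1r.
have fe : f *m J *m e^T = eps%:M.
  by rewrite flip ef tr_scalar_mx scale_scalar_mx mulr1.
pose K := kermx (J *m row_mx e^T f^T).
have KP k (v : 'M_(k, m.+2)) :
    (v <= K)%MS <-> v *m J *m e^T = 0 /\ v *m J *m f^T = 0.
  split=> [/sub_kermxP|[ve vf]].
    by rewrite mulmxA mul_mx_row -row_mx0 => /eq_row_mx.
  by apply/sub_kermxP; rewrite mulmxA mul_mx_row ve vf row_mx0.
have rK : \rank K = m.
  rewrite mxrank_ker -mxrank_tr (_ : \rank _ = 2%N) ?subn2 //; apply/eqP.
  rewrite -/(row_free _); apply/row_freeP.
  rewrite trmx_mul tr_row_mx !trmxK.
  exists (row_mx (eps *: f)^T e^T); rewrite -mulmxA mul_mx_row mul_col_row.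
  have fT : (eps *: f)^T = eps *: f^T by rewrite linearZ.
  rewrite !mulmxA JT fT -!scalemxAr -!scalemxAl ee ef fe ff !scaler0 scalerA !scale_scalar_mx mulr1 -scalar_mx_block.
  by congr (_%:M); case: eps2 => ->; rewrite ?mulrNN mulr1.
have [B Bf BK] := rank_basis rK.
have [Be Bf0] : B *m J *m e^T = 0 /\ B *m J *m f^T = 0.
  by apply/KP; rewrite BK.
have eB : e *m J *m B^T = 0 by rewrite flip Be trmx0 scaler0.
have fB : f *m J *m B^T = 0 by rewrite flip Bf0 trmx0 scaler0.
pose G k (V : 'M_(k, m.+2)) := (V - V *m J *m f^T *m e) *m pinvmx B.
have GE k (V : 'M_(k, m.+2)) : V *m J *m e^T = 0 ->
    V = V *m J *m f^T *m e + G k V *m B.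
  move=> Ve; rewrite /G mulmxKpV; first by rewrite addrC subrK.
  rewrite BK; apply/KP.
  rewrite !mulmxBl Ve -!(mulmxA (V *m J *m f^T)) ee ef mulmx0.
  by rewrite mulmx1 !subrr.
clearbody G.
(* Pairing with f isolates the coefficient of e, and the rows of B are free. *)
have Gu k (w : 'M_(k, 1)) (A : 'M_(k, m)) A' w' :
    w *m e + A *m B = w' *m e + A' *m B -> A = A'.
  move=> E; have := congr1 (fun M => M *m (J *m f^T)) E.
  rewrite !mulmxDl -!mulmxA !(mulmxA B) !(mulmxA e) Bf0 ef !mulmx1 !mulmx0 !addr0.
  by move=> ww; move: E; rewrite ww => /addrI /(row_free_inj Bf).
(* The form is invariant and e is an eigenrow, so S preserves the orthogonal complement of e. *)
have Brho x : S x -> B *m rho x *m J *m e^T = 0.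
  move=> Sx; have [a ax] := eE x Sx.
  have -> : B *m rho x *m J *m e^T = - (B *m J *m (e *m rho x)^T).
    apply/eqP; rewrite -addr_eq0 trmx_mul !mulmxA -mulmxDl -!(mulmxA B) -mulmxDr.
    by rewrite sk // mulmx0 mul0mx.
  by rewrite ax linearZ /= -scalemxAr Be scaler0 oppr0.
pose rho1 x := G m (B *m rho x).
pose u1 x := B *m rho x *m J *m f^T.
have rho1E x : S x -> B *m rho x = u1 x *m e + rho1 x *m B.
  by move=> Sx; apply/GE/Brho.
have R1 : mxrep S rho1.
  have mul y z : S y -> S z -> exists w,
      B *m rho y *m rho z = w *m e + rho1 y *m rho1 z *m B.
    move=> Sy Sz; have [a az] := eE z Sz; exists (a *: u1 y + rho1 y *m u1 z).
    rewrite (rho1E y Sy) mulmxDl -!(mulmxA _ _ (rho z)) az (rho1E z Sz).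
    rewrite mulmxDr -scalemxAr !mulmxA.
    by rewrite addrA mulmxDl -scalemxAl.
  split=> [a x y Sx Sy|x y Sx Sy].
    apply: (Gu _ (u1 (a *: x + y)) _ _ (a *: u1 x + u1 y)).
    rewrite -rho1E; last exact: SS.1.2.
    rewrite (rep_lin R) // mulmxDr -scalemxAr !rho1E // scalerDr addrACA.
    by rewrite !mulmxDl -!scalemxAl.
  have [w wE] := mul _ _ Sx Sy; have [w' w'E] := mul _ _ Sy Sx.
  apply: (Gu _ (u1 (glbr x y)) _ _ (w - w')).
  rewrite -rho1E; last exact: SS.2.
  by rewrite (rep_br R) // mulmxBr !mulmxA wE w'E !mulmxBl opprD addrACA.
have unitP (A : 'M_m) : A \in unitmx ->
    (col_mx e (col_mx f (A *m B)) : 'M_(1 + (1 + m))) \in unitmx.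
  move=> uA; rewrite -row_free_unit -kermx_eq0; apply: contraT => /rowV0Pn[v vK].
  case/eqP; have := sub_kermxP vK; rewrite -[v]hsubmxK -[rsubmx v]hsubmxK.
  set a := lsubmx v; set c := lsubmx _; set g := rsubmx _.
  rewrite !mul_row_col => E.
  have E' k (w : 'M_(m.+2, k)) : a *m (e *m w) + (c *m (f *m w) + g *m A *m (B *m w)) = 0.
    by rewrite -(mul0mx 1 w) -E !mulmxDl !mulmxA.
  have ef' : e *m (J *m f^T) = 1%:M by rewrite mulmxA.
  have ff' : f *m (J *m f^T) = 0 by rewrite mulmxA.
  have Bf' : B *m (J *m f^T) = 0 by rewrite mulmxA.
  have fe' : f *m (J *m e^T) = eps%:M by rewrite mulmxA.
  have Be' : B *m (J *m e^T) = 0 by rewrite mulmxA.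
  have a0 : a = 0.
    by have := E' _ (J *m f^T); rewrite ef' ff' Bf' mulmx1 !mulmx0 !addr0.
  have c0 : c = 0.
    have := E' _ (J *m e^T); rewrite a0 mul0mx add0r fe' Be' mulmx0 addr0.
    rewrite mul_mx_scalar => /eqP; rewrite scaler_eq0 => /orP[|/eqP//].
    by case: eps2 => ->; rewrite ?oppr_eq0 oner_eq0.
  have gA0 : g *m A *m B = 0 by rewrite -[RHS]E a0 c0 !mul0mx !add0r mulmxA.
  have g0 : g = 0.
    rewrite -[g](mulmxK uA) (_ : g *m A = 0) ?mul0mx //.
    by apply: (row_free_inj Bf); rewrite gA0 mul0mx.
  by rewrite a0 c0 g0 !row_mx0.
pose J1 := B *m J *m B^T.
(* A row of K orthogonal to K is also orthogonal to e and f, hence to everything. *)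
have uJ1 : J1 \in unitmx.
  rewrite -row_free_unit -kermx_eq0; apply: contraT => /rowV0Pn[v vK v0].
  have vJ : v *m (B *m J *m B^T) = 0 by apply/sub_kermxP.
  have : v *m B = 0; last first.
    by rewrite -(mul0mx _ B) => /(row_free_inj Bf) v0'; rewrite v0' eqxx in v0.
  rewrite -[v *m B](mulmxK uJ); set z := _ *m J.
  suff -> : z = 0 by rewrite mul0mx.
  have u1' := unitP _ (unitmx1 F m); rewrite mul1mx in u1'.
  rewrite -unitmx_tr in u1'; rewrite -[z](mulmxK u1') (_ : z *m _ = 0) ?mul0mx //.
  have zE k (w : 'M_(_, k)) : z *m w = v *m (B *m J *m w) by rewrite /z !mulmxA.
  by rewrite !tr_col_mx !mul_mx_row !zE Be Bf0 vJ !mulmx0 !row_mx0.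
have J1T : J1^T = eps *: J1.
  by rewrite /J1 !trmx_mul trmxK JT -scalemxAl -scalemxAr mulmxA.
have sk1 x : S x -> rho1 x *m J1 + J1 *m (rho1 x)^T = 0.
  move=> Sx; have : B *m (rho x *m J + J *m (rho x)^T) *m B^T = 0.
    by rewrite sk // mulmx0 mul0mx.
  rewrite mulmxDr mulmxDl !mulmxA -(mulmxA (B *m J)) -trmx_mul.
  move: (B *m rho x) (u1 x) (rho1 x) (rho1E x Sx) => M u r ->.
  rewrite raddfD /= !trmx_mul !mulmxDl mulmxDr -!(mulmxA u) eB mulmx0 add0r.
  by rewrite !(mulmxA _ e^T) Be mul0mx add0r /J1 !mulmxA.
have [P1 [d1 [[uP1 d1i P1E] G1]]] := IH m (leqnSn _) rho1 J1 eps uJ1 J1T eps2 R1 sk1.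
have [N [N0 dN]] := maxz_bound d1.
pose P : 'M[F]_(1 + (1 + m)) := col_mx e (col_mx f (P1 *m B)).
pose d (i : 'I_(1 + (1 + m))) := match fintype.split i with
  | inl _ => - N
  | inr j => match fintype.split j with inl _ => N | inr k => d1 k end
  end.
have uP : P \in unitmx by apply: unitP.
pose ie : 'I_(1 + (1 + m)) := lshift (1 + m) 0.
pose jf : 'I_(1 + (1 + m)) := rshift 1 (lshift m 0).
pose kB k : 'I_(1 + (1 + m)) := rshift 1 (rshift 1 k).
have de : d ie = - N by rewrite /d (unsplitK (inl 0 : 'I_1 + 'I_(1 + m))).
have df : d jf = N.
  by rewrite /d (unsplitK (inr _ : 'I_1 + 'I_(1 + m)))
    (unsplitK (inl 0 : 'I_1 + 'I_m)).
have dB k : d (kB k) = d1 k.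
  by rewrite /d (unsplitK (inr _ : 'I_1 + 'I_(1 + m)))
    (unsplitK (inr k : 'I_1 + 'I_m)).
have idx (i : 'I_(1 + (1 + m))) : [\/ i = ie, i = jf | exists k, i = kB k].
  case: (@splitP 1 (1 + m) i) => [i0 iE|i1 iE].
    by constructor 1; apply: ord_inj; rewrite iE ord1.
  case: (@splitP 1 m i1) => [i2 iE2|k iE2].
    by constructor 2; apply: ord_inj; rewrite iE iE2 ord1.
  by constructor 3; exists k; apply: ord_inj; rewrite iE iE2.
have Pe : row ie P = e by rewrite /P /ie rowKu; apply/rowP => j; rewrite mxE.
have Pf : row jf P = f.
  by rewrite /P /jf rowKd rowKu; apply/rowP => j; rewrite mxE.
have PB k : row (kB k) P = row k (P1 *m B) by rewrite /P /kB !rowKd.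
exists P, d; split; first split => //.
- move=> i j; have [->|->|[k ->]] := idx i; have [->|->|[l ->]] := idx j;
    rewrite ?de ?df ?dB //.
  + by move=> ?; lia.
  + by have := dN l; lia.
  + by move=> ?; lia.
  + by have := dN l; lia.
  + by have := dN k; lia.
  + by have := dN k; lia.
  + by move/d1i ->.
- move=> x Sx i j dij.
  have -> : (P *m rho x *m invmx P) i j = (row i P *m rho x *m invmx P) 0 j.
    by rewrite -!row_mul [RHS]mxE.
  have rowP' k : row k P *m invmx P = delta_mx 0 k.
    by rewrite -row_mul mulmxV // row1.
  move: dij; have [->|->|[k ->]] := idx i.
  + have [a ax] := eE x Sx; rewrite Pe ax -scalemxAl -Pe rowP' => dij.
    rewrite mxE [delta_mx _ _ _ _]mxE eqxx /=.
    by case: eqP => [jE|_]; rewrite ?mulr0 //; rewrite jE ltxx in dij.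
  + rewrite df; have [->|->|[l ->]] := idx j; rewrite ?de ?df ?dB ?ltxx //.
      by move=> ?; lia.
    by have := dN l; lia.
  rewrite PB row_mul -(mulmxA _ B) rho1E // mulmxDr mulmxDl.
  have -> : row k P1 *m (u1 x *m e) *m invmx P =
      (row k P1 *m u1 x) *m delta_mx 0 ie by rewrite -!mulmxA -Pe rowP' !mulmxA.
  have -> : row k P1 *m (rho1 x *m B) *m invmx P =
      \sum_l (P1 *m rho1 x *m invmx P1) k l *: delta_mx 0 (kB l).
    have -> : row k P1 *m (rho1 x *m B) =
        row k (P1 *m rho1 x *m invmx P1) *m (P1 *m B).
      by rewrite !row_mul !mulmxA (mulmxKV uP1).
    rewrite [X in X *m invmx P]mulmx_sum_row mulmx_suml; apply: eq_bigr => l _.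
    by rewrite -scalemxAl -PB rowP' [row _ _ _ _]mxE.
  rewrite dB => dij; rewrite mxE summxE.
  have [jE|jE|[l jE]] := idx j; rewrite jE ?de ?df ?dB in dij *.
  + by have := dN k; lia.
  + rewrite big1 => [|l _]; last by rewrite mxE [delta_mx _ _ _ _]mxE mulr0.
    by rewrite addr0 mxE big1 // => l _; rewrite [delta_mx _ _ _ _]mxE andbF mulr0.
  rewrite mxE big1 ?add0r => [|l' _]; last by rewrite [delta_mx _ _ _ _]mxE andbF mulr0.
  rewrite (bigD1 l) //= mxE P1E // mul0r add0r big1 // => l' l'l.
  rewrite mxE [delta_mx _ _ _ _]mxE /= eq_sym (_ : kB l' == kB l = false) ?mulr0 //.
  by apply/negbTE; apply: contraNneq l'l => /rshift_inj /rshift_inj ->.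
move=> i j; rewrite gram_entry.
have BB k l : row k (P1 *m B) *m J *m (row l (P1 *m B))^T =
    ((P1 *m J1 *m P1^T) k l)%:M.
  rewrite [LHS]mx11_scalar -gram_entry /J1 trmx_mul !mulmxA //.
have VB k (v : 'rV_m.+2) : v *m J *m B^T = 0 ->
    v *m J *m (row k (P1 *m B))^T = 0.
  by move=> vB; rewrite row_mul trmx_mul mulmxA vB mul0mx.
have [->|->|[k ->]] := idx i; have [->|->|[l ->]] := idx j;
  rewrite ?de ?df ?dB ?Pe ?Pf ?PB.
- by rewrite ee mxE.
- by rewrite addNr eqxx.
- by rewrite VB // mxE.
- by rewrite subrr eqxx.
- by rewrite ff mxE.
- by rewrite VB // mxE.
- by rewrite flip VB // trmx0 scaler0 mxE.
- by rewrite flip VB // trmx0 scaler0 mxE.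
- by move=> /G1 G0; rewrite BB G0 !mxE.
Qed.

End Flags.

(** * The involution defining the classical algebras *)

Section ClassicalAlgebra.
Variables (F : numClosedFieldType) (t : classical_type).
Local Notation gl := (glinf F).
Implicit Types x y z : gl.

Definition gdim i := if t is SPinf then i.*2 else i.

(** For o and sp, [par a] is the index of the basis vector that pairs nontrivially with e_a, and
    [sgn a] is the value of the form on that pair. For sl, which preserves no form, both are
    trivial. *)
Definition par a := if t is SPinf then (if odd a then a.-1 else a.+1) else a.

Definition sgn a : F := if t is SPinf then (-1) ^+ odd a else 1.

Lemma parK : involutive par.
Proof.
rewrite /par; case: t => // a; have [oa|oa] := boolP (odd a).
  by case: a oa => //= a; case: (odd a).
by rewrite /= oa.
Qed.

Lemma par_gdim i a : (par a < gdim i)%N = (a < gdim i)%N.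
Proof.
rewrite /par /gdim; case: t => //; have [oa|oa] := boolP (odd a).
  case: a oa => //= a oa; rewrite !ltnNge; congr negb; apply/idP/idP; first by lia.
  rewrite leq_eqVlt => /orP[/eqP E|]; last by lia.
  by have := odd_double i; rewrite E /= oa.
apply/idP/idP; first by lia.
rewrite leq_eqVlt => /orP[/eqP E|]; last by lia.
by move: (odd_double i) => /=; rewrite -E /= oa.
Qed.

Lemma sgn2 a : sgn a * sgn a = 1.
Proof. by rewrite /sgn; case: t; rewrite ?mulr1 // -expr2 sqrr_sign. Qed.

Lemma sgn_conj a : (sgn a)^* = sgn a.
Proof. by rewrite /sgn; case: t; rewrite ?rmorph1 // rmorphXn rmorphN1. Qed.

Definition gltr x : F := \sum_(a \in [set: nat]) (x a a : F).

Lemma gltrE n x : in_corner n x -> gltr x = \tr (corner n x).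
Proof.
move=> xn; rewrite /gltr (@fsbig_bound _ F^o _ n) => [|c nc]; last first.
  by rewrite xn // nc.
by apply: eq_bigr => i _; rewrite mxE.
Qed.

(** The defining condition of g freed from the level i: [galgP] shows that it cuts g_i out of the
    matrices of the i-th corner, and [ginfP] that it cuts out g. *)
Definition gskew x := if t is SLinf then gltr x = 0 else
  forall a b, (x a b : F) = - (sgn a * sgn b) * x (par b) (par a).

End ClassicalAlgebra.

Arguments sgn {F} : simpl never.
Arguments par : simpl never.

Section Galg.
Variables (F : numClosedFieldType).
Local Notation gl := (glinf F).

Lemma omega_entry n (a b : 'I_n) :
  omega_mx F n a b = sgn SPinf a * ((b : nat) == par SPinf a)%:R.
Proof.
rewrite mxE /sgn /par; have [oa|oa] := boolP (odd a); rewrite ?expr0 ?mul1r //.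
rewrite expr1 mulN1r; case: (nat_of_ord a) oa => //= k _.
Qed.

Lemma omega_sqr i : omega_mx F i.*2 *m omega_mx F i.*2 = - 1%:M.
Proof.
apply/matrixP => a b; rewrite mxE.
have pa : (par SPinf a < i.*2)%N by have := par_gdim SPinf i a; rewrite /gdim => ->.
rewrite (bigD1 (Ordinal pa)) //= big1 ?addr0 => [|c ca]; last first.
  rewrite [omega_mx _ _ a c]omega_entry (_ : _ == _ = false) ?mulr0 ?mul0r //.
  by apply: contraNF ca => /eqP ca; apply/eqP/val_inj.
rewrite !omega_entry /= eqxx mulr1 (parK SPinf) !mxE mulrA (eq_sym (b : nat)).
rewrite -(inj_eq val_inj) -mulNrn; case: eqP => _; rewrite ?mulr0 ?mulr1 //.
rewrite /sgn /par; case: (boolP (odd a)); case: (nat_of_ord a) => //= k.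
- by move=> /negbTE ->; rewrite expr1 expr0 mulr1.
- by rewrite expr1 expr0 mul1r.
- by move=> ->; rewrite expr1 expr0 mul1r.
Qed.

Lemma omega_tr n : (omega_mx F n)^T = - omega_mx F n.
Proof.
have ne (k l : nat) : odd k = odd l -> (k == l.+1 :> nat) = false.
  by move=> E; apply/negP => /eqP kl; move: E; rewrite kl /=; case: (odd l).
apply/matrixP => a b; rewrite !mxE; case: ifP => ob; case: ifP => oa.
- by rewrite -!(eq_sym (_ : nat) _.+1) !ne ?oa ?ob ?oppr0.
- by rewrite eq_sym.
- by rewrite opprK eq_sym.
- by rewrite !ne ?oa ?ob ?oppr0.
Qed.

Variable t : classical_type.

Definition form_mx n : 'M[F]_n := if t is SPinf then omega_mx F n else 1%:M.
Definition form_sign : F := if t is SPinf then -1 else 1.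

Lemma form_sign2 : form_sign = 1 \/ form_sign = -1.
Proof. by rewrite /form_sign; case: t; [left|left|right]. Qed.

Lemma form_mx_tr n : (form_mx n)^T = form_sign *: form_mx n.
Proof.
by rewrite /form_mx /form_sign; case: t;
  rewrite ?scale1r ?tr_scalar_mx // omega_tr scaleN1r.
Qed.

Lemma form_mx_sqr i : form_mx (gdim t i) *m form_mx (gdim t i) = form_sign%:M.
Proof.
rewrite /form_mx /form_sign /gdim; case: t; rewrite ?mulmx1 // omega_sqr.
by rewrite raddfN.
Qed.

Lemma form_mx_unit i : form_mx (gdim t i) \in unitmx.
Proof.
have E : form_mx (gdim t i) *m (form_sign *: form_mx (gdim t i)) = 1%:M.
  rewrite -scalemxAr form_mx_sqr scale_scalar_mx; congr (_%:M).
  by case: form_sign2 => ->; rewrite ?mulrNN mulr1.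
by have [] := mulmx1_unit E.
Qed.

Lemma galg_mx i (x : gl) : galg t i x <-> in_corner (gdim t i) x /\
  (if t is SLinf then \tr (corner (gdim t i) x) = 0 else
    corner (gdim t i) x *m form_mx (gdim t i) +
    form_mx (gdim t i) *m (corner (gdim t i) x)^T = 0).
Proof.
rewrite /galg /gdim /form_mx; case: t => //=; split=> -[xi E]; split=> //.
- by rewrite mulmx1 mul1mx E addrN.
- by move: E => /eqP; rewrite mulmx1 mul1mx addrC addr_eq0 => /eqP.
- set A := corner _ x in E *; set w := omega_mx _ _ in E *.
  have : w *m (A^T *m w + w *m A) *m w = 0 by rewrite E mulmx0 mul0mx.
  rewrite mulmxDr mulmxDl !mulmxA omega_sqr -!(mulmxA _ w w) omega_sqr.
  by rewrite mulmxN mulmx1 mulNmx mul1mx mulNmx -opprD addrC => /eqP;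
    rewrite oppr_eq0 => /eqP.
- set A := corner _ x in E *; set w := omega_mx _ _ in E *.
  have : w *m (A *m w + w *m A^T) *m w = 0 by rewrite E mulmx0 mul0mx.
  rewrite mulmxDr mulmxDl !mulmxA omega_sqr -!(mulmxA _ w w) omega_sqr.
  by rewrite mulmxN mulmx1 mulNmx mul1mx mulNmx -opprD addrC => /eqP;
    rewrite oppr_eq0 => /eqP.
Qed.

Lemma form_mx_entry i (a b : 'I_(gdim t i)) :
  form_mx (gdim t i) a b = sgn t a * ((b : nat) == par t a)%:R.
Proof.
rewrite /form_mx; case: t a b => /= a b; try exact: omega_entry.
  by rewrite mxE /sgn /par mul1r eq_sym.
by rewrite mxE /sgn /par mul1r eq_sym.
Qed.

Lemma galgP i (x : gl) : galg t i x <-> in_corner (gdim t i) x /\ gskew t x.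
Proof.
rewrite galg_mx; set n := gdim t i.
have [tS|tS] := pselect (t = SLinf).
  have tE (P Q : Prop) : (if t is SLinf then P else Q) = P by rewrite tS.
  by rewrite /gskew !tE; split=> -[xi]; rewrite (gltrE xi).
have tE (P Q : Prop) : (if t is SLinf then P else Q) = Q by case: (t) tS.
rewrite /gskew !tE.
have E (xi : in_corner n x) (a b : 'I_n) :
    (corner n x *m form_mx n + form_mx n *m (corner n x)^T) a b =
    x a (par t b) * sgn t (par t b) + sgn t a * x b (par t a).
  have pa : (par t a < n)%N by rewrite par_gdim.
  have pb : (par t b < n)%N by rewrite par_gdim.
  rewrite mxE !mxE [X in X + _](bigD1 (Ordinal pb)) //=.
  rewrite [X in _ + X](bigD1 (Ordinal pa)) //=.
  rewrite ![form_mx n _ _]form_mx_entry /= (parK t b) !eqxx !mulr1 !mxE /=.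
  rewrite big1 => [|c cb]; last first.
    have cbE : ((b : nat) == par t c) = false.
      by apply: contraNF cb => /eqP E; apply/eqP/val_inj; rewrite /= E parK.
    by rewrite form_mx_entry cbE !mulr0.
  rewrite big1 => [|c ca]; last first.
    have caE : ((c : nat) == par t a) = false.
      by apply: contraNF ca => /eqP E; apply/eqP/val_inj.
    by rewrite form_mx_entry caE mulr0 mul0r.
  by rewrite !addr0.
split=> -[xi H]; split=> //.
  move=> a b; have [an|na] := ltnP a n; last first.
    by rewrite xi ?na // (xi (par t b)) ?mulr0 // orbC leqNgt par_gdim -leqNgt na.
  have [bn|nb] := ltnP b n; last first.
    by rewrite xi ?nb ?orbT // (xi (par t b)) ?mulr0 // leqNgt par_gdim -leqNgt nb.
  have pb : (par t b < n)%N by rewrite par_gdim.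
  have /matrixP/(_ (Ordinal an) (Ordinal pb)) := H.
  rewrite E //= parK mxE => /eqP; rewrite addr_eq0 => /eqP h.
  by rewrite -[LHS]mulr1 -(sgn2 F t b) mulrA h mulNr mulrAC mulNr.
apply/matrixP => a b; rewrite E // [RHS]mxE (H a) parK.
have := sgn2 F t (par t b); move: (sgn t a) (sgn t (par t b)) => s s' s2.
have -> (y : F) : - (s * s') * y * s' = - (s * y) * (s' * s') by ring.
by rewrite s2 mulr1 addNr.
Qed.

End Galg.

(** * Regular elements *)

Section Closure.
Variables (F : numClosedFieldType) (t : classical_type).
Local Notation gl := (glinf F).

Lemma gskew_lin a (x y : gl) : gskew t x -> gskew t y -> gskew t (a *: x + y).
Proof.
have [n [xn yn _]] := in_corner_common x y 0.
rewrite /gskew; case: t; last 2 [by move=> X Y b c; rewrite !gl_lin X Y; ring].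
  rewrite (gltrE xn) (gltrE yn) (gltrE (in_corner_lin a xn yn)) corner_lin.
  by rewrite linearP /= => -> ->; rewrite mulr0 addr0.
by move=> X Y b c; rewrite !gl_lin X Y; ring.
Qed.

Lemma galg_lsub i : lsubspace (@galg F t i).
Proof.
split=> [|a x y].
  apply/galgP; split; first exact: in_corner0.
  rewrite /gskew; case: (t) => [|a b|a b]; rewrite ?gl0 ?mulr0 //.
  by rewrite (gltrE (@in_corner0 F 0)) /mxtrace big_ord0.
move=> /galgP[xi xs] /galgP[yi ys]; apply/galgP; split.
  exact: in_corner_lin.
exact: gskew_lin.
Qed.

Lemma galg_br i (x y : gl) : galg t i x -> galg t i y -> galg t i (glbr x y).
Proof.
rewrite !galg_mx => -[xi X] [yi Y]; split; first exact: glbr_corner.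
rewrite corner_br //; move: X Y; set A := corner _ x; set B := corner _ y.
have [tS|tS] := pselect (t = SLinf).
  have tE (P Q : Prop) : (if t is SLinf then P else Q) = P by rewrite tS.
  by rewrite !tE linearB /= mxtrace_mulC subrr.
have tE (P Q : Prop) : (if t is SLinf then P else Q) = Q by case: (t) tS.
rewrite !tE; set J := form_mx _ _ _.
move=> /eqP; rewrite addr_eq0 => /eqP X /eqP; rewrite addr_eq0 => /eqP Y.
rewrite linearB /= !trmx_mul mulmxBl mulmxBr !mulmxA.
have E (M N : 'M[F]_(gdim t i)) : M *m J = - (J *m M^T) -> N *m J = - (J *m N^T) ->
    M *m N *m J = J *m M^T *m N^T.
  by move=> MJ NJ; rewrite -mulmxA NJ mulmxN mulmxA MJ mulNmx opprK.
by rewrite (E _ _ X Y) (E _ _ Y X) addrA subrK addrN.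
Qed.

Lemma gdimS i j : (i <= j)%N -> (gdim t i <= gdim t j)%N.
Proof. by rewrite /gdim; case: t => //; rewrite leq_double. Qed.

Lemma leq_gdim i : (i <= gdim t i)%N.
Proof. by rewrite /gdim; case: t => //; rewrite -addnn leq_addr. Qed.

Lemma galgS i j : (i <= j)%N -> @galg F t i `<=` galg t j.
Proof.
move=> ij x /galgP[xi xs]; apply/galgP; split=> //.
exact: in_cornerS (gdimS ij) xi.
Qed.

Lemma galg_corner i x : @galg F t i x -> in_corner (gdim t i) x.
Proof. by case/galgP. Qed.

Lemma ginfP (x : gl) : ginf t x <-> gskew t x.
Proof.
split=> [[i _ /galgP[]//]|xs]; have [n xn] := glinf_bound x.
by exists n => //; apply/galgP; split=> //; apply: in_cornerS (leq_gdim n) xn.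
Qed.

Lemma galg_ginf i : @galg F t i `<=` ginf t.
Proof. exact: bigcup_sup. Qed.

Lemma ginf_lsub : lsubspace (@ginf F t).
Proof.
split; first by apply: (@galg_ginf 0); case: (galg_lsub 0).
by move=> a x y /ginfP xs /ginfP ys; apply/ginfP/gskew_lin.
Qed.

Lemma galg_subalgebra i : subalgebra (@galg F t i).
Proof. by split; [apply: galg_lsub|apply: galg_br]. Qed.

Lemma ginf_galg2 (x y : gl) : ginf t x -> ginf t y -> exists i, galg t i x /\ galg t i y.
Proof.
move=> [i _ xi] [j _ yj]; exists (maxn i j).
by split; [apply: galgS xi; apply: leq_maxl|apply: galgS yj; apply: leq_maxr].
Qed.

Lemma ginf_subalgebra : subalgebra (@ginf F t).
Proof.
split=> [|x y xg yg]; first exact: ginf_lsub.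
by have [i [xi yi]] := ginf_galg2 xg yg; apply: (@galg_ginf i); apply: galg_br.
Qed.
End Closure.

Section RegularElement.
Variables (F : numClosedFieldType) (t : classical_type).
Local Notation gl := (glinf F).

Lemma corner_rep i (S : set gl) : S `<=` galg t i -> mxrep S (corner (gdim t i)).
Proof.
move=> Sg; split=> [a x y _ _|x y /Sg /galg_corner xi /Sg /galg_corner yi].
  exact: corner_lin.
exact: corner_br.
Qed.

(** H is the diagonal matrix of the labels, transported back by P. For sl the scalar kappa makes the
    trace vanish; for o and sp the grading of the form already makes H skew. *)
Lemma regular_element i (S : set gl) : subalgebra S -> solvable S -> S `<=` galg t i ->
  exists P d H kappa, [/\ triangular_for S (corner (gdim t i)) P d, galg t i H &
    P *m corner (gdim t i) H *m invmx P =
    diag_mx (\row_j (d j)%:~R) + kappa%:M].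
Proof.
move=> SS SV Sg; have R := corner_rep Sg; set n := gdim t i in R *.
have [tS|tS] := pselect (t = SLinf).
  have [P [d Pd]] := triangularization SS SV R; have [uP _ _] := Pd.
  pose k : F := - (\sum_j (d j)%:~R) / n%:R.
  pose D := diag_mx (\row_j (d j)%:~R) + k%:M.
  exists P, d, (gl_of (invmx P *m D *m P)), k; split=> //.
    have tE (X Q : Prop) : (if t is SLinf then X else Q) = X by rewrite tS.
    apply/galg_mx; split; first exact: gl_of_corner.
    rewrite tE corner_gl_of mxtrace_mulC mulmxA mulmxV // mul1mx.
    rewrite linearD /= mxtrace_scalar mxtrace_diag.
    under eq_bigr do rewrite mxE.
    rewrite /k -[_ *+ _]mulr_natr.
    have [n0|n0] := eqVneq n 0%N; last by rewrite mulfVK ?pnatr_eq0 // addrN.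
    rewrite big1 => [|j _]; first by rewrite oppr0 !mul0r addr0.
    by have := ltn_ord j; rewrite {2}n0.
  by rewrite corner_gl_of !mulmxA mulmxV // mul1mx mulmxK.
have tE (X Q : Prop) : (if t is SLinf then X else Q) = Q by case: (t) tS.
have sk x : S x -> corner n x *m form_mx F t n + form_mx F t n *m (corner n x)^T = 0.
  by move=> /Sg /galg_mx[_]; rewrite tE.
have [P [d [Pd dJ]]] := skew_triangularization SS SV (form_mx_unit F t i)
  (form_mx_tr F t n) (form_sign2 F t) R sk.
have [uP _ _] := Pd; pose D : 'M[F]_n := diag_mx (\row_j (d j)%:~R).
exists P, d, (gl_of (invmx P *m D *m P)), 0; split=> //; last first.
  by rewrite corner_gl_of !mulmxA mulmxV // mul1mx mulmxK // raddf0 addr0.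
apply/galg_mx; split; first exact: gl_of_corner.
rewrite tE corner_gl_of; set J := form_mx _ _ _; set H := _ *m P.
have : D *m (P *m J *m P^T) + P *m J *m P^T *m D^T = 0.
  rewrite tr_diag_mx; apply/matrixP => k l; rewrite mxE mul_diag_mx mul_mx_diag.
  rewrite !mxE mulrC -mulrDr -rmorphD /=.
  have [->|kl] := eqVneq (d k + d l) 0; first by rewrite mulr0.
  by have := dJ _ _ kl; rewrite mxE => ->; rewrite mul0r.
move=> E; have : P *m (H *m J + J *m H^T) *m P^T = 0.
  rewrite -[RHS]E mulmxDr mulmxDl /H !trmx_mul !mulmxA mulmxV // mul1mx.
  by rewrite -(mulmxA _ (invmx P)^T) -trmx_mul mulmxV // trmx1 mulmx1.
move=> /(congr1 (fun M => invmx P *m M *m invmx P^T)).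
by rewrite !mulmxA mulVmx // mul1mx mulmxK ?unitmx_tr // mulmx0 mul0mx.
Qed.
End RegularElement.

(** * Borel subalgebras and raising elements *)

Section TriangularDecomposition.
Variables (F : numClosedFieldType) (t : classical_type).
Local Notation gl := (glinf F).

(** Plays the part of the decomposition of K into b and the opposite nilpotent algebra, which H
    grades strictly negatively. *)
Definition triangular_decomposition (K b : set gl) := exists H, b H /\
  forall x, K x -> exists x0 (ys : seq gl), [/\ b x0, x = x0 + \sum_(y <- ys) y &
    forall y, y \in ys -> K y /\ exists c, 0 < c /\ glbr H y = - c *: y].

(** All the elements of g_i that are triangular for the flag of b form a solvable algebra, so by
    maximality they are exactly b. The components of negative ad H-degree supply the remaining
    summands. *)
Lemma borel_triangular i (b : set gl) : is_borel (galg t i) b ->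
  triangular_decomposition (galg t i) b.
Proof.
move=> [bS bg bsol bmax]; set g := galg t i in bg bmax *; set n := gdim t i.
have [P [d [H [kappa [[uP dI Pb] gH HE]]]]] := regular_element bS bsol bg.
rewrite -/n in P d uP dI Pb HE.
have gL : lsubspace g := galg_lsub F t i.
have gbr x y : g x -> g y -> g (glbr x y) by apply: galg_br.
have gn x : g x -> in_corner n x by apply: galg_corner.
pose cx (x : gl) := P *m corner n x *m invmx P.
have cxL a x y : cx (a *: x + y) = a *: cx x + cx y.
  by rewrite /cx corner_lin mulmxDr mulmxDl -scalemxAr -scalemxAl.
have cxL' : linear cx by [].
have cx0 := lin0 cxL'.
have cxbr x y : g x -> g y -> cx (glbr x y) = cx x *m cx y - cx y *m cx x.
  move=> /gn xn /gn yn; rewrite /cx corner_br // mulmxBr mulmxBl.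
  by rewrite !mulmxA !(mulmxKV uP).
have cxI x y : g x -> g y -> cx x = cx y -> x = y.
  move=> /gn xn /gn yn E; apply: in_cornerP xn yn _.
  have := congr1 (fun M => invmx P *m M *m P) E.
  by rewrite /cx !mulmxA !mulVmx // !mul1mx !(mulmxKV uP).
have cHE : cx H = diag_mx (\row_j (d j)%:~R) + kappa%:M := HE.
have cPb x : b x -> forall k l, d k < d l -> cx x k l = 0 := Pb x.
clearbody cx.
have cxH x k l : g x -> cx (glbr H x) k l = (d k - d l)%:~R * cx x k l.
  move=> gx.
  rewrite cxbr // cHE mulmxDl mulmxDr mul_scalar_mx mul_mx_scalar.
  rewrite opprD addrACA subrr addr0 mul_diag_mx mul_mx_diag.
  move: (cx x) => X; rewrite !mxE.
  by rewrite [X in _ - X]mulrC -mulrBl -rmorphB.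
(* Elements whose components all have degree d a - d c at least k. A bracket raises the level by
   one, even from level 0, where the diagonal parts commute; this bounds the derived series. *)
pose Lev (k : nat) := [set x | g x /\ forall a c, d a < d c + k -> cx x a c = 0].
have LevL k : subspace (Lev k).
  split; first by split=> [|a c _]; [case: gL|rewrite cx0 mxE].
  move=> a x y [gx xk] [gy yk]; split; first exact: gL.2.
  by move=> e f ef; rewrite cxL !mxE xk // yk // mulr0 addr0.
have Levbr k x y : Lev k x -> Lev k y -> Lev k.+1 (glbr x y).
  move=> [gx xk] [gy yk]; split=> [|a c ac]; first exact: gbr.
  rewrite cxbr // !mxE; apply/eqP; rewrite subr_eq0; apply/eqP.
  have [dac|dac] := ltP (d a) (d c + k + k).
    rewrite !big1 // => e _.
      have [h|h] := ltP (d a) (d e + k); first by rewrite yk // mul0r.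
      by rewrite (xk e c) ?mulr0 //; lia.
    have [h|h] := ltP (d a) (d e + k); first by rewrite xk // mul0r.
    by rewrite (yk e c) ?mulr0 //; lia.
  have k0 : k = 0%N by lia.
  have /dI ca : d a = d c by lia.
  rewrite -ca; apply: eq_bigr => e _; rewrite {}k0 in xk yk.
  have [/dI ->|nae] := eqVneq (d e) (d a); first by rewrite mulrC.
  have [h|h] := ltP (d e) (d a); first by rewrite (xk e a) ?(yk e a) ?mulr0 //; lia.
  by rewrite (xk a e) ?(yk a e) ?mul0r //; lia.
have Levsub k : Lev k.+1 `<=` Lev k.
  by move=> x [gx xk]; split=> // a c ac; apply: xk; lia.
pose st := Lev 0%N.
have stS : subalgebra st by split=> [|x y xs ys]; [apply: (LevL 0%N)|apply/Levsub/Levbr].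
have stsol : solvable st.
  have [N [N0 dN]] := maxz_bound d.
  exists (absz (N + N)).
  have Dk k : iter k (fun D => brspan D D) st `<=` Lev k.
    elim: k => //= k IH; apply: brspan_min => // x y /IH xk /IH yk.
    exact: Levbr.
  move=> x /Dk[gx xk]; apply: cxI => //; first by case: gL.
  rewrite cx0; apply/matrixP => a c; rewrite mxE; apply: xk.
  by have := dN a; have := dN c; lia.
have bst : st = b.
  apply: bmax => //; first by move=> x [].
  move=> x bx; split=> [|a c]; first exact: bg.
  by rewrite addr0; apply: cPb.
pose ds := undup [seq d p.1 - d p.2 | p <- enum {: 'I_n * 'I_n}].
have dsP a c : d a - d c \in ds.
  by rewrite mem_undup; apply/mapP; exists (a, c); rewrite ?mem_enum.
(* the component of degree e of x under ad H, by Lagrange interpolation *)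
have graded x e : g x -> exists2 y, g y &
    forall a c, cx y a c = (d a - d c == e)%:R * cx x a c.
  move=> gx; pose T (f : int) (y : gl) := - f%:~R *: y + glbr H y.
  have foldE (s : seq int) : g (foldr T x s) /\ forall a c,
      cx (foldr T x s) a c = (\prod_(f <- s) (d a - d c - f)%:~R) * cx x a c.
    elim: s => [|f s [IHg IH]] /=.
      by split=> // a c; rewrite big_nil mul1r.
    split=> [|a c]; first by apply: gL.2 => //; apply: gbr.
    rewrite cxL !mxE cxH // IH -mulrDl big_cons -mulrA; congr (_ * _).
    by rewrite addrC -rmorphN -rmorphD.
  have [gy yE] := foldE [seq f <- ds | f != e].
  have q0 : \prod_(f <- [seq f <- ds | f != e]) (e - f)%:~R != 0 :> F.
    rewrite prodf_seq_neq0; apply/allP => f; rewrite mem_filter => /andP[fe _].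
    by rewrite /= intr_eq0 subr_eq0 eq_sym.
  exists ((\prod_(f <- [seq f <- ds | f != e]) (e - f)%:~R)^-1 *:
    foldr T x [seq f <- ds | f != e]).
    exact: lsubZ.
  move=> a c; rewrite (linZ cxL') mxE yE mulrA; congr (_ * _).
  have [->|ne] := eqVneq (d a - d c) e; first by rewrite mulVf.
  rewrite (_ : \prod_(f <- _) (d a - d c - f)%:~R = 0) ?mulr0 ?mul0r //.
  apply/eqP; rewrite prodf_seq_eq0; apply/hasP; exists (d a - d c).
    by rewrite mem_filter ne dsP.
  by rewrite subrr mulr0z eqxx.
have [comp compE] : exists comp : gl -> int -> gl, forall x e, g x ->
    g (comp x e) /\ forall a c, cx (comp x e) a c = (d a - d c == e)%:R * cx x a c.
  have E (x : gl) (e : int) : exists y, g x ->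
      g y /\ forall a c, cx y a c = (d a - d c == e)%:R * cx x a c.
    have [gx|ngx] := pselect (g x); last by exists 0.
    by have [y gy yE] := graded x e gx; exists y.
  have /choice[f fE] (x : gl) : exists f : int -> gl, forall e, g x ->
      g (f e) /\ forall a c, cx (f e) a c = (d a - d c == e)%:R * cx x a c.
    by have /choice[f] := E x; exists f.
  by exists f => x e; apply: fE.
exists H; split.
  rewrite -bst; split=> // a c; rewrite addr0 => ac.
  rewrite cHE !mxE; have -> : (a == c) = false.
    by apply: contraTF ac => /eqP ->; rewrite ltxx.
  by rewrite !mulr0n addr0.
move=> x gx; pose x0 := \sum_(e <- ds | 0 <= e) comp x e.
exists x0, [seq comp x e | e <- ds & ~~ (0 <= e)].
have gx0 : g x0 by apply: lsub_sum => // e _; apply: (compE x e gx).1.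
split.
- rewrite -bst; split=> // a c; rewrite addr0 => ac.
  rewrite (lin_sum cxL') summxE big1 // => e e0.
  rewrite (compE x e gx).2 (_ : _ == _ = false) ?mul0r //.
  by apply/negP => /eqP E; move: e0; rewrite -E; lia.
- apply: cxI => //.
    apply: lsubD => //; rewrite big_map; apply: lsub_sum => // e _.
    exact: (compE x e gx).1.
  rewrite big_map big_filter.
  have -> : x0 + \sum_(e <- ds | ~~ (0 <= e)) comp x e = \sum_(e <- ds) comp x e.
    by rewrite [RHS](bigID (fun e => 0 <= e)).
  rewrite (lin_sum cxL'); apply/matrixP => a c.
  rewrite summxE; under eq_bigr => e _ do rewrite (compE x e gx).2.
  rewrite (bigD1_seq (d a - d c)) ?dsP ?undup_uniq //= eqxx mul1r big1 ?addr0 //.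
  by move=> e ne; rewrite eq_sym (negbTE ne) mul0r.
move=> y /mapP[e]; rewrite mem_filter => /andP[e0 _] ->.
have [gy yE] := compE x e gx; split=> //; exists (- e)%:~R; split.
  by rewrite ltr0z; lia.
apply: cxI; [exact: gbr|exact: lsubZ|].
apply/matrixP => a c; rewrite cxH // (linZ cxL') mxE yE.
by case: eqP => [->|_]; rewrite ?mul0r ?mulr0 // rmorphN opprK.
Qed.
End TriangularDecomposition.

(** * Highest weight vectors *)

Section HighestWeight.
Variables (F : numClosedFieldType) (K b : set (glinf F)).
Hypotheses (KS : subalgebra K) (bK : b `<=` K).

Section Eigenvalues.
Variables (K0 : set (glinf F)) (M : lieModule K0) (H : glinf F) (chi : F).
Local Notation op e := (fun z : M => lact H z - e *: z).

Lemma op_linear e : linear (op e).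
Proof.
move=> a u w; rewrite lact_linear scalerBr scalerDr !scalerA [e * a]mulrC.
by rewrite opprD addrACA.
Qed.

Definition ops (es : seq F) (z : M) := foldr (fun e u => op e u) z es.

Lemma ops_linear es : linear (ops es).
Proof. by elim: es => // e es IH a u w /=; rewrite IH op_linear. Qed.

Lemma ops_cat es es' z : ops (es ++ es') z = ops es (ops es' z).
Proof. exact: foldr_cat. Qed.

Lemma ops_comm es es' z : ops es (ops es' z) = ops es' (ops es z).
Proof.
have opC e f (u : M) : op e (op f u) = op f (op e u).
  rewrite !lactB !lactZ !scalerBr !scalerA [e * f]mulrC !opprD !opprK !addrA.
  by congr (_ + _); rewrite -!addrA; congr (_ + _); rewrite addrC.
have opsC e : ops es' (op e z) = op e (ops es' z).
  elim: es' => //= f es' ->; exact: opC.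
elim: es => //= e es IH; rewrite IH.
elim: es' {IH opsC} (ops es z) => //= f es' IH u.
by rewrite -opC IH.
Qed.

Lemma ops_eigen es z e : lact H z = e *: z -> ops es z = (\prod_(f <- es) (e - f)) *: z.
Proof.
move=> Hz; elim: es => [|f es IH] /=; first by rewrite big_nil scale1r.
rewrite IH lactZ Hz !scalerA -scalerBl big_cons; congr (_ *: _).
by rewrite mulrBl mulrC.
Qed.

(* sums of generalized H-eigenvectors with eigenvalues below chi *)
Definition lower (z : M) := exists es, (forall e, e \in es -> 0 < chi - e) /\ ops es z = 0.

Lemma lower_lsub : lsubspace lower.
Proof.
split; first by exists [::].
move=> a u w [es [esP uE]] [es' [esP' wE]]; exists (es ++ es'); split.
  by move=> e; rewrite mem_cat => /orP[/esP|/esP'].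
rewrite ops_linear !ops_cat wE (lin0 (ops_linear es)) addr0.
by rewrite ops_comm uE (lin0 (ops_linear es')) scaler0.
Qed.
End Eigenvalues.

(** Here H acts like a regular dominant coweight: each summand outside b lowers its eigenvalues. *)
Definition raising_bound H := b H /\
  forall x, K x -> exists x0 (ys : seq (glinf F)), [/\ b x0, x = x0 + \sum_(y <- ys) y &
    forall y, y \in ys -> K y /\ exists c, 0 < c /\ glbr H y = - c *: y].

Section Gen.
Variables (K0 : set (glinf F)) (M : lieModule K0) (H : glinf F) (chi : F).
Hypotheses (K0L : lsubspace K0) (KK0 : K `<=` K0) (bH : raising_bound H).
Variable v : M.
Hypotheses (bv : forall x, b x -> exists a, lact x v = a *: v) (Hv : lact H v = chi *: v).

(** The counterpart of U(K) v = U(n_-) v: what lowering elements alone produce from v is already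
    K-stable, since moving an element of K past a lowering element costs a bracket in K, and on v
    itself b acts by scalars. *)
Lemma gen_lower z : gen K v z -> exists c, lower H chi (z - c *: v).
Proof.
have lL := lower_lsub M H chi; have KH : K H by apply: bK; case: bH.
pose Y := [set y | K y /\ exists c, 0 < c /\ glbr H y = - c *: y].
pose gY := [set z : M | forall S : set M, lsubspace S ->
  (forall y z, Y y -> S z -> S (lact y z)) -> S v -> S z].
have gYL : lsubspace gY.
  split; first by move=> S [].
  by move=> a u w gu gw S SL SY Sv; apply: SL.2; [apply: gu|apply: gw].
have gYY y u : Y y -> gY u -> gY (lact y u).
  by move=> Yy gu S SL SY Sv; apply: (SY) => //; apply: gu.
have gYv : gY v by move=> S.
have opsY es y c u : K y -> glbr H y = - c *: y ->
    ops H [seq e - c | e <- es] (lact y u) = lact y (ops H es u) :> M.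
  move=> Ky Hy; elim: es => //= e es ->; rewrite lactB lactZ.
  have -> w : lact H (lact y w) = lact y (lact H w) + lact (glbr H y) w :> M.
    by rewrite lact_br; [rewrite addrC subrK|apply: KK0|apply: KK0].
  rewrite Hy (lactZl K0L); last exact: KK0.
  rewrite scalerBl opprB scaleNr.
  by rewrite addrA subrK.
have lvY y : Y y -> lower H chi (lact y v).
  move=> [Ky [c [c0 Hy]]]; exists [:: chi - c]; split=> [e|].
    by rewrite inE => /eqP ->; rewrite subKr.
  have /= := opsY [:: chi] y c v Ky Hy; rewrite Hv subrr lact0.
  exact.
have gYlow u : gY u -> exists c, lower H chi (u - c *: v).
  move=> gu; suff : [set u | exists c, lower H chi (u - c *: v)] u by [].
  apply: gu => {u}.
  - split; first by exists 0; rewrite scale0r subr0; case: lL.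
    move=> a u w [c uc] [c' wc]; exists (a * c + c').
    rewrite (_ : _ - _ = a *: (u - c *: v) + (w - c' *: v)); first exact: lL.2.
    by rewrite scalerBr scalerDl scalerA opprD addrACA.
  - move=> y u Yy [c uc]; exists 0; rewrite scale0r subr0.
    rewrite -[u](subrK (c *: v)) lactD lactZ; apply: lsubD => //; last first.
      by apply: lsubZ => //; apply: lvY.
    case: Yy uc => Ky [c' [c'0 Hy]] [es [esP uE]].
    exists [seq e - c' | e <- es]; rewrite opsY // uE lact0; split=> // e.
    by move=> /mapP[f /esP f0 ->]; rewrite opprB addrA addrAC addr_gt0.
  - by exists 1; rewrite scale1r subrr; case: lL.
move=> gz; apply: gYlow; apply: gz => //; last first.
move=> x u Kx gu.
suff : [set u | gY u /\ forall x, K x -> gY (lact x u)] u by case=> _; apply.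
apply: gu => {x u Kx}.
- split; first by split=> [|y Ky]; rewrite ?lact0; case: gYL.
  move=> a u w [gu uK] [gw wK]; split; first exact: gYL.2.
  by move=> y Ky; rewrite lact_linear; apply: gYL.2; [apply: uK|apply: wK].
- move=> y u Yy [gu uK]; split=> [|x' Kx']; first exact: gYY.
  have Ky : K y by case: Yy.
  have -> : lact x' (lact y u) = lact y (lact x' u) + lact (glbr x' y) u.
    by rewrite lact_br; [rewrite addrC subrK|apply: KK0|apply: KK0].
  apply: (lsubD gYL); first by apply: gYY => //; apply: uK.
  by apply: uK; apply: KS.2.
split=> // x' Kx'; have [x0 [ys [bx0 -> ysP]]] := bH.2 _ Kx'.
have K0ys y : y \in ys -> K0 y by move=> /ysP[Ky _]; apply: KK0.
have Ksum : K0 (\sum_(y <- ys | (y \in ys) && true) y).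
  by apply: (@lsub_sum _ _ K0 _ _ _ _ K0L) => y /andP[/K0ys].
rewrite big_seq_cond (lactDl _ (KK0 (bK bx0)) Ksum).
rewrite (lact_suml K0L); last by move=> y /andP[/K0ys].
have [a ->] := bv bx0; apply: (lsubD gYL); first exact: (lsubZ a gYL gYv).
apply: (@lsub_sum _ _ gY _ _ _ _ gYL) => y /andP[/ysP ? _]; exact: gYY.
Qed.

(** The product of the H - f over eigenvalues f below chi kills z - c v. If it acts invertibly on z,
    then z is a multiple of v; otherwise e is one of the f. The inequality in the third case also
    asserts that chi - e is real. *)
Lemma gen_weight z e : gen K v z -> lact H z = e *: z ->
  [\/ z = 0, e = chi /\ exists c, z = c *: v | 0 < chi - e].
Proof.
move=> /gen_lower[c [es [esP E]]] Hz.
have Pchi : \prod_(f <- es) (chi - f) != 0.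
  by rewrite prodf_seq_neq0; apply/allP => f /esP; rewrite implyTb => /gt_eqF ->.
move: E; rewrite (linB (ops_linear _ _)) (linZ (ops_linear _ _)).
rewrite (ops_eigen _ Hz) (ops_eigen _ Hv) => /eqP; rewrite subr_eq0 => /eqP E.
have [ec|ec] := eqVneq e chi.
  constructor 2; split=> //; exists c; move: E; rewrite ec scalerA mulrC -scalerA.
  exact: scalerI.
have [->|z0] := eqVneq z 0; [by constructor 1|constructor 3].
have [e0|e0] := eqVneq (\prod_(f <- es) (e - f)) 0.
  move/eqP: e0; rewrite prodf_seq_eq0 => /hasP[f /esP f0 /=].
  by rewrite subr_eq0 => /eqP ->.
case/eqP: ec; have zE : z = ((\prod_(f <- es) (e - f))^-1 *
    (c * \prod_(f <- es) (chi - f))) *: v.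
  by rewrite -scalerA -[_ *: v]scalerA -E scalerK.
have := Hz; rewrite {1}zE lactZ Hv scalerA mulrC -scalerA -zE => /eqP.
by rewrite -subr_eq0 -scalerBl scaler_eq0 (negPf z0) orbF subr_eq0 => /eqP.
Qed.
End Gen.

Definition irr K0 (M : lieModule K0) (v : M) :=
  v <> 0 /\ forall z, gen K v z -> z <> 0 -> gen K z v.

Section Product.
Variables (K1 K2 : set (glinf F)) (M : lieModule K1) (N : lieModule K2).
Hypotheses (KK1 : K `<=` K1) (KK2 : K `<=` K2).

Lemma prod_mod_linear x : linear (fun p : M * N => (lact x p.1, lact x p.2)).
Proof. by move=> a p q; rewrite /= !lact_linear. Qed.

Lemma prod_mod_lin a x y (p : M * N) : K x -> K y ->
  (lact (a *: x + y) p.1, lact (a *: x + y) p.2) =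
  a *: (lact x p.1, lact x p.2) + (lact y p.1, lact y p.2).
Proof.
by move=> Kx Ky; rewrite !lact_lin //; do ?[exact: KK1|exact: KK2].
Qed.

Lemma prod_mod_br x y (p : M * N) : K x -> K y ->
  (lact (glbr x y) p.1, lact (glbr x y) p.2) =
  (lact x (lact y p.1), lact x (lact y p.2)) -
  (lact y (lact x p.1), lact y (lact x p.2)).
Proof.
by move=> Kx Ky; rewrite !lact_br //; do ?[exact: KK1|exact: KK2].
Qed.

Definition prod_mod : lieModule K := @LieModule F K (M * N)%type
  (fun x p => (lact x p.1, lact x p.2)) prod_mod_linear prod_mod_lin prod_mod_br.

(** The candidate for the graph of a K-homomorphism from U(K) v to N that sends v to w. *)
Definition gen2 (v : M) (w : N) : set (M * N) := gen K ((v, w) : prod_mod).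

Lemma gen2_id v w : gen2 v w (v, w).
Proof. exact: gen_id. Qed.

Lemma gen2_lsub v w : lsubspace (gen2 v w).
Proof. exact: (@gen_lsub _ K K prod_mod). Qed.

Lemma gen2_act v w x m n : K x -> gen2 v w (m, n) -> gen2 v w (lact x m, lact x n).
Proof. by move=> Kx g; apply: (@gen_stable _ K K prod_mod _ x (m, n)). Qed.

Lemma gen2_min v w (S : set (M * N)) : lsubspace S ->
  (forall x m n, K x -> S (m, n) -> S (lact x m, lact x n)) -> S (v, w) ->
  gen2 v w `<=` S.
Proof.
move=> SL SK Svw; apply: (@gen_min _ K K prod_mod (v, w) S) => //.
by move=> x [m n]; apply: SK.
Qed.

Lemma gen2_snd v w m n : gen2 v w (m, n) -> gen K w n.
Proof.
move=> g; suff : [set p : M * N | gen K w p.2] (m, n) by [].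
apply: gen2_min g; [|move=> x m' n' Kx gm; exact: (gen_stable Kx gm)|exact: gen_id].
have gL := gen_lsub K w; split; first by case: gL.
by move=> a p q gp gq; apply: gL.2.
Qed.

Lemma gen2_surj v w m : gen K v m -> exists n, gen2 v w (m, n).
Proof.
move=> g; suff : [set m | exists n, gen2 v w (m, n)] m by [].
apply: gen_min g; [split|move=> x u Kx [n gu]|].
- by exists 0; case: (gen2_lsub v w).
- move=> a u u' [n gu] [n' gu']; exists (a *: n + n').
  exact: ((gen2_lsub v w).2 a (u, n) (u', n') gu gu').
- by exists (lact x n); apply: gen2_act.
- by exists w; apply: gen2_id.
Qed.
End Product.

Lemma gen2_swap K1 K2 (M : lieModule K1) (N : lieModule K2)
    (KK1 : K `<=` K1) (KK2 : K `<=` K2) (v : M) (w : N) m n :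
  gen2 KK1 KK2 v w (m, n) -> gen2 KK2 KK1 w v (n, m).
Proof.
move=> g; suff : [set p : M * N | gen2 KK2 KK1 w v (p.2, p.1)] (m, n) by [].
apply: gen2_min g; [|move=> x m' n' Kx gm; exact: gen2_act|exact: gen2_id].
have gL := gen2_lsub KK2 KK1 w v; split; first by case: gL.
by move=> a p q gp gq; apply: (gL.2 a (p.2, p.1) (q.2, q.1)).
Qed.

Definition same_character K1 K2 (M : lieModule K1) (N : lieModule K2) (v : M) (w : N) :=
  forall x, b x -> exists a, lact x v = a *: v /\ lact x w = a *: w.

Lemma same_characterC K1 K2 (M : lieModule K1) (N : lieModule K2) (v : M) (w : N) :
  same_character v w -> same_character w v.
Proof. by move=> vw x bx; have [a [? ?]] := vw x bx; exists a. Qed.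

Section Pair.
Variable H : glinf F.
Hypothesis bH : raising_bound H.

(** If (0, n) lies in the module with n nonzero, irreducibility brings in (0, w). This has the same
    H-eigenvalue as the generator (v, w), so it is a multiple of it, which is impossible since v and
    w are nonzero. *)
Lemma pair_eq0 K1 K2 (M : lieModule K1) (N : lieModule K2)
    (KK1 : K `<=` K1) (KK2 : K `<=` K2) (v : M) (w : N) m n :
  v <> 0 -> irr w -> same_character v w -> gen2 KK1 KK2 v w (m, n) -> m = 0 -> n = 0.
Proof.
move=> v0 [w0 wirr] vw g m0; rewrite m0 in g; apply: contrapT => n0.
have GL := gen2_lsub KK1 KK2 v w.
have g0w : gen2 KK1 KK2 v w (0, w).
  have := wirr n (gen2_snd g) n0; move=> h.
  suff : [set n' | gen2 KK1 KK2 v w (0, n')] w by [].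
  apply: gen_min h => //; [split|].
  - by case: GL.
  - move=> a u u' gu gu'; rewrite /= -[X in (X, _)](addr0 (0 : M)).
    by rewrite -{1}(scaler0 M a); apply: (GL.2 a (0, u) (0, u')).
  - by move=> x u Kx /(gen2_act Kx); rewrite lact0.
have [a [Hv Hw]] := vw H bH.1.
pose P := prod_mod M N KK1 KK2.
have bvw x : b x -> exists a, lact x ((v, w) : P) = a *: ((v, w) : P).
  by move=> /vw[e [xv xw]]; exists e; rewrite /= xv xw.
have Hvw : lact H ((v, w) : P) = a *: ((v, w) : P) by rewrite /= Hv Hw.
have H0w : lact H ((0, w) : P) = a *: ((0, w) : P).
  by rewrite /= lact0 Hw -[X in (X, _)](scaler0 M a).
have [[]//|[_ [c [/esym/eqP]]]|] := gen_weight KS.1 (fun _ h => h) bH bvw Hvw g0w H0w.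
  rewrite scaler_eq0 => /orP[/eqP->|/eqP//].
  by rewrite scale0r.
by rewrite subrr ltxx.
Qed.

(** The orthogonal projection q of v to the module of z is an H-eigenvector with the eigenvalue of
    v, hence a multiple of v. It is nonzero: otherwise the whole module of v, including z, would be
    orthogonal to the module of z. *)
Lemma irr_unitary K0 (M : lieModule K0) (B : M -> M -> F) (v : M) :
  K `<=` K0 -> lsubspace K0 -> posform B ->
  (forall x, K x -> exists2 x', K x' & forall u u', B (lact x u) u' = B u (lact x' u')) ->
  v <> 0 -> (forall x, b x -> exists a, lact x v = a *: v) ->
  fdim_mod (gen K v) [set 0] -> irr v.
Proof.
move=> KK0 K0L Bp Badj v0 bv fv; split=> // z gz z0; have Bf := Bp.1.
have QL := gen_lsub K z; have QK := @gen_stable _ K _ _ z.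
have [q [Qq qo]] := orthogonal_projection Bp QL
  (fdim_modS (gen_trans gz) fv) v.
have [chi Hv] := bv H bH.1; have KH : K H by apply: bK; case: bH.
have Hq : lact H q = chi *: q.
  apply/eqP; rewrite -subr_eq0; apply/eqP/Bp.2; set d := _ - _.
  have Qd : gen K z d by exact: (lsubB QL (QK _ _ KH Qq) (lsubZ chi QL Qq)).
  have dE : d = chi *: (v - q) - lact H (v - q).
    by rewrite lactB Hv scalerBr opprB addrC addrA subrK.
  rewrite {1}dE (formBl Bf) (formZl Bf) qo // mulr0 sub0r.
  have [H' KH' ->] := Badj H KH; rewrite qo ?oppr0 //; exact: QK.
have gq : gen K v q by apply: gen_trans gz _ Qq.
have ortho : q <> 0.
  move=> q0; case: z0; apply: Bp.2; move: qo; rewrite q0 => qo.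
  have : [set u | forall s, gen K z s -> B u s = 0] z.
    apply: gz => //; first split.
    + by move=> s _; rewrite (form0l Bf).
    + by move=> a u w uo wo s Qs; case: Bf => -> _ _; rewrite uo // wo // mulr0 addr0.
    + move=> x u Kx uo s Qs; have [x' Kx' ->] := Badj x Kx.
      by apply: uo; apply: QK.
    by move=> s Qs; have := qo s Qs; rewrite subr0.
  by apply; apply: gen_id.
have [/ortho//|[_ [c qE]]|] := gen_weight K0L KK0 bH bv Hv gq Hq; last first.
  by rewrite subrr ltxx.
have [c0|c0] := eqVneq c 0; first by case: ortho; rewrite qE c0 scale0r.
by rewrite -[v](scalerK c0) -qE; apply: (lsubZ c^-1 QL Qq).
Qed.
End Pair.

End HighestWeight.

(** * Contravariant unitary forms on tensor modules *)

Section Star.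
Variable F : numClosedFieldType.
Local Notation gl := (glinf F).

Definition gstar_row (x : gl) (a b : nat) : F^o := ((x b a : F)^*).

Lemma gstar_row_subproof x a : gstar_row x a \in @fsupp F F^o.
Proof.
have [n xn] := glinf_bound x; apply/asboolP; exists n => b nb.
by rewrite /gstar_row xn ?nb // rmorph0.
Qed.

Definition gstar_fun (x : gl) (a : nat) : fseq F^o := FSeq (gstar_row_subproof x a).

Lemma gstar_subproof x : gstar_fun x \in @fsupp F (fseq F^o).
Proof.
have [n xn] := glinf_bound x; apply/asboolP; exists n => a na.
by apply: fseqP => b; rewrite /= /gstar_row xn ?na ?orbT // rmorph0.
Qed.

(** The conjugate transpose, which becomes the adjoint for the Hermitian forms on tensor modules. *)
Definition gstar (x : gl) : gl := FSeq (gstar_subproof x).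

Lemma gstarE x a b : gstar x a b = (x b a : F)^*.
Proof. by []. Qed.

Lemma gstarK x : gstar (gstar x) = x.
Proof. by apply: glinfP => a b; rewrite !gstarE conjCK. Qed.

Lemma gstar_corner n x : in_corner n x -> in_corner n (gstar x).
Proof. by move=> xn a b ab; rewrite gstarE xn ?rmorph0 // orbC. Qed.

Lemma gskew_star t x : gskew t x -> gskew t (gstar x).
Proof.
have [n xn] := glinf_bound x.
have sE a b : (gstar x a b : F) = (x b a : F)^* by [].
have skE u (X : forall a b, (x a b : F) = - (sgn u a * sgn u b) * x (par u b) (par u a)) a b :
    (gstar x a b : F) = - (sgn u a * sgn u b) * gstar x (par u b) (par u a).
  by rewrite !sE X rmorphM rmorphN rmorphM /= !sgn_conj [sgn _ b * _]mulrC.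
rewrite /gskew; case: t; [|exact: skE|exact: skE].
rewrite (gltrE xn) (gltrE (gstar_corner xn)) => tr0.
rewrite -[RHS](rmorph0 Num.conj) -tr0 rmorph_sum; apply: eq_bigr => i _.
by rewrite !mxE.
Qed.

Lemma ginf_star t x : ginf t x -> ginf t (gstar x).
Proof. by move=> /ginfP xs; apply/ginfP/gskew_star. Qed.

Lemma galg_star t i x : galg t i x -> galg t i (gstar x).
Proof.
move=> /galgP[xi xs]; apply/galgP; split; first exact: gstar_corner.
exact: gskew_star.
Qed.
End Star.

Section Unitary.
Variables (F : numClosedFieldType) (t : classical_type).
Local Notation K := (@ginf F t).

Definition unitary_form (M : lieModule K) (B : M -> M -> F) := posform B /\
  forall x, K x -> forall u v, B (lact x u) v = B u (lact (gstar x) v).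

(** By the last condition every sufficiently late step is a g_i-module, so each vector generates a
    finite-dimensional one. *)
Definition filtration (M : lieModule K) (Fil : nat -> set M) :=
  [/\ forall n, lsubspace (Fil n), forall n, Fil n `<=` Fil n.+1,
   forall v, exists n, Fil n v, forall n, fdim_mod (Fil n) [set 0] &
   forall n x v, K x -> in_corner n x -> Fil n v -> Fil n (lact x v)].

Lemma filtrationS (M : lieModule K) (Fil : nat -> set M) n m :
  filtration Fil -> (n <= m)%N -> Fil n `<=` Fil m.
Proof.
move=> [_ FS _ _ _]; elim: m => [|m IH]; first by rewrite leqn0 => /eqP->.
by rewrite leq_eqVlt => /orP[/eqP->//|/IH h v /h]; apply: FS.
Qed.

Definition triv_form (u v : triv_mod K) : F := (u : F) * (v : F)^*.

Lemma triv_unitary : unitary_form triv_form.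
Proof.
split; first split; first split; rewrite /triv_form.
- by move=> a u v w; rewrite mulrDl mulrA.
- by move=> u v; rewrite rmorphM /= conjCK mulrC.
- by move=> u; apply: mul_conjC_ge0.
- by move=> u /eqP; rewrite mul_conjC_eq0 => /eqP.
by move=> x Kx u v; rewrite /= mul0r rmorph0 mulr0.
Qed.

Lemma triv_filtration : filtration (fun=> [set: triv_mod K]).
Proof.
split=> // [v|n]; first by exists 0%N.
exists 1%N, (fun u : F^o => const_mx (u : F)); split.
  by move=> a u v; apply/matrixP => i j; rewrite !mxE.
by move=> v _ /matrixP/(_ 0 0); rewrite !mxE.
Qed.

Section Tens.
Variables (M : lieModule K) (W : matrep F) (B : M -> M -> F) (Fil : nat -> set M).
Hypotheses (BU : unitary_form B) (FM : filtration Fil).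
Hypothesis Wstar : forall x k c, coef W (gstar x) k c = (coef W x c k)^*.
Hypothesis Wcorner : forall n x k c, in_corner n x -> (n <= k)%N || (n <= c)%N ->
  coef W x k c = 0.

Definition tens_form (f g : tens M W) : F :=
  \sum_(k \in [set: nat]) B ((f : fseq M) k) ((g : fseq M) k).

Let Bf := BU.1.1.

Lemma tens_formE n (f g : tens M W) :
  (forall k, (n <= k)%N -> (f : fseq M) k = 0) \/
  (forall k, (n <= k)%N -> (g : fseq M) k = 0) ->
  tens_form f g = \sum_(k < n) B ((f : fseq M) k) ((g : fseq M) k).
Proof.
move=> fg; rewrite /tens_form (@fsbig_bound _ F^o _ n) // => c nc.
by case: fg => h; rewrite h ?(form0l Bf) ?(form0r Bf).
Qed.

Lemma tens_bound (f g : tens M W) : exists n,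
  (forall k, (n <= k)%N -> (f : fseq M) k = 0) /\
  (forall k, (n <= k)%N -> (g : fseq M) k = 0).
Proof.
have [n fn] := fseq_bound (f : fseq M); have [m gm] := fseq_bound (g : fseq M).
by exists (maxn n m); split=> k; rewrite geq_max => /andP[? ?]; [apply: fn|apply: gm].
Qed.

Lemma tens_unitary : unitary_form tens_form.
Proof.
split; first split; first split.
- move=> a u v w; have [n [un vn]] := tens_bound u v.
  have uvn k : (n <= k)%N -> ((a *: u + v : tens M W) : fseq M) k = 0.
    by move=> nk; rewrite fseq_lin un // vn // scaler0 addr0.
  rewrite !(@tens_formE n); try by left.
  rewrite mulr_sumr -big_split; apply: eq_bigr => k _.
  by rewrite fseq_lin (formDl Bf) (formZl Bf).
- move=> u v; have [n [un vn]] := tens_bound u v.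
  rewrite !(@tens_formE n); try by left.
  rewrite rmorph_sum; apply: eq_bigr => k _; exact: (formC Bf).
- move=> u; have [n [un _]] := tens_bound u u.
  by rewrite (@tens_formE n); [apply: sumr_ge0 => k _; apply: (form_ge0 Bf)|left].
- move=> u; have [n [un _]] := tens_bound u u.
  rewrite (@tens_formE n); last by left.
  move=> /psumr_eq0P h; apply: fseqP => k.
  have [nk|kn] := leqP n k; first exact: un.
  apply: BU.1.2; apply: (h _ (Ordinal kn)) => // i _; exact: (form_ge0 Bf).
move=> x Kx u v; have [n [un vn]] := tens_bound u v.
have [m xm] := coef_fin W x.
pose N := maxn n m; have nN : (n <= N)%N by apply: leq_maxl.
have xN k c : (N <= k)%N || (N <= c)%N -> coef W x k c = 0.
  by move=> h; apply: xm; move: h; rewrite !geq_max; case/orP=> /andP[_ ->]; rewrite ?orbT.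
have xsN k c : (N <= k)%N || (N <= c)%N -> coef W (gstar x) k c = 0.
  by move=> h; rewrite Wstar xN ?rmorph0 // orbC.
rewrite !(@tens_formE N); [|by left=> k /(leq_trans nN); apply: un|].
  under eq_bigr => k _ do rewrite /= /tens_fun (tens_sumE _ _ xN) (formDl Bf) (form_suml Bf) BU.2 //.
  under [RHS]eq_bigr => k _ do rewrite /= /tens_fun (tens_sumE _ _ xsN) (formDr Bf) (form_sumr Bf).
  rewrite !big_split; congr (_ + _); rewrite exchange_big; apply: eq_bigr => k _.
  by apply: eq_bigr => c _; rewrite (formZl Bf) (formZr Bf) Wstar conjCK.
by right=> k /(leq_trans nN); apply: vn.
Qed.

Definition tens_fil n : set (tens M W) := [set f |
  (forall k, (n <= k)%N -> (f : fseq M) k = 0) /\ forall k, Fil n ((f : fseq M) k)].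

Lemma tens_filtration : filtration tens_fil.
Proof.
have [FL FS Fex Ff FK] := FM; split.
- move=> n; split; first by split=> // k; case: (FL n).
  move=> a u v [un uF] [vn vF]; split=> [k nk|k]; rewrite fseq_lin.
    by rewrite un // vn // scaler0 addr0.
  exact: (FL n).2.
- move=> n u [un uF]; split=> k; last exact/FS/uF.
  by move=> nk; apply: un; apply: ltnW.
- move=> u; have [n un] := fseq_bound (u : fseq M).
  have /choice[l lE] k : exists m, Fil m ((u : fseq M) k) by apply: Fex.
  exists (maxn n (\max_(k < n) l k)); split=> k.
    by rewrite geq_max => /andP[nk _]; apply: un.
  have [nk|kn] := leqP n k; first by rewrite un //; case: (FL (maxn n (\max_(k < n) l k))).
  apply: filtrationS FM _ _ (lE k).
  by rewrite leq_max (leq_bigmax (Ordinal kn)) orbT.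
- move=> n; have [d [j [jL jI]]] := Ff n.
  exists (n * d)%N, (fun f : fseq M => mxvec (\matrix_(k < n) j (f k))); split.
    move=> a u v; rewrite -linearP; congr mxvec; apply/row_matrixP => k.
    by rewrite rowK fseq_lin jL linearP /= !rowK.
  move=> u [un uF] u0; apply: fseqP => k.
  have [nk|kn] := leqP n k; first exact: un.
  apply: jI => //.
  have /row_matrixP/(_ (Ordinal kn)) : \matrix_(k < n) j ((u : fseq M) k) = 0.
    by rewrite -[LHS]mxvecK u0 linear0.
  by rewrite rowK row0.
move=> n x u Kx xn [un uF]; split=> k => [nk|].
  rewrite /= /tens_fun un // lact0 add0r; apply: fsbig1 => c _.
  by rewrite (Wcorner xn) ?nk // scale0r.
have xn' k' c : (n <= k')%N || (n <= c)%N -> coef W x k' c = 0 by apply: Wcorner.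
rewrite /= /tens_fun (tens_sumE _ _ xn').
apply: (lsubD (FL n)); first exact: FK.
by apply: lsub_sum => // c _; apply: lsubZ.
Qed.
End Tens.

Definition vec_rep (d : bool) : matrep F := if d then nat_rep else conat_rep.

Lemma vec_rep_star d x k c : coef (vec_rep d) (gstar x) k c = (coef (vec_rep d) x c k)^*.
Proof. by case: d => //=; rewrite rmorphN. Qed.

Lemma vec_rep_corner d n x k c : in_corner n x -> (n <= k)%N || (n <= c)%N ->
  coef (vec_rep d) x k c = 0.
Proof.
case: d => xn kc; first exact: xn.
by rewrite -[LHS]/(- (x c k : F)) xn ?oppr0 // orbC.
Qed.

(* mixed tensor powers of V (letter true) and V_* (letter false), in any order *)
Fixpoint word_mod (w : seq bool) : lieModule K :=
  if w is d :: w' then tens (word_mod w') (vec_rep d) else triv_mod K.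

Fixpoint word_form (w : seq bool) : word_mod w -> word_mod w -> F :=
  if w is d :: w' then tens_form (W := vec_rep d) (@word_form w') else triv_form.

Fixpoint word_fil (w : seq bool) : nat -> set (word_mod w) :=
  if w is d :: w' then tens_fil (W := vec_rep d) (@word_fil w')
  else fun=> [set: triv_mod K].

Lemma word_unitary w : unitary_form (@word_form w).
Proof.
elim: w => [|d w IH]; first exact: triv_unitary.
by apply: tens_unitary => //; apply: vec_rep_star.
Qed.

Lemma word_filtration w : filtration (@word_fil w).
Proof.
elim: w => [|d w IH]; first exact: triv_filtration.
by apply: tens_filtration => //; apply: vec_rep_corner.
Qed.

Lemma tensor_module_word p q :
  word_mod (nseq q false ++ nseq p true) = tensor_module K p q.
Proof.
rewrite /tensor_module; elim: q => [|q IH] /=; last by rewrite IH.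
by elim: p => //= p ->.
Qed.

(* evaluating one tensor factor at an index beyond n is equivariant for the
   elements of the corner n *)
Lemma word_eval n w (u : word_mod w) : ~ word_fil n u ->
  exists w' (e : word_mod w -> word_mod w'), [/\ size w' = (size w).-1, linear e,
    forall x v, K x -> in_corner n x -> e (lact x v) = lact x (e v) & e u <> 0].
Proof.
elim: w u => [|d w IH] u nu; first by case: nu.
have [nz|] := pselect (exists2 k, (n <= k)%N & (u : fseq (word_mod w)) k <> 0).
  have [k nk uk0] := nz.
  exists w, (fun u : fseq (word_mod w) => u k); split=> // x v Kx xn.
  rewrite /= /tens_fun fsbig1 ?addr0 // => c _.
  by rewrite (vec_rep_corner _ xn) ?nk // scale0r.
move=> /forall2NP uk0.
have [k uk] : exists k, ~ word_fil n ((u : fseq (word_mod w)) k).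
  apply/not_existsP => h; apply: nu; split=> k => [nk|].
    by have [//|/contrapT] := uk0 k.
  by apply: contrapT => hk; apply: (h k).
have [w' [e [sw' eL eK eu]]] := IH _ uk.
have sw : (0 < size w)%N.
  have nil_fil (z : word_mod w) : size w = 0%N -> word_fil n z.
    by move=> /size0nil E; move: z; rewrite E.
  by rewrite lt0n; apply/eqP => /(nil_fil ((u : fseq (word_mod w)) k)).
have supp (v : fseq (word_mod w)) : (fun c => e (v c)) \in @fsupp F (word_mod w').
  have [m vm] := fseq_bound v; apply/asboolP; exists m => c /vm ->.
  exact: (lin0 eL).
exists (d :: w'), (fun v : fseq (word_mod w) => FSeq (supp v) : word_mod (d :: w')).
split.
- by rewrite /= sw' prednK.
- by move=> a v v'; apply: fseqP => c; rewrite fseq_lin /= eL.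
- move=> x v Kx xn; apply: fseqP => c; rewrite /= /tens_fun (linD eL) eK //.
  have xn' k' c' : (n <= k')%N || (n <= c')%N -> coef (vec_rep d) x k' c' = 0.
    exact: vec_rep_corner.
  rewrite !(tens_sumE _ _ xn') (lin_sum eL); congr (_ + _).
  by apply: eq_bigr => c' _; rewrite (linZ eL).
- by move=> /(congr1 (fun v : fseq (word_mod w') => v k)).
Qed.

Definition unitary_filtered (M : lieModule K) := exists B Fil,
  @unitary_form M B /\ @filtration M Fil.

Lemma sub_unitary_filtered (M N : lieModule K) (f : M -> N) :
  is_hom K f -> injective f -> unitary_filtered N -> unitary_filtered M.
Proof.
move=> [fL fK] fI [B [Fil [[[Bf Bp] BK] [FL FS Fex Ff FKs]]]].
exists (fun u v => B (f u) (f v)), (fun n => f @^-1` Fil n); split.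
  split; first split; first split.
  - by move=> a u v w; rewrite fL (formDl Bf) (formZl Bf).
  - by move=> u v; apply: (formC Bf).
  - by move=> u; apply: (form_ge0 Bf).
  - by move=> u /Bp fu0; apply: fI; rewrite fu0 (lin0 fL).
  by move=> x Kx u v; rewrite fK // BK // fK //; apply: ginf_star.
split.
- move=> n; split; first by rewrite /= (lin0 fL); case: (FL n).
  by move=> a u v /= uF vF; rewrite fL; apply: (FL n).2.
- by move=> n u /FS.
- by move=> u; apply: Fex.
- move=> n; have [d [j [jL jI]]] := Ff n; exists d, (j \o f); split.
    exact: linear_comp.
  by move=> u uF /(jI _ uF) /= fu0; apply: fI; rewrite fu0 (lin0 fL).
by move=> n x u Kx xn; rewrite /= fK //; apply: FKs.
Qed.

Lemma simple_tensor_word (M : lieModule K) : simple_tensor M ->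
  exists w (f : M -> word_mod w), is_hom K f /\ injective f.
Proof.
move=> [_ [p [q [f [fh fI]]]]]; exists (nseq q false ++ nseq p true).
by move: f fh fI; rewrite -tensor_module_word => f fh fI; exists f.
Qed.

Lemma simple_tensor_unitary (M : lieModule K) : simple_tensor M -> unitary_filtered M.
Proof.
move=> /simple_tensor_word[w [f [fh fI]]]; apply: (sub_unitary_filtered fh fI).
exists (@word_form w), (@word_fil w); split; first exact: word_unitary.
exact: word_filtration.
Qed.

Lemma gen_fdim (M : lieModule K) i (v : M) : unitary_filtered M ->
  fdim_mod (gen (galg t i) v) [set 0].
Proof.
move=> [B [Fil [_ FM]]]; have [FL _ Fex Ff FK] := FM; have [n vn] := Fex v.
apply: fdim_modS (Ff (maxn n (gdim t i))).
apply: gen_min => //; last by apply: filtrationS FM _ _ vn; apply: leq_maxl.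
move=> x u xi; apply: FK; first exact: galg_ginf xi.
by apply: in_cornerS (galg_corner xi); apply: leq_maxr.
Qed.

Lemma irr_galg (M : lieModule K) i b H (v : M) : b `<=` galg t i ->
  raising_bound (galg t i) b H -> unitary_filtered M -> v <> 0 ->
  (forall x, b x -> exists a, lact x v = a *: v) -> irr (galg t i) v.
Proof.
move=> bi bH MU v0 bv; have [B [Fil [[Bp BK] _]]] := MU.
apply: (irr_unitary (galg_subalgebra F t i) bi bH (@galg_ginf F t i)
  (ginf_lsub F t) Bp) => //; last exact: gen_fdim.
move=> x xi; exists (gstar x); first exact: galg_star.
by apply: BK; apply: galg_ginf xi.
Qed.

End Unitary.

(** * Singular vectors *)

Section Levels.
Variables (F : numClosedFieldType) (t : classical_type).
Local Notation K := (@ginf F t).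
Local Notation g i := (@galg F t i).
Local Notation gK i := (@galg_ginf F t i).

Lemma gen_union (M : lieModule K) (v m : M) : gen K v m -> exists i, gen (g i) v m.
Proof.
move=> gm; suff : [set m | exists i, gen (g i) v m] m by [].
have mono i j u : (i <= j)%N -> gen (g i) v u -> gen (g j) v u.
  by move=> /galgS ij; apply: genS; apply: ij.
apply: gm => [|x u [i _ xi] [j uj]|].
- split; first by exists 0%N; case: (gen_lsub (g 0) v).
  move=> a u w [i ui] [j wj]; exists (maxn i j); apply: (gen_lsub _ _).2.
    by apply: mono ui; apply: leq_maxl.
  by apply: mono wj; apply: leq_maxr.
- exists (maxn i j); apply: gen_stable; first by apply: galgS xi; apply: leq_maxl.
  by apply: mono uj; apply: leq_maxr.
- by exists 0%N; apply: gen_id.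
Qed.

Section Gen2.
Variables M N : lieModule K.

Definition gen2_at i : M -> N -> set (M * N) := gen2 (gK i) (gK i).
Definition gen2_all : M -> N -> set (M * N) :=
  gen2 (fun x (h : K x) => h) (fun x (h : K x) => h).

Lemma gen2_at_mono i j v w : (i <= j)%N -> gen2_at i v w `<=` gen2_at j v w.
Proof.
move=> ij; apply: gen2_min; [exact: gen2_lsub| |exact: gen2_id].
by move=> x m n xi; apply: gen2_act; apply: galgS xi.
Qed.

Lemma gen2_all_union v w p : gen2_all v w p -> exists i, gen2_at i v w p.
Proof.
move=> gp; suff : [set p | exists i, gen2_at i v w p] p by [].
apply: gen2_min gp => [|x m n [i _ xi] [j mj]|].
- split; first by exists 0%N; case: (gen2_lsub (gK 0) (gK 0) v w).
  move=> a p1 p2 [i pi] [j pj]; exists (maxn i j); apply: (gen2_lsub _ _ _ _).2.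
    by apply: gen2_at_mono pi; apply: leq_maxl.
  by apply: gen2_at_mono pj; apply: leq_maxr.
- exists (maxn i j); apply: gen2_act; first by apply: galgS xi; apply: leq_maxl.
  by apply: gen2_at_mono mj; apply: leq_maxr.
- by exists 0%N; apply: gen2_id.
Qed.
End Gen2.
End Levels.

Section Singular.
Variables (F : numClosedFieldType) (t : classical_type).
Local Notation K := (@ginf F t).
Local Notation g i := (@galg F t i).
Variable b : nat -> set (glinf F).
Hypotheses (bB : forall i, is_borel (g i) (b i)) (bS : forall i, b i `<=` b i.+1).

Lemma borel_sub i : b i `<=` g i.
Proof. by case: (bB i). Qed.

Lemma borel_mono i j : (i <= j)%N -> b i `<=` b j.
Proof.
elim: j => [|j IH]; first by rewrite leqn0 => /eqP->.
by rewrite leq_eqVlt => /orP[/eqP->//|/IH h x /h]; apply: bS.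
Qed.

Lemma borel_raising i : exists H, raising_bound (g i) (b i) H.
Proof. exact: borel_triangular. Qed.

Definition singular K1 K2 (M : lieModule K1) (v : M) (N : lieModule K2) i : set N :=
  [set w | forall x, b i x -> forall a, lact x v = a *: v -> lact x w = a *: w].
Arguments singular {K1 K2 M} v N i.

Section Theory.
Variables (M : lieModule K) (v : M).
Hypotheses (MU : unitary_filtered M) (v0 : v <> 0)
  (bv : forall i x, b i x -> exists a, lact x v = a *: v).

Lemma singular_lsub (N : lieModule K) i : lsubspace (singular v N i).
Proof.
split=> [x _ a _|a u w uS wS x bx e xv]; first by rewrite lact0 scaler0.
by rewrite lact_linear (uS x bx e xv) (wS x bx e xv) scalerDr !scalerA mulrC.
Qed.

Lemma singularS (N : lieModule K) i : singular v N i.+1 `<=` singular v N i.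
Proof. by move=> w wS x /bS; apply: wS. Qed.

Lemma singular_mono (N : lieModule K) i j : (i <= j)%N ->
  singular v N j `<=` singular v N i.
Proof. by move=> ij w wS x /(borel_mono ij); apply: wS. Qed.

Lemma singular_character (N : lieModule K) i w : singular v N i w ->
  same_character (b i) v w.
Proof. by move=> wS x bx; have [a xv] := bv bx; exists a; split=> //; apply: wS. Qed.

Lemma singular_bv (N : lieModule K) i w : singular v N i w ->
  forall x, b i x -> exists a, lact x w = a *: w.
Proof. by move=> /singular_character wS x /wS[a [_ xw]]; exists a. Qed.

Lemma singular_irr (N : lieModule K) i w : unitary_filtered N ->
  singular v N i w -> w <> 0 -> irr (g i) w.
Proof.
move=> NU wS w0; have [H bH] := borel_raising i.
exact: irr_galg (@borel_sub i) bH NU w0 (singular_bv wS).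
Qed.

(** [pair_eq0] in both directions: the module generated by (v, w) is the graph of an isomorphism. *)
Lemma singular_pair (N : lieModule K) i w m n : unitary_filtered N ->
  singular v N i w -> w <> 0 -> gen2_at i v w (m, n) -> m = 0 <-> n = 0.
Proof.
move=> NU wS w0 mn; have [H bH] := borel_raising i.
have vw := singular_character wS; split.
  apply: (pair_eq0 (galg_subalgebra F t i) (@borel_sub i) bH v0 _ vw mn).
  exact: singular_irr.
have wv := same_characterC vw.
apply: (pair_eq0 (galg_subalgebra F t i) (@borel_sub i) bH w0 _ wv (gen2_swap mn)).
exact: (singular_irr (w := v)).
Qed.

Hypothesis Mv : forall m, gen K v m.

Lemma singular_embedding (N : lieModule K) z : unitary_filtered N -> z <> 0 ->
  (forall i, singular v N i z) ->
  exists f : M -> N, [/\ is_hom K f, injective f & f v = z].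
Proof.
move=> NU z0 zS; have pair m n : gen2_all v z (m, n) -> m = 0 <-> n = 0.
  by move=> /gen2_all_union[k]; apply: singular_pair.
have [| |m|f [fL fG]] := @functional_linear F M N (gen2_all v z).
- exact: gen2_lsub.
- by move=> n /pair[->].
- exact: gen2_surj.
exists f; split; last by apply/esym/fG/gen2_id.
  split=> // x Kx m; apply/esym/fG; apply: gen2_act => //; exact/fG.
move=> m m' fmm; apply/eqP; rewrite -subr_eq0; apply/eqP.
have [_ ->] // := pair (m - m') (f (m - m')) ((fG _ _).2 erefl).
by rewrite (linB fL) fmm subrr.
Qed.

(* The multiplicity of the g_i-module generated by v in its own module is
   finite for large i.  Let r be the least length of a tensor word all of
   whose singular spaces are nonzero: evaluating a tensor factor at an index
   outside the i-th corner lands in a shorter word, so for large i the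
   singular vectors live in the i-th corner.  Hence the singular spaces are
   finite-dimensional and stationary, and M embeds in that word. *)
Lemma singular_stationary : simple_tensor M ->
  exists i1, forall i, (i1 <= i)%N -> singular v M i = singular v M i1.
Proof.
move=> MT; have [w0 [f0 [[f0L f0K] f0I]]] := simple_tensor_word MT.
have wU w : unitary_filtered (word_mod F t w).
  by exists (@word_form F t w), (@word_fil F t w); split;
    [apply: word_unitary|apply: word_filtration].
pose Q w := forall i, exists2 z, singular v (word_mod F t w) i z & z <> 0.
have ex : exists r, `[< exists w, size w = r /\ Q w >].
  exists (size w0); apply/asboolP; exists w0; split=> // i; exists (f0 v).
    move=> x bx a xv; rewrite -f0K ?xv ?(linZ f0L) //.
    exact/galg_ginf/borel_sub/bx.
  by move=> f0v; apply: v0; apply: f0I; rewrite f0v (lin0 f0L).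
have [r /asboolP[w [sw Qw]] rmin] := ex_minnP ex.
(* There are finitely many words of length r - 1, so one level i0 serves all of them. *)
have [i0 i0P] : exists i0, forall w', size w' = r.-1 -> (0 < r)%N ->
    forall z, singular v (word_mod F t w') i0 z -> z = 0.
  have [r0|r0] := posnP r; first by exists 0%N.
  have E (w' : r.-1.-tuple bool) : exists i, forall z,
      singular v (word_mod F t w') i z -> z = 0.
    apply: contrapT => nE; have : (r <= r.-1)%N; last by rewrite -ltnS prednK // ltnn.
    apply: rmin; apply/asboolP; exists w'; split; first exact: size_tuple.
    move=> i; apply: contrapT => ni; apply: nE; exists i => z zS.
    by apply: contrapT => z0; apply: ni; exists z.
  have /choice[I IP] := E; exists (\max_w' I w') => w' /eqP sw' _ z zS.
  apply: (IP (Tuple sw') z); apply: singular_mono zS.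
  exact: (leq_bigmax (Tuple sw')).
have wfil i z : (i0 <= i)%N -> singular v (word_mod F t w) i z ->
    word_fil (gdim t i) z.
  move=> i0i zS; apply: contrapT => nz.
  have [w' [e [sw' eL eK ez]]] := word_eval nz; apply: ez.
  have r0 : (0 < r)%N.
    rewrite -sw lt0n; apply/eqP => /size0nil E; move: z nz {zS}; rewrite E.
    by move=> z; apply.
  apply: (i0P w') => //; first by rewrite sw' sw.
  apply: (singular_mono i0i) => x bx a xv; have gx := borel_sub bx.
  by rewrite -eK ?(zS x bx a xv) ?(linZ eL) //; [apply: galg_ginf gx|apply: galg_corner].
have [FL _ _ Ff _] := word_filtration F t w.
have [i1 i01 stat] := chain_stationary (FL (gdim t i0)) (Ff _)
  (singular_lsub (word_mod F t w)) (@singularS _) (fun z => @wfil i0 z (leqnn _)).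
have [z zS z0] := Qw i1.
have zall i : singular v (word_mod F t w) i z.
  have [ii1|i1i] := leqP i i1; first exact: singular_mono zS.
  by rewrite stat // ltnW.
have [f [[fL fK] fI _]] := singular_embedding (wU w) z0 zall.
have [B [Fil [BU FM]]] := MU.
(* The embedding f carries singular vectors of M to singular vectors of the word, so from level i0
   on they lie in this finite-dimensional preimage. *)
pose S := f @^-1` word_fil (gdim t i0).
have SL : lsubspace S.
  split; first by rewrite /S /= (lin0 fL); case: (FL (gdim t i0)).
  by move=> a u u' Su Su'; rewrite /S /= fL; apply: (FL _).2.
have [d [j [jL jI]]] := Ff (gdim t i0).
have Sf : fdim_mod S [set 0].
  exists d, (j \o f); split; first exact: linear_comp.
  by move=> u uS /(jI _ uS) /= fu0; apply: fI; rewrite fu0 (lin0 fL).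
have [|i2 _ st2] := chain_stationary SL Sf (singular_lsub M) (@singularS _) (i0 := i0).
  move=> u uS; apply: wfil (leqnn _) _ => x bx a xv.
  rewrite -fK ?(uS x bx a xv) ?(linZ fL) //; exact: galg_ginf (borel_sub bx).
by exists i2.
Qed.
End Theory.
End Singular.

(** * Ext as cocycles modulo coboundaries *)

Section Cocycles.
Variables (F : fieldType) (K : set (glinf F)).
Hypothesis KS : subalgebra K.
Variables M N : lieModule K.

Lemma linear_lsub : lsubspace [set f : M -> N | linear f].
Proof.
split; first by move=> a u v; rewrite scaler0 addr0.
move=> a f g fL gL c u v.
rewrite -[LHS]/(a *: f (c *: u + v) + g (c *: u + v)) fL gL.
by rewrite !scalerDr !scalerA addrACA [a * c]mulrC -scalerA -!scalerDr.
Qed.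

Definition lin_maps : lmodType F := subl linear_lsub.
Implicit Types w : lin_maps.

Definition app w : M -> N := subl_val w.

Lemma app_linear w : linear (app w).
Proof. exact: subl_mem. Qed.

Lemma app_lin a w w' m : app (a *: w + w') m = a *: app w m + app w' m.
Proof. by []. Qed.

Lemma app_sub w w' m : app (w - w') m = app w m - app w' m.
Proof. by []. Qed.

Lemma lin_mapsP w w' : (forall m, app w m = app w' m) -> w = w'.
Proof. by move=> h; apply: subl_inj; apply/funext. Qed.

Lemma lin_map_of (f : M -> N) : linear f -> exists w, forall m, app w m = f m.
Proof. by move=> fL; exists (subl_of linear_lsub fL). Qed.

Lemma homs_act_linear x w : linear (fun m => lact x (app w m) - app w (lact x m)).
Proof.
move=> a u v; rewrite !(app_linear, lact_linear).
by rewrite opprD addrACA scalerBr.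
Qed.

Definition homs_act x w : lin_maps := subl_of linear_lsub (homs_act_linear x w).

Lemma homs_actE x w m : app (homs_act x w) m = lact x (app w m) - app w (lact x m).
Proof. by []. Qed.

Lemma homs_linear x : linear (homs_act x).
Proof.
move=> a w w'; apply: lin_mapsP => m; rewrite homs_actE !app_lin !homs_actE.
by rewrite lact_linear opprD addrACA scalerBr.
Qed.

Lemma homs_lin a x y w : K x -> K y ->
  homs_act (a *: x + y) w = a *: homs_act x w + homs_act y w.
Proof.
move=> Kx Ky; apply: lin_mapsP => m; rewrite app_lin !homs_actE !lact_lin //.
by rewrite (app_linear w) opprD addrACA scalerBr.
Qed.

Lemma homs_br x y w : K x -> K y -> homs_act (glbr x y) w =
  homs_act x (homs_act y w) - homs_act y (homs_act x w).
Proof.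
move=> Kx Ky; apply: lin_mapsP => m.
rewrite app_sub !homs_actE !lact_br // !lactB (linB (app_linear w)).
rewrite !opprB !addrA [RHS](ACl (1*8*3*6*(5*2)*(7*4))) /=.
by rewrite !subrr !addr0.
Qed.

Definition homs : lieModule K := LieModule homs_linear homs_lin homs_br.

(** The value 0 outside K makes equality of functions the same as equality on K. *)
Definition cocycle (phi : glinf F -> lin_maps) := [/\ forall x, ~ K x -> phi x = 0,
  forall a x y, K x -> K y -> phi (a *: x + y) = a *: phi x + phi y &
  forall x y, K x -> K y ->
    phi (glbr x y) = homs_act x (phi y) - homs_act y (phi x)].

Definition coboundary (phi : glinf F -> lin_maps) :=
  exists w, forall x, phi x = if `[< K x >] then homs_act x w else 0.

Lemma cocycle_lsub : lsubspace cocycle.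
Proof.
split.
  by split=> // [a x y _ _|x y _ _]; rewrite ?scaler0 ?addr0 // !(lin0 (homs_linear _)) subrr.
move=> a p q [p0 pL pB] [q0 qL qB].
have E x : (a *: p + q) x = a *: p x + q x by [].
split=> [x nKx|c x y Kx Ky|x y Kx Ky]; rewrite !E.
- by rewrite p0 // q0 // scaler0 addr0.
- by rewrite pL // qL // scalerDr !scalerA [a * c]mulrC -scalerA addrACA -scalerDr.
- by rewrite pB // qB // !homs_linear scalerBr opprD addrACA.
Qed.

Lemma coboundary_lsub : lsubspace coboundary.
Proof.
split; first by exists 0 => x; case: ifP => // _; rewrite (lin0 (homs_linear _)).
move=> a p q [w pE] [w' qE]; exists (a *: w + w') => x.
rewrite -[LHS]/(a *: p x + q x) pE qE; case: ifP => _; last by rewrite scaler0 addr0.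
by rewrite homs_linear.
Qed.

Lemma coboundary_cocycle : coboundary `<=` cocycle.
Proof.
move=> p [w pE]; split=> [x nKx|a x y Kx Ky|x y Kx Ky]; rewrite !pE.
- by case: asboolP.
- rewrite !asboolT //; first exact: homs_lin.
  exact: KS.1.2.
- rewrite !asboolT //; first exact: homs_br.
  exact: KS.2.
Qed.

Lemma pair_lin (U V : lmodType F) a (p q : U * V) :
  a *: p + q = (a *: p.1 + q.1, a *: p.2 + q.2).
Proof. by []. Qed.

Lemma pair_sub (U V : lmodType F) (p q : U * V) : p - q = (p.1 - q.1, p.2 - q.2).
Proof. by []. Qed.

Section Extension.
Variable phi : glinf F -> lin_maps.
Hypothesis phiZ : cocycle phi.

Let mid_act x (p : N * M) : N * M := (lact x p.1 + app (phi x) p.2, lact x p.2).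

Lemma cocycle_ext_linear x : linear (mid_act x).
Proof.
move=> a p q; rewrite [RHS]pair_lin /mid_act /= !lact_linear (app_linear (phi x)).
by congr pair; rewrite scalerDr addrACA.
Qed.

Lemma cocycle_ext_lin a x y p : K x -> K y ->
  mid_act (a *: x + y) p = a *: mid_act x p + mid_act y p.
Proof.
move=> Kx Ky; have [_ pL _] := phiZ.
rewrite [RHS]pair_lin /mid_act /= pL // !lact_lin // app_lin.
by congr pair; rewrite scalerDr addrACA.
Qed.

Lemma cocycle_ext_br x y p : K x -> K y ->
  mid_act (glbr x y) p = mid_act x (mid_act y p) - mid_act y (mid_act x p).
Proof.
move=> Kx Ky; have [_ _ pB] := phiZ.
rewrite [RHS]pair_sub /mid_act /= pB // !lact_br //; congr pair.
rewrite app_sub !homs_actE !lactD.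
by rewrite !opprB !opprD !addrA [RHS](ACl (1*4*2*6*3*5)).
Qed.

Definition cocycle_mid : lieModule K :=
  LieModule cocycle_ext_linear cocycle_ext_lin cocycle_ext_br.

Lemma cocycle_in_hom : is_hom K (fun n : N => (n, 0) : cocycle_mid).
Proof.
split; first by move=> a u v; rewrite [RHS]pair_lin /= scaler0 addr0.
by move=> x Kx v; rewrite /= /mid_act /= (lin0 (app_linear _)) addr0 lact0.
Qed.

Lemma cocycle_out_hom : is_hom K (fun p : cocycle_mid => p.2).
Proof. by split. Qed.

Lemma cocycle_in_inj : injective (fun n : N => (n, 0) : cocycle_mid).
Proof. by move=> n n' []. Qed.

Lemma cocycle_out_surj m : exists e : cocycle_mid, e.2 = m.
Proof. by exists (0, m). Qed.

Lemma cocycle_exact (e : cocycle_mid) : e.2 = 0 <-> exists n : N, e = (n, 0).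
Proof. by case: e => n m /=; split=> [->|[n' []]//]; exists n. Qed.

Definition cocycle_ext : extension M N := Extension cocycle_in_hom cocycle_out_hom
  cocycle_in_inj cocycle_out_surj cocycle_exact.
End Extension.

(** The cocycle phi measures how far the linear section s is from being K-equivariant. *)
Definition section_cocycle (E : extension M N) (s : M -> E) phi := [/\ linear s,
  forall m, ext_out (s m) = m, cocycle phi &
  forall x m, K x -> ext_in E (app (phi x) m) = lact x (s m) - s (lact x m)].

Lemma ext_in_linear (E : extension M N) : linear (ext_in E).
Proof. by case: (ext_in_hom E). Qed.

Lemma ext_out_linear (E : extension M N) : linear (@ext_out _ _ _ _ E).
Proof. by case: (ext_out_hom E). Qed.

Lemma ext_in_act (E : extension M N) x n : K x ->
  ext_in E (lact x n) = lact x (ext_in E n).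
Proof. by move=> Kx; case: (ext_in_hom E) => _; apply. Qed.

Lemma ext_out_act (E : extension M N) x (e : E) : K x ->
  ext_out (e0 := E) (lact x e) = lact x (ext_out e).
Proof. by move=> Kx; case: (ext_out_hom E) => _; apply. Qed.

Lemma ext_out_in (E : extension M N) n : ext_out (ext_in E n) = 0.
Proof. by apply/ext_exact; exists n. Qed.

Lemma section_cocycle_of (E : extension M N) (s : M -> E) : linear s ->
  (forall m, ext_out (s m) = m) -> exists phi, section_cocycle s phi.
Proof.
move=> sL sO; have inL := ext_in_linear E; have outL := @ext_out_linear E.
have inI := @ext_in_inj _ _ _ _ E.
have ex x : exists w, if `[< K x >] then
    forall m, ext_in E (app w m) = lact x (s m) - s (lact x m) else w = 0.
  case: asboolP => [Kx|_]; last by exists 0.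
  have /choice[f fE] m : exists n, lact x (s m) - s (lact x m) = ext_in E n.
    apply/ext_exact; rewrite (linB outL) ext_out_act // !sO subrr //.
  have fL : linear f.
    move=> a u v; apply: inI; rewrite -fE inL -!fE !(sL, lact_linear).
    by rewrite scalerBr opprD addrACA.
  by have [w wE] := lin_map_of fL; exists w => m; rewrite wE -fE.
have [phi phiE] := choice ex; exists phi.
have pE x m : K x -> ext_in E (app (phi x) m) = lact x (s m) - s (lact x m).
  by move=> Kx; have := phiE x; rewrite asboolT // => ->.
split=> //; split.
- by move=> x nKx; have := phiE x; rewrite asboolF.
- move=> a x y Kx Ky; apply: lin_mapsP => m; apply: inI.
  rewrite app_lin inL !pE //; last exact: KS.1.2.
  by rewrite !lact_lin // sL scalerBr opprD addrACA.
move=> x y Kx Ky; apply: lin_mapsP => m; apply: inI.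
rewrite app_sub !homs_actE !(linB inL) !ext_in_act // !pE //; last exact: KS.2.
rewrite !lact_br // !lactB (linB sL) !opprB !addrA.
by rewrite [RHS](ACl (1*8*3*6*(5*2)*(7*4))) /= !subrr !addr0.
Qed.

Lemma section_cocycle_ex (E : extension M N) : exists s phi,
  @section_cocycle E s phi.
Proof.
have [s [sL sO]] := linear_section (@ext_out_linear E) (@ext_out_surj _ _ _ _ E).
by exists s; apply: section_cocycle_of.
Qed.

(** The difference of s' and f s takes values in N, and its coboundary is the difference of the
    cocycles. With f the identity this also shows that the class does not depend on the section. *)
Lemma section_cocycle_hom (E E' : extension M N) (f : E -> E') a
    (s : M -> E) phi (s' : M -> E') phi' :
  section_cocycle s phi -> section_cocycle s' phi' -> is_hom K f ->
  (forall n, f (ext_in E n) = ext_in E' (a *: n)) ->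
  (forall e, ext_out (f e) = ext_out e) -> coboundary (phi' - a *: phi).
Proof.
move=> [sL sO pZ pE] [s'L s'O p'Z p'E] [fL fK] fin fout.
have inL := ext_in_linear E'; have inI := @ext_in_inj _ _ _ _ E'.
have /choice[u uE] m : exists n, s' m - f (s m) = ext_in E' n.
  by apply/ext_exact; rewrite (linB (@ext_out_linear E')) s'O fout sO subrr.
have uL : linear u.
  move=> c m m'; apply: inI; rewrite -uE inL -!uE sL s'L fL.
  by rewrite scalerBr opprD addrACA.
have [w wE] := lin_map_of uL; exists w => x.
rewrite -[LHS]/(phi' x - a *: phi x).
case: asboolP => [Kx|nKx]; last first.
  have [p0 _ _] := pZ; have [p'0 _ _] := p'Z.
  by rewrite p0 // p'0 // scaler0 subrr.
apply: lin_mapsP => m; apply: inI.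
rewrite app_sub homs_actE !wE !(linB inL) ext_in_act // -!uE p'E //.
rewrite -[app (a *: phi x) m]/(a *: app (phi x) m) -fin pE // (linB fL) lactB fK //.
by rewrite !opprB !addrA [RHS](ACl (1*4*3*2)).
Qed.

Lemma section_cocycle_baer (E1 E2 E : extension M N) (s1 : M -> E1) phi1
    (s2 : M -> E2) phi2 (s : M -> E) phi :
  section_cocycle s1 phi1 -> section_cocycle s2 phi2 -> section_cocycle s phi ->
  is_baer_sum E1 E2 E -> coboundary (phi - (phi1 + phi2)).
Proof.
move=> [s1L s1O p1Z p1E] [s2L s2O p2Z p2E] [sL sO pZ pE] [f [fL fK fin fout]].
have inL := ext_in_linear E; have inI := @ext_in_inj _ _ _ _ E.
have s12 m : ext_out (s1 m) = ext_out (s2 m) by rewrite s1O s2O.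
have /choice[u uE] m : exists n, s m - f (s1 m) (s2 m) = ext_in E n.
  by apply/ext_exact; rewrite (linB (@ext_out_linear E)) sO fout // s1O subrr.
have uL : linear u.
  move=> c m m'; apply: inI; rewrite -uE inL -!uE sL s1L s2L fL //.
  by rewrite scalerBr opprD addrACA.
have [w wE] := lin_map_of uL; exists w => x.
rewrite -[LHS]/(phi x - (phi1 x + phi2 x)).
case: asboolP => [Kx|nKx]; last first.
  have [-> //] := pZ; have [-> //] := p1Z; have [-> //] := p2Z.
  by rewrite addr0 subrr.
apply: lin_mapsP => m; apply: inI.
rewrite app_sub homs_actE !wE !(linB inL) ext_in_act // -!uE pE //.
rewrite -[app (phi1 x + phi2 x) m]/(app (phi1 x) m + app (phi2 x) m) -fin p1E // p2E //.
have o12 : ext_out (lact x (s1 m)) = ext_out (lact x (s2 m)).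
  by rewrite !ext_out_act // s12.
have := fL (-1) _ _ _ _ (s12 (lact x m)) o12; rewrite !scaleN1r ![- _ + _]addrC => ->.
by rewrite fK // lactB !opprB !addrA [RHS](ACl (1*4*3*2)).
Qed.

Lemma coboundary_equiv (E E' : extension M N) (s : M -> E) phi (s' : M -> E') phi' :
  section_cocycle s phi -> section_cocycle s' phi' -> coboundary (phi' - phi) ->
  ext_equiv E E'.
Proof.
move=> [sL sO pZ pE] [s'L s'O p'Z p'E] [w wE].
have inL := ext_in_linear E; have inI := @ext_in_inj _ _ _ _ E.
have inL' := ext_in_linear E'; have outL := @ext_out_linear E.
have /choice[n nE] e : exists n, e - s (ext_out e) = ext_in E n.
  by apply/ext_exact; rewrite (linB outL) sO subrr.
have nL : linear n.
  by move=> a e e'; apply: inI; rewrite -nE inL -!nE outL sL scalerBr opprD addrACA.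
(* In coordinates N x M given by the two sections, this is the identity corrected by w, the cochain
   that bounds the difference of the cocycles. *)
pose f e := s' (ext_out e) - ext_in E' (app w (ext_out e)) + ext_in E' (n e).
have fL : linear f.
  move=> a e e'; rewrite /f outL nL s'L (app_linear w) !inL'.
  by rewrite opprD [a *: _ + _ + _]addrACA -scalerBr addrACA -scalerDr.
exists f; split.
- split=> // x Kx e; rewrite /f !lactD lactN -!ext_in_act // ext_out_act //.
  have -> : n (lact x e) = lact x (n e) + app (phi x) (ext_out e).
    apply: inI; rewrite -nE ext_out_act // (linD inL) ext_in_act // -nE pE //.
    by rewrite lactB addrA subrK.
  set m := ext_out e.
  have kE : app (phi' x) m = app (phi x) m + (lact x (app w m) - app w (lact x m)).
    rewrite -homs_actE; have := wE x; rewrite asboolT // => <-.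
    by rewrite -[app ((phi' - phi) x) m]/(app (phi' x) m - app (phi x) m) addrC subrK.
  have -> : s' (lact x m) = lact x (s' m) - ext_in E' (app (phi' x) m).
    by rewrite p'E // opprB addrC subrK.
  rewrite kE !(linD inL') !(linN inL') !opprD opprK !addrA.
  by rewrite [LHS](ACl (1*3*6*(4*5)*(2*7))) /= subrr addNr !addr0.
- move=> k; rewrite /f ext_out_in (lin0 (app_linear w)) (lin0 s'L) (lin0 inL').
  rewrite subr0 add0r; congr ext_in; apply: inI.
  by rewrite -nE ext_out_in (lin0 sL) subr0.
- move=> e; rewrite /f (linD (@ext_out_linear E')) (linB (@ext_out_linear E')).
  by rewrite !ext_out_in s'O subr0 addr0.
Qed.

(** Cocycles modulo coboundaries are realized by the cocycles in a fixed complement of the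
    coboundaries. Each class thus has a distinguished representative [iota], through which the
    cardinality of X will be bounded. *)
Lemma ext1_model : exists X : ext1_space M N, exists psi : (glinf F -> lin_maps) -> X,
  (forall a p q, cocycle p -> cocycle q -> psi (a *: p + q) = a *: psi p + psi q) /\
  [/\ forall p, cocycle p -> psi p = 0 -> coboundary p,
    forall c, exists2 p, cocycle p & psi p = c,
    (forall E : extension M N, (exists s : M -> E, [/\ linear s,
       forall m, ext_out (s m) = m &
       forall x m, K x -> s (lact x m) = lact x (s m)]) -> ext1_class X E = 0) &
    exists iota : X -> glinf F -> lin_maps, injective iota /\
      forall c, cocycle (iota c)].
Proof.
have [C0 [C0L BC0 BC0T]] := complement coboundary_lsub.
have CL : lsubspace (cocycle `&` C0) := lsubI cocycle_lsub C0L.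
pose X : lmodType F := subl CL.
have XZ (c : X) : cocycle (subl_val c) by case: (subl_mem c).
have XI (c c' : X) : coboundary (subl_val c - subl_val c') -> c = c'.
  move=> cB; apply: subl_inj; apply/eqP; rewrite -subr_eq0; apply/eqP.
  by apply: BC0 => //; case: (subl_mem c) (subl_mem c') => _ ? [_ ?]; apply: lsubB.
have ex p : exists c : X, cocycle p -> coboundary (p - subl_val c).
  have [pZ|npZ] := pselect (cocycle p); last by exists 0.
  have [q [c [qB Cc pE]]] := BC0T p.
  have cZ : (cocycle `&` C0) c.
    split=> //; rewrite -[c](addKr q) -pE addrC; apply: lsubB => //.
      exact: cocycle_lsub.
    exact: coboundary_cocycle.
  by exists (subl_of CL cZ) => _; rewrite /= pE addrK.
have [psi psiE] := choice ex.
have XB (c c' : X) p q : coboundary (p - subl_val c) -> coboundary (q - subl_val c') ->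
    coboundary (p - q) -> c = c'.
  move=> cB c'B pqB; apply: XI.
  rewrite [_ - _](_ : _ = (p - q) - (p - subl_val c) + (q - subl_val c')).
    by apply: lsubD; [exact: coboundary_lsub|apply: lsubB => //|];
      try exact: coboundary_lsub.
  by rewrite opprB !addrA [RHS](ACl (1*4*(2*5)*(3*6))) /= subrr addNr !add0r.
have psiL a p q : cocycle p -> cocycle q -> psi (a *: p + q) = a *: psi p + psi q.
  move=> pZ qZ; have [CL1 CL2] := cocycle_lsub; have [B0 BL2] := coboundary_lsub.
  have e : a *: p + q - subl_val (a *: psi p + psi q) =
      a *: (p - subl_val (psi p)) + (q - subl_val (psi q)).
    by rewrite subl_lin scalerBr addrACA -opprD.
  apply: (@XB _ _ (a *: p + q) (a *: p + q) (psiE _ (CL2 a p q pZ qZ))).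
    by rewrite e; exact: (BL2 a _ _ (psiE p pZ) (psiE q qZ)).
  by rewrite subrr.
have psi0 p : cocycle p -> psi p = 0 -> coboundary p.
  by move=> pZ p0; have := psiE p pZ; rewrite p0 subr0.
have psiI (p q : glinf F -> lin_maps) : cocycle p -> cocycle q ->
    coboundary (p - q) -> psi p = psi q.
  by move=> pZ qZ; apply: XB (psiE p pZ) (psiE q qZ).
have psi_onto c : psi (subl_val c) = c.
  apply: (@XB _ _ (subl_val c) (subl_val c) (psiE _ (XZ c))); rewrite subrr;
    by case: coboundary_lsub.
have /choice[cl clE] (E : extension M N) : exists c, forall s phi,
    @section_cocycle E s phi -> psi phi = c.
  have [s [phi sZ]] := section_cocycle_ex E; exists (psi phi) => s' phi' sZ'.
  have := section_cocycle_hom sZ sZ' (f := id) (a := 1); rewrite scale1r => B.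
  case: sZ sZ' => _ _ pZ _ [_ _ p'Z _]; apply: psiI => //.
  by apply: B => // n; rewrite scale1r.
have cl_onto c : exists E, cl E = c.
  have pZ := XZ c; exists (cocycle_ext pZ); apply: etrans (psi_onto c); apply/esym.
  apply: (clE _ (fun m => (0, m) : cocycle_ext pZ)); split=> //.
    by move=> a u v; rewrite [RHS]pair_lin /= scaler0 addr0.
  move=> x m Kx; rewrite [RHS]pair_sub /= lact0 add0r.
  by congr pair; rewrite ?subr0 ?subrr.
have cl_eq E E' : cl E = cl E' <-> ext_equiv E E'.
  have [s [phi sZ]] := section_cocycle_ex E.
  have [s' [phi' sZ']] := section_cocycle_ex E'.
  rewrite -(clE _ _ _ sZ) -(clE _ _ _ sZ').
  have [[_ _ pZ _] [_ _ p'Z _]] := (sZ, sZ').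
  split=> [pp'|[f [fK fin fout]]].
    apply: coboundary_equiv sZ sZ' _; apply: psi0.
      rewrite -scaleN1r addrC; case: cocycle_lsub => _; exact.
    by rewrite -scaleN1r addrC psiL // pp' scaleN1r addNr.
  apply/esym/psiI => //.
  have := section_cocycle_hom sZ sZ' fK (a := 1); rewrite scale1r; apply=> // n.
  by rewrite scale1r.
have cl_add E1 E2 E : is_baer_sum E1 E2 E -> cl E = cl E1 + cl E2.
  have [s [phi sZ]] := section_cocycle_ex E.
  have [s1 [phi1 sZ1]] := section_cocycle_ex E1.
  have [s2 [phi2 sZ2]] := section_cocycle_ex E2.
  move=> /(section_cocycle_baer sZ1 sZ2 sZ).
  rewrite -(clE _ _ _ sZ) -(clE _ _ _ sZ1) -(clE _ _ _ sZ2).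
  have [[_ _ pZ _] [_ _ p1Z _] [_ _ p2Z _]] := And3 sZ sZ1 sZ2.
  have := psiL 1 _ _ p1Z p2Z; rewrite !scale1r => <- B; apply: psiI => //.
  by rewrite -[phi1]scale1r; case: cocycle_lsub => _; apply.
have cl_scale a E E' : is_ext_scale a E E' -> cl E' = a *: cl E.
  have [s [phi sZ]] := section_cocycle_ex E.
  have [s' [phi' sZ']] := section_cocycle_ex E'.
  move=> [f [fK fin fout]]; rewrite -(clE _ _ _ sZ) -(clE _ _ _ sZ').
  have B := section_cocycle_hom sZ sZ' fK fin fout.
  have [[_ _ pZ _] [_ _ p'Z _]] := (sZ, sZ').
  have [Z0 Z2] := cocycle_lsub; have Z00 : psi 0 = 0.
    have := psiL 1 0 0 Z0 Z0; rewrite !scale1r addr0 => e.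
    by apply: (addrI (psi 0)); rewrite addr0.
  have -> : a *: psi phi = psi (a *: phi).
    by rewrite -[a *: phi]addr0 psiL // Z00 addr0.
  by apply: psiI => //; rewrite -[a *: phi]addr0; apply: Z2.
exists (Ext1Space cl_onto cl_eq cl_add cl_scale), psi; split=> //; split=> //.
- by move=> c; exists (subl_val c).
- move=> E [s [sL sO sK]] /=; have [phi sZ] := section_cocycle_of sL sO.
  rewrite -(clE _ _ _ sZ) -(psi_onto 0); case: (sZ) => _ _ pZ pE.
  have [p0 _ _] := pZ.
  suff -> : phi = subl_val (0 : X) by [].
  apply/funext => x; have [Kx|nKx] := pselect (K x); last exact: p0.
  apply: lin_mapsP => m; apply: (@ext_in_inj _ _ _ _ E).
  by rewrite pE // sK // subrr (lin0 (ext_in_linear E)).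
exists (fun c : X => subl_val c); split=> // c c'; exact: subl_inj.
Qed.
End Cocycles.

(** * The trace form *)

Section TraceForm.
Variables (F : numClosedFieldType) (t : classical_type).
Local Notation gl := (glinf F).
Implicit Types x y z : gl.

Definition trform x y : F := gltr (glmul x (gstar y)).

Lemma gltr_mulE n x y : in_corner n x -> in_corner n y ->
  gltr (glmul x y) = \tr (corner n x *m corner n y).
Proof. by move=> xn yn; rewrite (gltrE (glmul_corner xn yn)) corner_mul. Qed.

Lemma trformE n x y : in_corner n x -> in_corner n y ->
  trform x y = \sum_(a < n) \sum_(c < n) (x a c : F) * (y a c : F)^*.
Proof.
move=> xn yn; rewrite /trform (gltr_mulE xn (gstar_corner yn)) /mxtrace.
apply: eq_bigr => a _; rewrite mxE; apply: eq_bigr => c _.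
by rewrite !mxE gstarE.
Qed.

Lemma trform_pos : posform trform.
Proof.
split; first split.
- move=> a x y z; have [n [xn yn zn]] := in_corner_common x y z.
  rewrite !(@trformE n) //; last exact: in_corner_lin.
  rewrite mulr_sumr -big_split; apply: eq_bigr => i _.
  rewrite mulr_sumr -big_split; apply: eq_bigr => j _.
  by rewrite gl_lin mulrDl mulrA.
- move=> x y; have [n [xn yn _]] := in_corner_common x y 0.
  rewrite !(@trformE n) // rmorph_sum; apply: eq_bigr => i _.
  by rewrite rmorph_sum; apply: eq_bigr => j _; rewrite rmorphM /= conjCK mulrC.
- move=> x; have [n xn] := glinf_bound x; rewrite (@trformE n) //.
  by apply: sumr_ge0 => i _; apply: sumr_ge0 => j _; apply: mul_conjC_ge0.
move=> x; have [n xn] := glinf_bound x; rewrite (@trformE n) // => /eqP.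
rewrite psumr_eq0 => [/allP h|i _]; last first.
  by apply: sumr_ge0 => j _; apply: mul_conjC_ge0.
apply: (in_cornerP xn (@in_corner0 _ n)); apply/matrixP => i j; rewrite !mxE gl0.
have := h i (mem_index_enum i); rewrite /= psumr_eq0 => [/allP hi|k _].
  by have := hi j (mem_index_enum j); rewrite /= mul_conjC_eq0 => /eqP.
exact: mul_conjC_ge0.
Qed.

Lemma gltr_mulC x y : gltr (glmul x y) = gltr (glmul y x).
Proof.
have [n [xn yn _]] := in_corner_common x y 0.
by rewrite !(@gltr_mulE n) // mxtrace_mulC.
Qed.

Lemma gltr_br x y z : gltr (glmul (glbr x y) z) = - gltr (glmul (glbr x z) y).
Proof.
have [n [xn yn zn]] := in_corner_common x y z.
rewrite !(@gltr_mulE n) //; do ?exact: glbr_corner.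
rewrite !corner_br // !mulmxBl !(raddfB (@mxtrace F n)) /= opprB.
congr (_ - _); first by rewrite mxtrace_mulC mulmxA.
by rewrite -mulmxA mxtrace_mulC.
Qed.

Lemma gstar_lin a x y : gstar (a *: x + y) = a^* *: gstar x + gstar y.
Proof.
by apply: glinfP => i j; rewrite gstarE !gl_lin !gstarE rmorphD rmorphM.
Qed.

Lemma gstar_sum n (c : nat -> F) (e : nat -> gl) :
  gstar (\sum_(s < n) c s *: e s) = \sum_(s < n) (c s)^* *: gstar (e s).
Proof.
elim: n => [|n IH]; last by rewrite !big_ord_recr /= addrC gstar_lin IH addrC.
by rewrite !big_ord0; apply: glinfP => i j; rewrite gstarE !gl0 rmorph0.
Qed.

(* The bases e and e^* of g_i are dual to each other with respect to the trace
   form, whence the invariance of the sum of the e_s^* (x) e_s. *)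
Lemma casimir_basis i : exists n (e : nat -> gl),
  [/\ forall s, (s < n)%N -> galg t i (e s),
    forall y, galg t i y -> exists c : nat -> F, y = \sum_(s < n) c s *: e s &
    forall y, galg t i y -> exists k : nat -> nat -> F,
      (forall s, (s < n)%N -> glbr y (e s) = \sum_(r < n) k s r *: e r) /\
      (forall s, (s < n)%N ->
        glbr y (gstar (e s)) = - \sum_(r < n) k r s *: gstar (e r))].
Proof.
have gL := galg_lsub F t i.
have [n [e [eg _ eE]]] := orthonormal_basis trform_pos gL
  (corner_fdim (@galg_corner F t i)).
have ge s : (s < n)%N -> galg t i (gstar (e s)) by move=> /eg; apply: galg_star.
exists n, e; split=> // [y yi|y yi]; first by exists (fun s => trform y (e s)); apply: eE.
exists (fun s r => trform (glbr y (e s)) (e r)); split=> s sn.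
  by apply: eE; apply: galg_br => //; apply: eg.
have zi : galg t i (gstar (glbr y (gstar (e s)))).
  by apply/galg_star/galg_br => //; apply: ge.
rewrite -[LHS]gstarK {1}(eE _ zi).
rewrite (gstar_sum n (fun r => trform (gstar (glbr y (gstar (e s)))) (e r)) e) -sumrN; apply: eq_bigr => r _.
rewrite -scaleNr; congr (_ *: _).
rewrite -(formC (@trform_pos).1) /trform gstarK gltr_mulC.
by rewrite gltr_br.
Qed.

Lemma gl_fun n (f : nat -> nat -> F) : exists x : gl, in_corner n x /\
  forall a c, (a < n)%N -> (c < n)%N -> (x a c : F) = f a c.
Proof.
exists (gl_of (\matrix_(a < n, c < n) f a c)); split; first exact: gl_of_corner.
move=> a c an cn; have := gl_ofE (\matrix_(a < n, c < n) f a c) (Ordinal an) (Ordinal cn).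
by rewrite mxE.
Qed.

Lemma par_inj a c : (par t a == par t c) = (a == c).
Proof. exact: inj_eq (can_inj (parK t)) a c. Qed.

Lemma fresh_index n (s : seq nat) : (size s < n)%N ->
  exists2 k, (k < n)%N & k \notin s.
Proof.
move=> sn; have [//|h] := pselect (exists2 k, (k < n)%N & k \notin s).
have : (size (iota 0 n) <= size s)%N.
  apply: uniq_leq_size; first exact: iota_uniq.
  move=> k; rewrite mem_iota => /andP[_ kn].
  by apply: contrapT => /negP ks; apply: h; exists k.
by rewrite size_iota leqNgt sn.
Qed.

(* E_ac - (the image of E_ac under the involution fixing g_i) *)
Lemma root_vector i a c : (a < gdim t i)%N -> (c < gdim t i)%N -> a != c ->
  exists2 x : gl, galg t i x & forall r d, (r < gdim t i)%N -> (d < gdim t i)%N ->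
    (x r d : F) = ((r == a) && (d == c))%:R - (if t is SLinf then 0 else
      sgn t r * sgn t d * ((par t d == a) && (par t r == c))%:R).
Proof.
move=> an cn ac; set n := gdim t i.
pose f r d : F := ((r == a) && (d == c))%:R - (if t is SLinf then 0 else
      sgn t r * sgn t d * ((par t d == a) && (par t r == c))%:R).
have [x [xn xf]] := gl_fun n f; exists x => //; apply/galgP; split=> //.
have skew : (forall r d, f r d = - (sgn t r * sgn t d) * f (par t d) (par t r)) ->
    forall r d, (x r d : F) = - (sgn t r * sgn t d) * x (par t d) (par t r).
  move=> fs r d; have [rn|nr] := ltnP r n; last first.
    by rewrite xn ?nr // xn ?mulr0 // !(leqNgt n) !par_gdim -!leqNgt nr orbT.
  have [dn|nd] := ltnP d n; last first.
    by rewrite xn ?nd ?orbT // xn ?mulr0 // !(leqNgt n) !par_gdim -!leqNgt nd.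
  by rewrite !xf // ?par_gdim.
have sp r : sgn t (par t r) = (if t is SPinf then -1 else 1) * sgn t r :> F.
  rewrite /sgn /par; case: (t) => //; rewrite ?mulr1 //.
  have [orr|orr] := boolP (odd r); last by rewrite /= orr expr0 expr1 mulr1.
  by case: r orr => //= r /negbTE ->; rewrite expr0 expr1 mulrNN mulr1.
have fskew : t <> SLinf ->
    forall r d, f r d = - (sgn t r * sgn t d) * f (par t d) (par t r).
  move=> tS r d; have fE r' d' : f r' d' = ((r' == a) && (d' == c))%:R -
      sgn t r' * sgn t d' * ((par t d' == a) && (par t r' == c))%:R.
    by rewrite /f; case: (t) tS.
  have s2 : (sgn t r * sgn t d) * (sgn t (par t d) * sgn t (par t r)) = 1 :> F.
    rewrite !sp; set e := (if t is SPinf then -1 else 1) : F.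
    have e2 : e * e = 1 by rewrite /e; case: (t); rewrite ?mulrNN mulr1.
    transitivity (e * e * (sgn t r * sgn t r) * (sgn t d * sgn t d)); first ring.
    by rewrite e2 !sgn2 !mulr1.
  by rewrite !fE !parK -[X in X - _]mul1r -s2; ring.
have [tS|tS] := pselect (t = SLinf); last first.
  by have := skew (fskew tS); rewrite /gskew; case: (t) tS.
have -> : gskew t x = (gltr x = 0) by rewrite /gskew tS.
rewrite (gltrE xn); apply: big1 => k _; rewrite mxE xf // /f tS subr0.
by case: eqP => // ->; rewrite (negbTE ac).
Qed.

(** Commuting with the root vector at (a, c) gives z_ra = delta_ra z_cc as soon as c avoids a, r and
    their partners under [par]; with five indices such a c always exists. Hence z is scalar, and
    trace zero or skewness makes it vanish. *)
Lemma galg_center i z : (5 <= i)%N -> galg t i z ->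
  (forall x, galg t i x -> glbr x z = 0) -> z = 0.
Proof.
move=> i5 /galgP[]; set n := gdim t i => zn zs zc.
have n5 : (5 <= n)%N := leq_trans i5 (leq_gdim t i).
have mE u v a c : in_corner n u -> (a < n)%N ->
    (glmul u v a c : F) = \sum_(k < n) (u a k : F) * v k c.
  move=> un an; rewrite glmulE (@fsbig_bound _ F^o _ n) // => k nk.
  by rewrite un ?nk ?orbT ?mul0r.
have key a c r : (a < n)%N -> (c < n)%N -> (r < n)%N -> c \notin [:: a; par t a; r; par t r] ->
    (z r a : F) = (r == a)%:R * z c c.
  move=> an cn rn; rewrite !inE !negb_or => /and4P[ca cpa cr cpr].
  rewrite eq_sym in ca; have [x xi xE] := root_vector an cn ca.
  have xn := galg_corner xi; have := zc x xi; rewrite -/n in xn xE.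
  have pa : (par t c == a) = false.
    by rewrite -(parK t a) par_inj (negbTE cpa).
  have pr : (par t r == c) = false by rewrite eq_sym (negbTE cpr).
  have cc : (par t c == r) = false.
    by rewrite -(parK t r) par_inj (negbTE cpr).
  move=> /(congr1 (fun y : gl => y r c : F)); rewrite gl0 glB !mE //.
  rewrite (eq_bigr (fun k : 'I_n => ((r == a) && ((k : nat) == c))%:R * (z k c : F))); last first.
    by move=> k _; rewrite xE // pr andbF mulr0; case: (t); rewrite subr0.
  rewrite [X in _ - X](eq_bigr (fun k : 'I_n => (z r k : F) * ((k : nat) == a)%:R)) => [|k _]; last first.
    by rewrite xE // eqxx andbT pa andFb mulr0; case: (t); rewrite subr0.
  rewrite (bigD1 (Ordinal cn)) //= big1 => [|k /negbTE kc]; last first.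
    by rewrite -val_eqE /= in kc; rewrite kc andbF mul0r.
  rewrite (bigD1 (Ordinal an)) //= [X in _ - (_ + X)]big1 => [|k /negbTE ka]; last first.
    by rewrite -val_eqE /= in ka; rewrite ka mulr0.
  by rewrite !eqxx andbT mulr1 !addr0 => /eqP; rewrite subr_eq0 => /eqP <-.
have fresh s : (size s < 5)%N -> exists2 k, (k < n)%N & k \notin s.
  by move=> s5; apply: fresh_index; apply: leq_trans n5.
have off a r : (a < n)%N -> (r < n)%N -> r != a -> (z r a : F) = 0.
  move=> an rn ra; have [//|c cn cs] := fresh [:: a; par t a; r; par t r].
  by rewrite (key a c r) // (negbTE ra) mul0r.
have diag a c : (a < n)%N -> (c < n)%N -> c \notin [:: a; par t a] -> (z a a : F) = z c c.
  move=> an cn ca; rewrite (key a c a) ?eqxx ?mul1r //.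
  by move: ca; rewrite !inE !negb_or; case: (c == a); case: (c == par t a).
have dpar a : (a < n)%N -> (z a a : F) = z (par t a) (par t a).
  move=> an; have [//|c cn cs] := fresh [:: a; par t a].
  rewrite (diag a c) // (diag (par t a) c) ?par_gdim //.
  by move: cs; rewrite parK !inE orbC.
have z00 a : (a < n)%N -> (z a a : F) = 0.
  have [tS|tS] := pselect (t = SLinf); last first.
    move=> an; have : (z a a : F) = - z a a.
      rewrite {1}dpar //; have : forall a c, (z a c : F) = - (sgn t a * sgn t c) * z (par t c) (par t a).
        by move: zs tS; rewrite /gskew; case: (t).
      by move=> ->; rewrite sgn2 parK mulN1r.
    by move=> /eqP; rewrite -subr_eq0 opprK -mulr2n mulrn_eq0 /= => /eqP.
  have n0 : (0 < n)%N by apply: leq_trans n5.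
  have zE a' : (a' < n)%N -> (z a' a' : F) = z 0%N 0%N.
    move=> an; have [->//|ane] := eqVneq a' 0%N; apply/esym/diag => //.
    by rewrite /par tS !inE orbb.
  have : gskew t z = (gltr z = 0) by rewrite /gskew tS.
  move=> e an; move: zs; rewrite e (gltrE zn) /mxtrace.
  rewrite (eq_bigr (fun=> z 0%N 0%N : F)) => [|k _]; last by rewrite mxE zE.
  rewrite sumr_const card_ord => /eqP; rewrite mulrn_eq0 => /orP[/eqP n0'|/eqP].
    by rewrite n0' in n0.
  by rewrite zE.
apply: (in_cornerP zn (@in_corner0 _ n)); apply/matrixP => a c; rewrite !mxE gl0.
by have [->|ac] := eqVneq a c; [apply: z00|apply: off].
Qed.

(** If x - q is orthogonal to [g, g], invariance of the trace form makes the bracket of any y with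
    the adjoint of x - q orthogonal to itself, hence zero. So that adjoint is central. *)
Lemma galg_perfect i x : (5 <= i)%N -> galg t i x -> brspan (galg t i) (galg t i) x.
Proof.
move=> i5 xi; set g := galg t i; have gA : subalgebra g := galg_subalgebra F t i.
have DL : lsubspace (brspan g g) := brspan_sub g g.
have Dg : brspan g g `<=` g := derived_sub gA.
have [q [Dq qE]] := orthogonal_projection trform_pos DL
  (fdim_modS Dg (corner_fdim (@galg_corner F t i))) x.
have zg : g (x - q) := lsubB gA.1 xi (Dg _ Dq).
suff /eqP : x - q = 0 by rewrite subr_eq0 => /eqP->.
rewrite -[x - q]gstarK (galg_center i5 (galg_star zg)).
  by apply: glinfP => a c; rewrite gstarE !gl0 rmorph0.
move=> y yg; have sg : g (glbr y (gstar (x - q))).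
  by apply: gA.2 => //; apply: galg_star.
apply: (trform_pos.2); rewrite /trform gltr_br.
set w := glbr y (gstar (x - q)); rewrite -[gltr _]/(trform (glbr y (gstar w)) (x - q)).
rewrite (formC (@trform_pos).1) qE ?rmorph0 ?oppr0 //.
by apply: brspan_br => //; apply: galg_star.
Qed.
End TraceForm.

(** * Whitehead's lemma *)

Section Whitehead.
Variables (F : numClosedFieldType) (K : set (glinf F)).
Hypotheses (KS : subalgebra K) (Kstar : forall x, K x -> K (gstar x)).
Hypothesis Kperfect : forall x, K x -> brspan K K x.

Definition contravariant (M : lieModule K) (B : M -> M -> F) :=
  forall x, K x -> forall u v, B (lact x u) v = B u (lact (gstar x) v).

Variables (n : nat) (e : nat -> glinf F).
Hypothesis eK : forall s, (s < n)%N -> K (e s).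
Hypothesis e_span : forall y, K y -> exists c : nat -> F, y = \sum_(s < n) c s *: e s.
Hypothesis e_dual : forall y, K y -> exists k : nat -> nat -> F,
  (forall s, (s < n)%N -> glbr y (e s) = \sum_(r < n) k s r *: e r) /\
  (forall s, (s < n)%N -> glbr y (gstar (e s)) = - \sum_(r < n) k r s *: gstar (e r)).

Lemma additive_on_sum (V : lmodType F) (f : glinf F -> V) (z : nat -> glinf F) (c : nat -> F) m :
  (forall a x y, K x -> K y -> f (a *: x + y) = a *: f x + f y) ->
  (forall s, (s < m)%N -> K (z s)) ->
  f (\sum_(s < m) c s *: z s) = \sum_(s < m) c s *: f (z s).
Proof.
move=> fL zK; elim: m zK => [|m IH] zK.
  rewrite !big_ord0; have K0 : K 0 by case: KS => -[].
  have := fL 1 _ _ K0 K0; rewrite !scale1r addr0 => h.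
  by apply: (addrI (f 0)); rewrite addr0.
have zK' s : (s < m)%N -> K (z s) by move=> sm; apply: zK; apply: ltnW.
rewrite !big_ord_recr /= addrC fL ?IH 1?addrC //; first exact: zK.
by apply: lsub_sum => [|s _]; [case: KS|apply: lsubZ; [case: KS|apply: zK']].
Qed.

(** The invariance of the Casimir tensor, seen through a bilinear f. Two instances are needed: f x z
    = x z w for the Casimir operator, and f x z = x phi(z) for the element theta in Whitehead's
    lemma. *)
Lemma casimir_invariance (V : lmodType F) (f : glinf F -> glinf F -> V) y :
  (forall z, K z -> forall a x x', K x -> K x' ->
     f (a *: x + x') z = a *: f x z + f x' z) ->
  (forall z, K z -> forall a x x', K x -> K x' ->
     f z (a *: x + x') = a *: f z x + f z x') -> K y ->
  \sum_(s < n) (f (glbr y (gstar (e s))) (e s) + f (gstar (e s)) (glbr y (e s))) = 0.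
Proof.
move=> fl fr Ky; have [k [k1 k2]] := e_dual Ky.
have esK s : (s < n)%N -> K (gstar (e s)) by move=> /eK /Kstar.
rewrite (eq_bigr (fun s : 'I_n => - (\sum_(r < n) k r s *: f (gstar (e r)) (e s)) +
    \sum_(r < n) k s r *: f (gstar (e s)) (e r))) => [|s _]; last first.
  rewrite k1 // k2 //; congr (_ + _).
    rewrite -!sumrN; under eq_bigr do rewrite -scaleNr; under [RHS]eq_bigr do rewrite -scaleNr.
    apply: (@additive_on_sum _ (f^~ (e s)) (fun r => gstar (e r)) (fun r => - k r s)) => //.
    exact/fl/eK.
  apply: (@additive_on_sum _ (f (gstar (e s))) e (k s)) => //.
  exact/fr/esK.
by rewrite big_split sumrN exchange_big /= addNr.
Qed.

Variable W : lieModule K.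

Definition casimir (w : W) := \sum_(s < n) lact (gstar (e s)) (lact (e s) w).

Lemma casimir_linear : linear casimir.
Proof.
move=> a u v; rewrite /casimir scaler_sumr -big_split; apply: eq_bigr => s _.
by rewrite !lact_linear.
Qed.

Lemma casimir_comm y w : K y -> lact y (casimir w) = casimir (lact y w).
Proof.
move=> Ky; rewrite /casimir lact_sum; apply/eqP; rewrite -subr_eq0 -sumrB; apply/eqP.
rewrite -[RHS](@casimir_invariance W (fun x z => lact x (lact z w)) y) //.
- apply: eq_bigr => s _; have es : K (e s) := eK (ltn_ord s).
  have gs := Kstar es; rewrite !lact_br // lactB.
  by rewrite addrA subrK.
- by move=> z _ a x x' Kx Kx'; rewrite lact_lin.
- by move=> z _ a x x' Kx Kx'; rewrite lact_lin // lact_linear.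
Qed.

Variable B : W -> W -> F.
Hypotheses (Bp : posform B) (BK : contravariant B).

(** By contravariance B(C w, w) is the sum of the squared norms of the e_s w. *)
Lemma casimir_eq0 w : casimir w = 0 -> forall y, K y -> lact y w = 0.
Proof.
move=> w0 y Ky; have Bf := Bp.1.
have : B (casimir w) w = 0 by rewrite w0 (form0l Bf).
rewrite /casimir (form_suml Bf) (eq_bigr (fun s : 'I_n => B (lact (e s) w) (lact (e s) w))).
  move=> /eqP; rewrite psumr_eq0 => [/allP h|s _]; last exact: (form_ge0 Bf).
  have [c ->] := e_span Ky.
  rewrite (@additive_on_sum _ (fun x => lact x w)) //; last first.
    by move=> a x x' Kx Kx'; apply: lact_lin.
  apply: big1 => s _; have /eqP/(Bp.2) -> := h s (mem_index_enum s).
  by rewrite scaler0.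
by move=> s _; rewrite BK ?gstarK //; apply/Kstar/eK.
Qed.

(** The Casimir operator is self-adjoint for a positive definite form, so its generalized kernel is
    its kernel. *)
Lemma casimir_iter_eq0 k w : iter k casimir w = 0 -> casimir w = 0.
Proof.
have Bf := Bp.1; have C0 := lin0 casimir_linear.
have adj u v : B (casimir u) v = B u (casimir v).
  rewrite (form_suml Bf) (form_sumr Bf); apply: eq_bigr => s _.
  by rewrite !BK ?gstarK //; [apply: eK|apply/Kstar/eK].
elim: k w => [|k IH] w; first by move=> /= ->.
case: k IH => [//|k] IH; rewrite !iterSr -iterSr => /IH Cw.
by apply: (Bp.2); rewrite adj Cw (form0r Bf).
Qed.

(* theta = sum of e_s^* phi(e_s) satisfies y theta = C phi(y).  After removing
   from phi the coboundary of a preimage of theta under C, as far as there is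
   one, phi takes values in the invariants, hence vanishes on K = [K, K]. *)
Lemma whitehead (phi : glinf F -> W) (S : set W) :
  (forall a x y, K x -> K y -> phi (a *: x + y) = a *: phi x + phi y) ->
  (forall x y, K x -> K y -> phi (glbr x y) = lact x (phi y) - lact y (phi x)) ->
  lsubspace S -> stable K S -> fdim_mod S [set 0] ->
  (forall s, (s < n)%N -> S (phi (e s))) ->
  exists w, forall y, K y -> phi y = lact y w.
Proof.
move=> phiL phiB SL SK Sf Sphi.
pose th := \sum_(s < n) lact (gstar (e s)) (phi (e s)).
have thE y : K y -> lact y th = casimir (phi y).
  move=> Ky; rewrite /th lact_sum /casimir; apply/eqP; rewrite -subr_eq0 -sumrB; apply/eqP.
  rewrite -[RHS](@casimir_invariance W (fun x z => lact x (phi z)) y) //.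
  - apply: eq_bigr => s _; have es : K (e s) := eK (ltn_ord s).
    have gs := Kstar es; rewrite lact_br // phiB // lactB.
    by rewrite addrA subrK.
  - by move=> z _ a x x' Kx Kx'; rewrite lact_lin.
  - by move=> z _ a x x' Kx Kx'; rewrite phiL // lact_linear.
have Sth : S th.
  by apply: lsub_sum => // s _; apply: SK; [apply/Kstar/eK|apply: Sphi].
have CS u : S u -> S (casimir u).
  move=> Su; apply: lsub_sum => // s _; have es : K (e s) := eK (ltn_ord s).
  by apply: (SK _ _ (Kstar es)); apply: SK.
have [k [z [w [Sz Sw thzw kz]]]] :=
  fitting SL (lsub_set0 W) casimir_linear CS Sf Sth.
have Cz := casimir_iter_eq0 kz; have zK := casimir_eq0 Cz.
pose psi y := phi y - lact y w.
have psi0 x y : K x -> K y -> lact x (psi y) = 0.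
  move=> Kx Ky; apply: casimir_eq0 Kx.
  rewrite (linB casimir_linear) -thE // thzw lactD zK // add0r casimir_comm //.
  by rewrite subrr.
exists w => y Ky; apply/eqP; rewrite -subr_eq0; apply/eqP.
rewrite -[LHS]/(psi y).
suff : [set y | K y /\ psi y = 0] y by case.
apply: (brspan_min _ _ (Kperfect Ky)) => /= [|x x' Kx Kx'].
  split.
    have K0 : K 0 by case: KS => -[].
    split=> //; have := phiL 1 _ _ K0 K0; rewrite /psi !scale1r addr0 => h.
    have -> : phi 0 = 0 by apply: (addrI (phi 0)); rewrite addr0.
    by rewrite lact0l ?subrr //; case: KS.
  move=> a x x' [Kx x0] [Kx' x0']; split; first exact: KS.1.2.
  rewrite /psi phiL // lact_lin // opprD addrACA -scalerBr.
  by rewrite -[_ - _]/(psi x) -[phi x' - _]/(psi x') x0 x0' scaler0 addr0.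
split; first exact: KS.2.
rewrite /psi phiB // lact_br // -[LHS]/(_ - _).
have -> : lact x (phi x') - lact x' (phi x) - (lact x (lact x' w) - lact x' (lact x w)) =
    lact x (psi x') - lact x' (psi x).
  by rewrite /psi !lactB !opprB !addrA [LHS](ACl (1*4*2*3)) /= [RHS](ACl (1*2*4*3)).
by rewrite !psi0 // subrr.
Qed.
End Whitehead.

Section SubModule.
Variables (F : fieldType) (K K0 : set (glinf F)).
Hypotheses (KS : subalgebra K) (KK0 : K `<=` K0).
Variables (M : lieModule K0) (S : set M).
Hypotheses (SL : lsubspace S) (SK : stable K S).

(** An operator is needed for every x, while S is stable only under K; outside K it is set to 0. *)
Definition sub_act (x : glinf F) (u : subl SL) : subl SL :=
  if pselect (K x) is left Kx then subl_of SL (SK Kx (subl_mem u)) else 0.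

Lemma sub_actE x u : K x -> subl_val (sub_act x u) = lact x (subl_val u).
Proof. by rewrite /sub_act; case: pselect. Qed.

Lemma sub_act_linear x : linear (sub_act x).
Proof.
move=> a u v; have [Kx|nKx] := pselect (K x).
  by apply: subl_inj; rewrite subl_lin !sub_actE // lact_linear.
by rewrite /sub_act; case: pselect => // _; rewrite scaler0 addr0.
Qed.

Lemma sub_act_lin a x y u : K x -> K y ->
  sub_act (a *: x + y) u = a *: sub_act x u + sub_act y u.
Proof.
move=> Kx Ky; apply: subl_inj; rewrite subl_lin !sub_actE ?lact_lin //;
  do ?[exact: KK0]; exact: KS.1.2.
Qed.

Lemma sub_act_br x y u : K x -> K y ->
  sub_act (glbr x y) u = sub_act x (sub_act y u) - sub_act y (sub_act x u).
Proof.
move=> Kx Ky; apply: subl_inj.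
rewrite -[RHS]/(subl_val (sub_act x (sub_act y u)) - subl_val (sub_act y (sub_act x u))).
by rewrite !sub_actE ?lact_br //; do ?[exact: KK0]; apply: KS.2.
Qed.

Definition sub_mod : lieModule K := LieModule sub_act_linear sub_act_lin sub_act_br.

End SubModule.

Section HomsForm.
Variables (F : numClosedFieldType) (K : set (glinf F)).
Hypotheses (KS : subalgebra K) (Kstar : forall x, K x -> K (gstar x)).
Variables (M N : lieModule K) (BM : M -> M -> F) (BN : N -> N -> F).
Hypotheses (BMp : posform BM) (BNp : posform BN).
Hypotheses (BMK : contravariant BM) (BNK : contravariant BN).
Variables (m : nat) (u : nat -> M).
Hypothesis uE : forall z, z = \sum_(i < m) BM z (u i) *: u i.
Local Notation W := (homs M N).

(** The Hilbert-Schmidt form on Hom(M, N). *)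
Definition homs_form (f g : W) : F := \sum_(s < m) BN (app f (u s)) (app g (u s)).

Lemma homs_form_pos : posform homs_form.
Proof.
have Bf := BNp.1; split; first split.
- move=> a f g h; rewrite /homs_form mulr_sumr -big_split; apply: eq_bigr => s _.
  by rewrite app_lin (formDl Bf) (formZl Bf).
- move=> f g; rewrite /homs_form rmorph_sum; apply: eq_bigr => s _; exact: (formC Bf).
- by move=> f; apply: sumr_ge0 => s _; apply: (form_ge0 Bf).
move=> f /eqP; rewrite psumr_eq0 => [/allP h|s _]; last exact: (form_ge0 Bf).
apply: lin_mapsP => z; rewrite (uE z) (lin_sum (app_linear f)); apply: big1 => s _.
by rewrite (linZ (app_linear f)) ((BNp.2) _ (eqP (h s (mem_index_enum s)))) scaler0.
Qed.

Lemma homs_form_contravariant : contravariant homs_form.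
Proof.
have Bf := BNp.1; have Bm := BMp.1; move=> x Kx f g.
have E (y : glinf F) (h h' : W) : homs_form (lact y h) h' =
    \sum_(s < m) BN (lact y (app h (u s))) (app h' (u s)) -
    \sum_(s < m) \sum_(r < m) BM (lact y (u s)) (u r) * BN (app h (u r)) (app h' (u s)).
  rewrite -sumrB; apply: eq_bigr => s _; rewrite homs_actE (formBl Bf); congr (_ - _).
  rewrite {1}(uE (lact y (u s))) (lin_sum (app_linear h)) (form_suml Bf).
  by apply: eq_bigr => r _; rewrite (linZ (app_linear h)) (formZl Bf).
rewrite E [RHS](formC homs_form_pos.1) E rmorphB !rmorph_sum; congr (_ - _).
  by apply: eq_bigr => s _; rewrite /= -(formC Bf) BNK.
rewrite exchange_big; apply: eq_bigr => s _; rewrite rmorph_sum; apply: eq_bigr => r _ /=.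
by rewrite rmorphM /= -(formC Bf) -(formC Bm) BMK.
Qed.

Lemma homs_fdim (T : set N) : fdim_mod T [set 0] ->
  fdim_mod [set f : W | forall s, (s < m)%N -> T (app f (u s))] [set 0].
Proof.
move=> [d [j [jL jT]]].
exists (m * d)%N, (fun f => mxvec (\matrix_(s < m) j (app f (u s)))); split.
  move=> a f g; rewrite -linearP; congr mxvec; apply/matrixP => s k.
  by rewrite !mxE app_lin jL !mxE.
move=> f fT /(congr1 vec_mx); rewrite mxvecK linear0 => f0.
apply: lin_mapsP => z; rewrite (uE z) (lin_sum (app_linear f)); apply: big1 => s _.
rewrite (linZ (app_linear f)) (jT _ (fT s (ltn_ord s))) ?scaler0 //.
by have /(congr1 (row s)) := f0; rewrite rowK row0.
Qed.
End HomsForm.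

Lemma filtration_bound (F : numClosedFieldType) (t : classical_type)
    (N : lieModule (@ginf F t)) (Fil : nat -> set N) m (g : nat -> N) :
  filtration Fil -> exists l, forall s, (s < m)%N -> Fil l (g s).
Proof.
move=> FF; have [_ _ Fex _ _] := FF; elim: m => [|m [l IH]]; first by exists 0%N.
have [l' gl'] := Fex (g m); exists (maxn l l') => s; rewrite ltnS leq_eqVlt.
move=> /orP[/eqP->|/IH]; first by apply: filtrationS FF _ _ gl'; apply: leq_maxr.
by apply: filtrationS FF _ _; apply: leq_maxl.
Qed.

(** Whitehead's lemma is applied to the maps from the finite-dimensional module U(g_i) v to N. The
    finitely many values of phi on a basis of g_i, restricted to that module, map into one step k of
    the filtration, and k is taken at least [gdim t i] to make that step g_i-stable. *)
Lemma cocycle_trivial_on (F : numClosedFieldType) (t : classical_type) i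
    (M N : lieModule (@ginf F t)) (v : M) (phi : glinf F -> lin_maps M N) :
  (5 <= i)%N -> unitary_filtered M -> unitary_filtered N -> cocycle phi ->
  exists w : lin_maps M N, forall y m, galg t i y -> gen (galg t i) v m ->
    app (phi y) m = lact y (app w m) - app w (lact y m).
Proof.
move=> i5 MU NU [_ phiL phiB]; set g := galg t i.
have gA : subalgebra g := galg_subalgebra F t i.
have gK : g `<=` @ginf F t := @galg_ginf F t i.
have [n [e [eg e_span e_dual]]] := casimir_basis F t i.
have gs x : g x -> g (gstar x) := @galg_star F t i x.
have [BM [_ [[BMp BMK] _]]] := MU; have [BN [Fil [[BNp BNK] FF]]] := NU.
pose M1 := sub_mod gA gK (gen_lsub g v) (@gen_stable _ _ _ _ v).
pose N1 := resm gK N.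
pose B1 (a b : M1) := BM (subl_val a) (subl_val b).
have Bf := BMp.1.
have B1p : posform B1.
  split; first split.
  - by move=> a x y z; rewrite /B1 -(formZl Bf) -(formDl Bf).
  - by move=> x y; apply: (formC Bf).
  - by move=> x; apply: (form_ge0 Bf).
  by move=> x /(BMp.2) x0; apply: subl_inj.
have B1K : contravariant B1.
  move=> x gx a b; rewrite /B1 /= !sub_actE //; last exact: gs.
  by apply: BMK; exact: (gK _ gx).
have M1f : fdim_mod [set: M1] [set 0].
  have [d [j [jL j0]]] := gen_fdim i v MU.
  exists d, (fun a : M1 => j (subl_val a)); split; first by move=> a x y; apply: jL.
  by move=> a _ /(j0 _ (subl_mem a)) a0; apply: subl_inj.
have [m [u [_ _ uE]]] := orthonormal_basis B1p (lsub_setT M1) M1f.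
have {}uE z := uE z I.
have restL (f : lin_maps M N) : linear (fun a : M1 => app f (subl_val a) : N1).
  by move=> a x y; exact: (app_linear f a (subl_val x) (subl_val y)).
pose rest f : lin_maps M1 N1 := subl_of (linear_lsub M1 N1) (restL f).
pose psi y := rest (phi y).
have [l lP] : exists l, forall s r, (s < n)%N -> (r < m)%N -> Fil l (app (psi (e s)) (u r)).
  have /choice[l lP] s := filtration_bound m (fun r => app (psi (e s)) (u r)) FF.
  exists (\max_(s < n) l s) => s r sn rm; apply: filtrationS FF _ _ (lP s r rm).
  exact: (leq_bigmax (Ordinal sn)).
pose k := maxn l (gdim t i).
have [FL _ _ Ff FK] := FF.
pose S := [set f : homs M1 N1 | forall s, (s < m)%N -> Fil k (app f (u s))].
have SL : lsubspace S.
  split=> [s _|a f h fS hS s sm]; first by case: (FL k).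
  by apply: (FL k).2; [apply: fS|apply: hS].
have SK : stable g S.
  move=> x f gx fS s sm; rewrite homs_actE; apply: lsubB => //.
    apply: FK (fS s sm); first exact: (gK _ gx).
    by apply: in_cornerS (galg_corner gx); apply: leq_maxr.
  rewrite (uE (lact x (u s))) (lin_sum (app_linear f)); apply: lsub_sum => // r _.
  by rewrite (linZ (app_linear f)); apply: lsubZ => //; apply: fS.
have psiL a x y : g x -> g y -> psi (a *: x + y) = a *: psi x + psi y.
  move=> gx gy; apply: lin_mapsP => z.
  by rewrite -[LHS]/(app (phi (a *: x + y)) (subl_val z)) phiL //; [exact: (gK _ gx)|exact: (gK _ gy)].
have psiB x y : g x -> g y ->
    psi (glbr x y) = homs_act x (psi y) - homs_act y (psi x) :> homs M1 N1.
  move=> gx gy; apply: lin_mapsP => z; rewrite app_sub !homs_actE.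
  rewrite -[LHS]/(app (phi (glbr x y)) (subl_val z)) phiB; [|exact: (gK _ gx)|exact: (gK _ gy)].
  have aE c : g c -> subl_val (lact c z : M1) = lact c (subl_val z).
    by move=> gc; apply: sub_actE gc.
  rewrite app_sub !homs_actE -!aE //.
have N1K : contravariant (K := g) (M := N1) BN by move=> x gx; apply: BNK; exact: (gK _ gx).
have BNp' : posform (BN : N1 -> N1 -> F) := BNp.
have Ff' : fdim_mod (Fil k : set N1) [set 0] := Ff k.
have psiS r : (r < n)%N -> S (psi (e r)).
  move=> rn s sm; apply: filtrationS FF _ _ (lP r s rn sm); exact: leq_maxl.
have [w1 w1E] := whitehead gA gs (fun x xi => galg_perfect i5 xi) eg e_span e_dual
  (homs_form_pos BNp' uE) (homs_form_contravariant B1p BNp' B1K N1K uE)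
  psiL psiB SL SK (homs_fdim uE Ff') psiS.
(* The solution w1 is defined on the module of v only; its graph is extended to a linear map on
   M. *)
pose G := [set p : M * N | exists a : M1, p = (subl_val a, app w1 a)].
have [||f [fL fE]] := @functional_extend _ M N G.
- split; first by exists 0; rewrite (lin0 (app_linear w1)).
  move=> a p q [c ->] [d ->]; exists (a *: c + d).
  by rewrite (app_linear w1).
- move=> y [a [a0 ->]]; rewrite (_ : a = 0) ?(lin0 (app_linear w1)) //.
  by apply: subl_inj; rewrite -a0.
have [w wE] := lin_map_of fL; exists w => y z gy gz.
pose a : M1 := subl_of (gen_lsub g v) gz.
have aw (c : M1) : app w (subl_val c) = app w1 c.
  by rewrite wE; apply/esym/fE; exists c.
have yaE : subl_val (lact y a : M1) = lact y z by apply: sub_actE gy.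
have := congr1 (fun h : homs M1 N1 => app h a) (w1E y gy).
by rewrite homs_actE -aw -aw yaE.
Qed.

(** * Lifts of the highest weight vector to an extension *)

Section Lifting.
Variables (F : numClosedFieldType) (t : classical_type).
Local Notation K := (@ginf F t).
Variables (M N : lieModule K) (E : extension M N).

Definition lift_at i (v : M) (e : E) :=
  ext_out e = v /\ forall z, gen (galg t i) e z -> ext_out z = 0 -> z = 0.

(** Subtracting from a linear section the map w that trivializes its cocycle makes it
    g_i-equivariant on U(g_i) v; the image of that module is the module of the lift. *)
Lemma extension_lift i (v : M) : (5 <= i)%N ->
  unitary_filtered M -> unitary_filtered N -> exists e, lift_at i v e.
Proof.
move=> i5 MU NU; have [s [phi [sL sO pZ pE]]] := section_cocycle_ex (ginf_subalgebra F t) E.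
have [w wE] := cocycle_trivial_on v i5 MU NU pZ.
have inL := ext_in_linear E.
pose s' m := s m - ext_in E (app w m).
have s'L : linear s'.
  by move=> a m m'; rewrite /s' sL (app_linear w) inL opprD addrACA scalerBr.
have s'O m : ext_out (s' m) = m.
  by rewrite (linB (@ext_out_linear _ _ _ _ E)) sO ext_out_in subr0.
have s'K x m : galg t i x -> gen (galg t i) v m -> lact x (s' m) = s' (lact x m).
  move=> xi gm; have Kx := galg_ginf xi.
  have := pE x m Kx; rewrite wE // (linB inL) ext_in_act // => h.
  have -> : s' (lact x m) = s (lact x m) - ext_in E (app w (lact x m)) by [].
  have -> : ext_in E (app w (lact x m)) = lact x (ext_in E (app w m)) -
      (lact x (s m) - s (lact x m)) by rewrite -h subKr.
  by rewrite /s' lactB opprB addrCA addrA subrK addrC.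
exists (s' v); split=> // z gz z0.
have [m _ zE] : exists2 m, gen (galg t i) v m & z = s' m.
  have gL := gen_lsub (galg t i) v.
  suff : [set z | exists2 m, gen (galg t i) v m & z = s' m] z by [].
  apply: gz => [|x u xi [m gm ->]|]; last by exists v => //; apply: gen_id.
    split; first by exists 0; [case: gL|rewrite (lin0 s'L)].
    by move=> a _ _ [m gm ->] [m' gm' ->]; exists (a *: m + m'); [apply: gL.2|rewrite s'L].
  by exists (lact x m); [apply: gen_stable|rewrite s'K].
by rewrite zE (_ : m = 0) ?(lin0 s'L) // -(s'O m) -zE.
Qed.
End Lifting.

(** * Splitting of extensions *)

Section Splitting.
Variables (F : numClosedFieldType) (t : classical_type).
Local Notation K := (@ginf F t).
Local Notation g i := (@galg F t i).
Variable b : nat -> set (glinf F).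
Hypotheses (bB : forall i, is_borel (g i) (b i)) (bS : forall i, b i `<=` b i.+1).
Variables (M N : lieModule K) (v : M).
Hypotheses (MU : unitary_filtered M) (NU : unitary_filtered N) (v0 : v <> 0).
Hypotheses (bv : forall i x, b i x -> exists a, lact x v = a *: v).
Hypothesis Mv : forall m, gen K v m.
Variable E : extension M N.

Lemma lift_mono i j (e : E) : (i <= j)%N -> lift_at j v e -> lift_at i v e.
Proof.
move=> /(@galgS F t) ij [ev eI]; split=> // z gz; apply: eI; exact: genS ij _ gz.
Qed.

Lemma lift_diff i (e e' : E) : lift_at i v e -> lift_at i v e' ->
  exists2 n, singular b v (N := N) i n & e = e' + ext_in E n.
Proof.
move=> [ev eI] [e'v e'I].
have [n nE] : exists n, e - e' = ext_in E n.
  by apply/ext_exact; rewrite (linB (@ext_out_linear _ _ _ _ E)) ev e'v subrr.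
exists n; last by rewrite -nE addrC subrK.
(* The vector x u - a u lies in the g_i-module of u and maps to 0, so it vanishes: b_i acts on a
   lift as it does on v. *)
have eig (u : E) x a : ext_out u = v ->
    (forall z, gen (g i) u z -> ext_out z = 0 -> z = 0) ->
    b i x -> lact x v = a *: v -> lact x u = a *: u.
  move=> uv uI bx xv; have xi := borel_sub bB bx.
  have uL := gen_lsub (g i) u; have uu := @gen_id _ (g i) _ _ u.
  apply/eqP; rewrite -subr_eq0; apply/eqP/uI.
    exact: (lsubB uL (gen_stable xi uu) (lsubZ a uL uu)).
  rewrite (linB (@ext_out_linear _ _ _ _ E)) (linZ (@ext_out_linear _ _ _ _ E)).
  by rewrite ext_out_act ?uv ?xv ?subrr //; apply: galg_ginf xi.
move=> x bx a xv; apply: (@ext_in_inj _ _ _ _ E).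
have Kx := galg_ginf (borel_sub bB bx).
rewrite ext_in_act // (linZ (ext_in_linear E)) -nE lactB scalerBr.
by rewrite (eig e x a) // (eig e' x a).
Qed.

(** The elements of the new module are sums z' + n', where z' lies in the module of e and n' is the
    image of [ext_out z'] under the homomorphism sending v to n. If z' maps to 0, both terms
    vanish. *)
Lemma lift_shift i (e : E) n : lift_at i v e -> singular b v (N := N) i n ->
  lift_at i v (e + ext_in E n).
Proof.
move=> [ev eI] nS; have outL := @ext_out_linear _ _ _ _ E; have inL := ext_in_linear E.
split; first by rewrite (linD outL) ev ext_out_in addr0.
move=> z gz; have gL := gen_lsub (g i) e; have GL := gen2_lsub (@galg_ginf F t i) (@galg_ginf F t i) v n.
have [z' [n' [gz' gn' ->]]] : [set z | exists z' n', [/\ gen (g i) e z',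
    gen2_at (M := M) (N := N) i v n (ext_out z', n') & z = z' + ext_in E n']] z.
  apply: gz => [|x _ xi [z' [n' [gz' gn' ->]]]|].
  - split.
      exists 0, 0; rewrite (lin0 outL) (lin0 inL) addr0; by split=> //; [case: gL|case: GL].
    move=> a _ _ [z1 [n1 [g1 G1 ->]]] [z2 [n2 [g2 G2 ->]]].
    exists (a *: z1 + z2), (a *: n1 + n2); split; first exact: gL.2.
      rewrite outL; exact: (GL.2 a (ext_out z1, n1) (ext_out z2, n2)).
    by rewrite inL scalerDr addrACA.
  - have Kx := galg_ginf xi; exists (lact x z'), (lact x n'); split.
    + exact: gen_stable.
    + by rewrite ext_out_act //; apply: gen2_act.
    + by rewrite lactD ext_in_act.
  - by exists e, n; split=> //; rewrite ev; exact: gen2_id.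
rewrite (linD outL) ext_out_in addr0 => z'0.
rewrite (eI _ gz' z'0) add0r; rewrite z'0 in gn'.
suff -> : n' = 0 by rewrite (lin0 inL).
have [n0|nn0] := pselect (n = 0); last first.
  by have [-> //] := singular_pair bB MU v0 bv NU nS nn0 gn'.
have := gen2_snd gn'; rewrite n0 => g0.
suff : [set 0] n' by [].
by apply: g0 => [|x _ _ ->|] //; [exact: lsub_set0|exact: lact0].
Qed.

Lemma lift_section (e : E) i1 : (forall i, (i1 <= i)%N -> lift_at i v e) ->
  exists s : M -> E, [/\ linear s, forall m, ext_out (s m) = m &
    forall x m, K x -> s (lact x m) = lact x (s m)].
Proof.
move=> eL; have outL := @ext_out_linear _ _ _ _ E.
have gL := gen_lsub K e; have ev : ext_out e = v by case: (eL i1 (leqnn _)).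
pose G := [set p : M * E | gen K e p.2 /\ p.1 = ext_out p.2].
have [||m|s [sL sG]] := @functional_linear F M E G.
- split; first by split; [case: gL|rewrite (lin0 outL)].
  move=> a p q [gp pE] [gq qE]; split; first exact: gL.2.
  by rewrite [RHS](outL a p.2 q.2) -pE -qE.
- move=> z [/= gz z0]; have [i gi] := gen_union gz.
  have [_ eI] := eL (maxn i1 i) (leq_maxl _ _); apply: eI (esym z0).
  by apply: genS gi; apply: galgS; apply: leq_maxr.
- have [z gz zm] : [set m | exists2 z, gen K e z & ext_out z = m] m; last first.
    by exists z; split.
  apply: (Mv m) => [|x _ Kx [z gz <-]|]; last by exists e => //; apply: gen_id.
    split; first by exists 0; [case: gL|rewrite (lin0 outL)].
    move=> a _ _ [z1 g1 <-] [z2 g2 <-]; exists (a *: z1 + z2); first exact: gL.2.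
    by rewrite outL.
  by exists (lact x z); [apply: gen_stable|rewrite ext_out_act].
have Gs m : G (m, s m) by apply/sG.
exists s; split=> // [m|x m Kx]; first by case: (Gs m).
apply/esym/sG; case: (Gs m) => /= gm mE; split=> /=; first exact: gen_stable.
by rewrite ext_out_act // -mE.
Qed.

Lemma extension_splits i1 :
  (forall i, (i1 <= i)%N -> singular b v (N := N) i = singular b v (N := N) i1) ->
  exists s : M -> E, [/\ linear s, forall m, ext_out (s m) = m &
    forall x m, K x -> s (lact x m) = lact x (s m)].
Proof.
move=> st; set i2 := maxn i1 5; have i12 : (i1 <= i2)%N := leq_maxl _ _.
have [e eL] := extension_lift E v (leq_maxr i1 5 : (5 <= i2)%N) MU NU.
apply: (@lift_section e i2) => i i2i.
have [e' e'L] := extension_lift E v (leq_trans (leq_maxr i1 5) i2i) MU NU.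
have [n nS ->] := lift_diff eL (lift_mono i2i e'L).
by apply: lift_shift => //; rewrite st 1?(leq_trans i12) // -(st i2).
Qed.
End Splitting.

(** * Highest weights and singular vectors *)

Section HighestWeights.
Variables (F : numClosedFieldType) (t : classical_type).
Local Notation K := (@ginf F t).
Local Notation g i := (@galg F t i).
Local Notation gK i := (@galg_ginf F t i).
Variables h b : nat -> set (glinf F).
Hypothesis hb : nested_borels t h b.
Local Notation hinf := (\bigcup_i h i).

Let bB := nb_borel hb.
Let bS := nb_borelS hb.

Definition hw_vector (la : weight hinf) (M : lieModule K) (v : M) :=
  [/\ v <> 0, forall x (hx : hinf x), lact x v = la (exist _ x hx) *: v,
     forall i x, brspan (b i) (b i) x -> lact x v = 0 & forall m, gen K v m].

Lemma is_V_vector (la : weight hinf) (M : lieModule K) : is_V b la M ->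
  exists v : M, hw_vector la v.
Proof.
move=> [_ [v [v0 vla vb vS]]]; exists v; split=> // [i x bx|m].
  by apply: vb; apply: brspanSS bx => y ?; exists i.
rewrite (vS (gen K v)) //.
have gL := gen_lsub K v; split; [by case: gL|exact: gL.2|].
by move=> x u Kx gu; apply: gen_stable.
Qed.

Lemma cartan_sub i x : h i x -> b i x.
Proof. exact: (nb_sub hb). Qed.

Lemma borel_decomposition i x : b i x ->
  exists y z : glinf F, [/\ h i y, brspan (b i) (b i) z & x = y + z].
Proof.
have [hA hg hn hself] := nb_cartan hb i.
move=> bx; have [y hy zb] := borel_cartan_derived (@galg_corner F t i) (bB i)
  (nb_cartan hb i) (@cartan_sub i) bx.
by exists y, (x - y); split=> //; rewrite addrC subrK.
Qed.

Section Vector.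
Variables (la : weight hinf) (M : lieModule K) (v : M).
Hypothesis vla : hw_vector la v.

Lemma hw_borel i (x y z : glinf F) (hy : hinf y) : h i y -> brspan (b i) (b i) z -> x = y + z ->
  lact x v = la (exist _ y hy) *: v.
Proof.
have [_ vh vb _] := vla; move=> iy bz ->.
have ig x' : b i x' -> K x' by move=> /(borel_sub bB) /(gK i).
rewrite lactDl; first by rewrite vh (vb i) // addr0.
  exact/ig/cartan_sub.
by apply/ig/(derived_sub _ bz); case: (bB i).
Qed.

Lemma hw_bv i x : b i x -> exists a, lact x v = a *: v.
Proof.
move=> /borel_decomposition[y [z [iy bz E]]]; have hy : hinf y by exists i.
by exists (la (exist _ y hy)); exact: (hw_borel hy iy bz E).
Qed.

Lemma hw_irr i : unitary_filtered M -> irr (g i) v.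
Proof.
move=> MU; have [v0 _ _ _] := vla; have [H bH] := borel_raising bB i.
exact: irr_galg (@borel_sub _ _ _ bB i) bH MU v0 (@hw_bv i).
Qed.

Definition Vi i : lieModule (g i) :=
  sub_mod (galg_subalgebra F t i) (gK i) (gen_lsub (g i) v) (@gen_stable _ _ _ _ v).

(** Unitarity makes the g_i-module of the highest weight vector simple, so V^i_la is found inside
    V_la itself. *)
Lemma is_Vi_Vi i : unitary_filtered M -> is_Vi (h := h) b la (Vi i).
Proof.
move=> MU; have [v0 vh vb _] := vla.
have [_ virr] := hw_irr i MU.
pose v1 : Vi i := subl_of (gen_lsub (g i) v) (@gen_id _ (g i) _ _ v).
have aE x (u : Vi i) : g i x -> subl_val (lact x u) = lact x (subl_val u).
  by move=> ?; apply: sub_actE.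
have sub (S : set (Vi i)) z : is_submodule S -> S z -> z <> 0 -> S = [set: Vi i].
  move=> [S0 SL SK] Sz z0; apply/seteqP; split=> // u _.
  have gz : gen (g i) (subl_val z) v.
    by apply: virr; [exact: subl_mem|move=> z00; apply: z0; apply: subl_inj].
  have [u' [Su' uu']] : [set m | exists u', S u' /\ m = subl_val u'] (subl_val u).
    have := gen_trans gz (subl_mem u); apply=> [|x _ xi [w [Sw ->]]|].
    - split; first by exists 0.
      move=> a _ _ [w [Sw ->]] [w' [Sw' ->]]; exists (a *: w + w').
      by split=> //; apply: SL.
    - by exists (lact x w); rewrite aE //; split=> //; apply: SK.
    - by exists z.
  by rewrite (subl_inj uu').
have v10 : v1 <> 0 by move=> /(congr1 (@subl_val _ _ _ _)).
split; first split.
- by exists v1.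
- move=> S SS; have [[z [Sz z0]]|nz] := pselect (exists z, S z /\ z <> 0).
    by right; apply: sub Sz z0.
  left; apply/seteqP; split=> [z Sz|_ ->]; last by case: SS.
  by apply: contrapT => z0; apply: nz; exists z.
exists v1; split=> // [x hx|x bx|S SS Sv1].
- apply: subl_inj; rewrite aE; last exact/(borel_sub bB)/cartan_sub.
  have hx' : hinf x by exists i.
  rewrite /= (vh x hx'); congr (_ *: _); rewrite /res_weight.
  by congr (la _); congr exist; apply: Prop_irrelevance.
- apply: subl_inj; rewrite aE; last first.
    by apply: (borel_sub bB); apply: derived_sub bx; case: (bB i).
  exact: (vb i).
- exact: sub Sv1 v10.
Qed.
End Vector.

Lemma hw_eigen (la : weight hinf) (M : lieModule K) (v : M) i x y (hy : hinf y) z a :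
  hw_vector la v -> h i y -> brspan (b i) (b i) z -> x = y + z ->
  lact x v = a *: v -> a = la (exist _ y hy).
Proof.
move=> vla iy bz E; rewrite (hw_borel vla hy iy bz E) => /eqP.
have [v0 _ _ _] := vla; rewrite -subr_eq0 -scalerBl scaler_eq0 => /orP[|/eqP//].
by rewrite subr_eq0 => /eqP.
Qed.

Lemma Vi_vector i (la : weight hinf) (M : lieModule (g i)) : is_Vi (h := h) b la M ->
  exists v : M, [/\ v <> 0, irr (g i) v, forall m, gen (g i) v m &
    forall x y z (hy : hinf y), h i y -> brspan (b i) (b i) z -> x = y + z ->
      lact x v = la (exist _ y hy) *: v].
Proof.
move=> [[_ MS] [v [v0 vh vb vS]]]; exists v.
have gA := galg_subalgebra F t i.
have genT z : z <> 0 -> gen (g i) z = [set: M].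
  move=> z0; have gL := gen_lsub (g i) z.
  have [|e|//] := MS (gen (g i) z).
    split; [by case: gL|exact: gL.2|].
    by move=> x u xi gu; apply: gen_stable.
  have : gen (g i) z z by apply: gen_id.
  by rewrite e.
split=> // [|m|x y z hy iy bz ->].
- by split=> // z _ /genT ->.
- by rewrite genT.
have yg : g i y by exact/(borel_sub bB)/cartan_sub.
have zg : g i z by apply: (borel_sub bB); apply: derived_sub bz; case: (bB i).
rewrite lactDl // (vb _ bz) addr0 (vh y iy); congr (_ *: _); rewrite /res_weight.
by congr (la _); congr exist; apply: Prop_irrelevance.
Qed.

Section Pairs.
Variables (la mu : weight hinf) (M N : lieModule K) (v : M) (w : N).
Hypotheses (MU : unitary_filtered M) (NU : unitary_filtered N).
Hypotheses (vmu : hw_vector mu v) (wla : hw_vector la w).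

(** The graph generated by (v, z) is a nonzero homomorphism into N, and its image lies in the
    g_j-module of w as soon as z does. *)
Lemma wle_of_singular i0 : (forall i, (i0 <= i)%N -> exists2 z, singular b v i z & z <> 0 :> N) ->
  wle t b mu la.
Proof.
move=> S; exists i0 => i /S[z zS z0].
have [_ _ _ wT] := wla; have [v0 _ _ _] := vmu; have bv := hw_bv vmu.
have [j [ij gz]] : exists j, (i < j)%N /\ gen (g j) w z.
  have [k gk] := gen_union (wT z); exists (maxn i.+1 k); split; first exact: leq_maxl.
  by apply: genS gk; apply: galgS; apply: leq_maxr.
exists j; split=> //; exists (Vi v i), (Vi w j).
have pair := singular_pair bB MU v0 bv NU zS z0.
have GL := gen2_lsub (gK i) (gK i) v z.
have aM (x : glinf F) (u : Vi v i) : g i x -> subl_val (lact x u) = lact x (subl_val u).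
  by move=> ?; apply: sub_actE.
have ji : g i `<=` g j by apply: galgS; apply: ltnW.
have aN (x : glinf F) (u : Vi w j) : g i x -> subl_val (lact x u) = lact x (subl_val u).
  by move=> xi; apply: sub_actE; apply: ji.
pose G := [set p : Vi v i * Vi w j | gen2_at (M := M) (N := N) i v z (subl_val p.1, subl_val p.2)].
have [||m|f [fL fG]] := @functional_linear F (Vi v i) (Vi w j) G.
- split; first by case: GL.
  by move=> a p q Gp Gq; exact: (GL.2 a (subl_val p.1, subl_val p.2) (subl_val q.1, subl_val q.2)).
- by move=> n /pair[n0 _]; apply: subl_inj; apply: n0.
- have [n gn] := gen2_surj (gK i) (gK i) z (subl_mem m).
  have gwn : gen (g j) w n.
    have := gen_trans gz (genS ji (gen2_snd gn)); exact.
  by exists (subl_of (gen_lsub (g j) w) gwn).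
exists f; split.
- exact: is_Vi_Vi.
- exact: is_Vi_Vi.
- split=> // x xi u; apply/esym/fG; rewrite /G /= aM // aN //.
  by apply: gen2_act => //; apply/fG.
have v1 : gen (g i) v v by apply: gen_id.
exists (subl_of (gen_lsub (g i) v) v1) => f0.
have : G (subl_of (gen_lsub (g i) v) v1, f (subl_of (gen_lsub (g i) v) v1)) by apply/fG.
by rewrite f0 => /pair[_ /(_ erefl)]; apply: v0.
Qed.

Lemma singular_of_wle : wle t b mu la -> forall i, exists2 z, singular b v i z & z <> 0 :> N.
Proof.
move=> [i0 W] i1; set i := maxn i1 i0.
have [j [ij [M1 [N1 [f [M1V N1V [fL fK] [u fu]]]]]]] := W i (leq_maxr _ _).
have [v1 [v10 v1irr v1T v1b]] := Vi_vector M1V.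
have [w1 [w10 w1irr w1T w1b]] := Vi_vector N1V.
have [v0 _ _ _] := vmu; have [w0 _ _ _] := wla.
have fv1 : f v1 <> 0.
  move=> fv0; apply: fu; suff : [set u | f u = 0] u by [].
  apply: (v1T u) => [|x m xi fm|//].
    by split=> [|a p q fp fq] /=; rewrite ?(lin0 fL) // fL fp fq scaler0 addr0.
  by rewrite /= fK // fm lact0.
have same : same_character (b j) w1 w.
  move=> x /borel_decomposition[y [z [jy bz xE]]]; have hy : hinf y by exists j.
  by exists (la (exist _ y hy)); split; [exact: w1b bz xE|exact: hw_borel bz xE].
have [H bH] := borel_raising bB j; have gA := galg_subalgebra F t j.
(* The module N1 is only some model of V^j_la; n is the image of f(v1) under the isomorphism from N1
   to U(g_j) w that sends w1 to w. *)
have [n gn] := gen2_surj (fun _ (p : g j _) => p) (gK j) w (w1T (f v1)).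
have p1 := pair_eq0 gA (@borel_sub _ _ _ bB j) bH w10 (hw_irr wla j NU) same.
have p2 := pair_eq0 gA (@borel_sub _ _ _ bB j) bH w0 w1irr (same_characterC same).
exists n; last by move=> n0; apply: fv1; apply: (p2 _ _ _ _ (gen2_swap gn) n0).
apply: (singular_mono bS) (leq_maxl i1 i0) _ _ => x bx a xv.
have xj : g j x by apply: galgS (borel_sub bB bx); apply: ltnW.
have [y [z [iy bz xE]]] := borel_decomposition bx; have hy : hinf y by exists i.
have xv1 : lact x v1 = a *: v1.
  by rewrite (v1b _ _ _ hy iy bz xE) (hw_eigen hy vmu iy bz xE xv).
apply/eqP; rewrite -subr_eq0; apply/eqP.
have GL := gen2_lsub (fun _ (p : g j _) => p) (gK j) w1 w.
have := lsubB GL (gen2_act xj gn) (lsubZ a GL gn).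
rewrite -(fK x (borel_sub bB bx)).
rewrite xv1 (linZ fL) /= => G0; apply: (p1 _ _ _ _ G0).
by rewrite subrr.
Qed.

Lemma weight_eq_singular : mu = la -> forall i, singular b v i w.
Proof.
move=> e i x bx a xv; have [y [z [iy bz xE]]] := borel_decomposition bx.
have hy : hinf y by exists i.
by rewrite (hw_borel wla hy iy bz xE) -e (hw_eigen hy vmu iy bz xE xv).
Qed.

(** At high levels z and w generate each other, so neither H-eigenvalue can lie strictly below the
    other. Hence z is a multiple of w, and the two weights agree on h_i. *)
Lemma global_singular (z : N) : z <> 0 -> (forall i, singular b v i z) -> mu = la.
Proof.
move=> z0 zS; have [w0 _ _ wT] := wla; have [v0 vh _ _] := vmu.
have [i0 gz0] := gen_union (wT z).
have key i : (i0 <= i)%N -> exists2 c, c != 0 & z = c *: w.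
  move=> i0i; have gz : gen (g i) w z by apply: genS gz0; apply: galgS.
  have gw : gen (g i) z w by have [_] := hw_irr wla i NU; apply.
  have [H bH] := borel_raising bB i; have bHH : b i H by case: bH.
  have [a Ha] := hw_bv wla bHH; have [e He] := singular_bv (hw_bv vmu) (zS i) bHH.
  have gA := galg_subalgebra F t i; have bg := @borel_sub _ _ _ bB i.
  have := gen_weight gA bg (ginf_lsub F t) (gK i) bH (@hw_bv _ _ _ wla i) Ha gz He.
  case=> [//|[_ [c zc]]|a_e]; first exists c => //.
    by apply/eqP => c0; apply: z0; rewrite zc c0 scale0r.
  have := gen_weight gA bg (ginf_lsub F t) (gK i) bH
    (singular_bv (hw_bv vmu) (zS i)) He gw Ha.
  case=> [//|[ea _]|e_a]; first by move: a_e; rewrite ea subrr ltxx.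
  by have := addr_gt0 a_e e_a; rewrite addrA subrK subrr ltxx.
apply/funext => -[x hx].
have [i _ ix] := hx; set j := maxn i i0.
have jx : h j x.
  have : (i <= j)%N by apply: leq_maxl.
  elim: (j) => [|j' IH]; first by rewrite leqn0 => /eqP <-.
  by rewrite leq_eqVlt => /orP[/eqP <-//|/IH]; apply: (nb_cartanS hb).
have [c c0 zc] := key j (leq_maxr _ _).
have [_ wh _ _] := wla.
have := zS j x (cartan_sub jx) _ (vh x hx); rewrite zc lactZ wh !scalerA => /eqP.
rewrite -subr_eq0 -scalerBl scaler_eq0 => /orP[|/eqP//].
rewrite mulrC -mulrBl mulf_eq0 (negbTE c0) orbF subr_eq0 => /eqP e.
exact/esym.
Qed.

Lemma not_wlt_stationary : simple_tensor N -> ~ wlt t b mu la ->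
  exists i1, forall i, (i1 <= i)%N -> singular b v (N := N) i = singular b v i1.
Proof.
move=> NT nlt; have [e|ne] := pselect (mu = la).
  have [w0 _ _ wT] := wla.
  have [i1 st] := singular_stationary bB bS NU w0 (hw_bv wla) wT NT.
  have E i : singular b v (N := N) i = singular b w i.
    apply/seteqP; split=> z zS x bx a xa; apply: (zS x bx a).
      have [c xv] := hw_bv vmu bx; rewrite xv; have := weight_eq_singular e bx xv.
      rewrite xa => /eqP; rewrite -subr_eq0 -scalerBl scaler_eq0 => /orP[|/eqP//].
      by rewrite subr_eq0 => /eqP->.
    exact: (weight_eq_singular e bx xa).
  by exists i1 => i /st; rewrite !E.
have nle : ~ wle t b mu la by move=> le; apply: nlt.
have [i1 S0] : exists i1, forall z : N, singular b v i1 z -> z = 0.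
  apply: contrapT => nS; apply: nle; apply: (@wle_of_singular 0) => i _.
  apply: contrapT => ni; apply: nS; exists i => z zS; apply: contrapT => z0.
  by apply: ni; exists z.
have E i : (i1 <= i)%N -> singular b v (N := N) i = [set 0].
  move=> i1i; apply/seteqP; split=> [z|z ->].
    by move=> /(singular_mono bS i1i) /S0.
  by case: (singular_lsub b v N i).
by exists i1 => i /E ->; rewrite E.
Qed.
End Pairs.
End HighestWeights.

(** * Cocycles from a sequence of singular vectors *)

Section CocycleFamily.
Variables (F : numClosedFieldType) (t : classical_type).
Local Notation K := (@ginf F t).
Local Notation g i := (@galg F t i).
Variable b : nat -> set (glinf F).
Hypotheses (bB : forall i, is_borel (g i) (b i)) (bS : forall i, b i `<=` b i.+1).
Variables (M N : lieModule K) (v : M).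
Hypotheses (MU : unitary_filtered M) (NU : unitary_filtered N) (v0 : v <> 0).
Hypotheses (bv : forall i x, b i x -> exists a, lact x v = a *: v).
Hypothesis Mv : forall m, gen K v m.
Hypothesis S_neq0 : forall i, exists2 z, singular b v i z & z <> 0 :> N.
Hypothesis S_cap0 : forall z : N, (forall i, singular b v i z) -> z = 0.
Local Notation S i := (singular b v (N := N) i).

(** The intersections of T with the S_i decrease in a finite-dimensional space, so they become equal
    to their common intersection, which is 0. *)
Lemma singular_avoid (T : set N) n : lsubspace T -> fdim_mod T [set 0] ->
  exists2 i, (n <= i)%N & forall z, T z -> S i z -> z = 0.
Proof.
move=> TL Tf; pose U i := T `&` S i.
have UL i : lsubspace (U i) by apply: lsubI => //; apply: singular_lsub.
have Udec i : U i.+1 `<=` U i by move=> z [Tz /(singularS bS)].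
have UT : U n `<=` T by move=> z [].
have [i1 ni1 U1] := chain_stationary TL Tf UL Udec UT; exists i1 => // z Tz zS.
apply: S_cap0 => i; have [i1i|/ltnW ii1] := leqP i1 i.
  by have [] : U i z by rewrite U1.
exact: (singular_mono bS ii1).
Qed.

(** The two sequences are interleaved so that the step n_k of the filtration contains f_0, ...,
    f_(k-1) but meets the singular space of level i_k only in 0. *)
Lemma singular_sequence : exists (Fil : nat -> set N) (n i : nat -> nat) (f : nat -> N),
  [/\ filtration Fil,
    forall k, [/\ (k <= n k)%N, (n k <= i k)%N & (i k < n k.+1)%N],
    forall k, S (i k) (f k) /\ f k <> 0,
    forall k z, Fil (n k) z -> S (i k) z -> z = 0 &
    forall k, Fil (n k.+1) (f k)].
Proof.
have [B [Fil [_ FF]]] := NU; have [FL _ Fex Ff _] := FF.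
(* From the current n, the triple consists of the level i_k, the next filtration step and the vector
   f_k. *)
have /choice[q qP] n : exists q : nat * nat * N, [/\ (n <= q.1.1)%N, (q.1.1 < q.1.2)%N,
    S q.1.1 q.2 /\ q.2 <> 0, forall z, Fil n z -> S q.1.1 z -> z = 0 & Fil q.1.2 q.2].
  have [i ni iT] := singular_avoid n (FL n) (Ff n).
  have [z zS z0] := S_neq0 i; have [l lz] := Fex z.
  exists (i, maxn i.+1 l, z); split=> //; first exact: leq_maxl.
  by apply: filtrationS FF _ _ lz; apply: leq_maxr.
pose n k := iter k (fun m => (q m).1.2) 0%N.
have nn k : [/\ (n k <= (q (n k)).1.1)%N & ((q (n k)).1.1 < n k.+1)%N].
  by have [] := qP (n k).
exists Fil, n, (fun k => (q (n k)).1.1), (fun k => (q (n k)).2); split=> // k;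
  try by have [] := qP (n k).
have [nk kn] := nn k; split=> //; elim: (k) => // k' IH.
have [nk' kn'] := nn k'; apply: leq_ltn_trans IH _; exact: leq_ltn_trans nk' kn'.
Qed.

Lemma singular_lift i z : S i z -> exists f : lin_maps M N, app f v = z /\
  forall x m, g i x -> gen (g i) v m -> app f (lact x m) = lact x (app f m).
Proof.
move=> zS; have [->|z0] := pselect (z = 0).
  by exists 0; split=> // x m _ _; rewrite -[app 0 m]/(0 : N) lact0.
have GL := gen2_lsub (@galg_ginf F t i) (@galg_ginf F t i) v z.
have [|f [fL fG]] := @functional_extend _ M N (gen2_at (M := M) (N := N) i v z) GL.
  by move=> n /(singular_pair bB MU v0 bv NU zS z0)[-> //].
have [w wE] := lin_map_of fL; exists w; split.
  by rewrite wE; apply/esym/fG; exact: gen2_id.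
move=> x m xi gm; have [n gn] := gen2_surj (@galg_ginf F t i) (@galg_ginf F t i) z gm.
by rewrite !wE -(fG _ _ gn); apply/esym/fG/gen2_act.
Qed.

Lemma cocycle_family : exists phi : (nat -> F^o) -> glinf F -> lin_maps M N,
  [/\ forall a, cocycle (phi a),
    forall c a a', phi (c *: a + a') = c *: phi a + phi a' &
    forall a, coboundary (phi a) -> exists n, forall k, (n <= k)%N -> a k = 0].
Proof.
have KS := ginf_subalgebra F t.
have [Fil [n [i [f [FF ni fS Fi Ff]]]]] := singular_sequence.
have [FL _ Fex _ _] := FF.
have im k k' : (k <= k')%N -> (i k <= i k')%N.
  elim: k' => [|k' IH]; first by rewrite leqn0 => /eqP->.
  rewrite leq_eqVlt => /orP[/eqP->//|/IH /leq_trans]; apply.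
  have [_ _ h1] := ni k'; have [_ h2 _] := ni k'.+1.
  by apply: leq_trans h2; apply: ltnW.
have ik k : (k <= i k)%N by have [h1 h2 _] := ni k; apply: leq_trans h2.
have nm k l : (l <= k)%N -> (n l <= n k)%N.
  elim: k => [|k IH]; first by rewrite leqn0 => /eqP->.
  rewrite leq_eqVlt => /orP[/eqP->//|/IH /leq_trans]; apply.
  by have [_ h1 h2] := ni k; apply: ltnW; apply: leq_ltn_trans h1 h2.
have /choice[w wP] k := singular_lift (fS k).1.
have wE k := (wP k).1; have wK k := (wP k).2.
(* Local finiteness: once level i_k contains x and m lies in U(g_(i_k)) v, the map w_k commutes with
   x at m. Identities for the infinite sum can therefore be checked on long partial sums [P a j],
   whose coboundaries obey them. *)
have small x m : K x -> exists j, forall k, (j <= k)%N -> app (homs_act x (w k)) m = 0.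
  move=> [j1 _ xj1]; have [j2 mj2] := gen_union (Mv m); exists (maxn j1 j2) => k.
  rewrite geq_max => /andP[jk1 jk2]; rewrite homs_actE wK ?subrr //.
    by apply: galgS xj1; apply: leq_trans (ik k).
  by apply: genS mj2; apply: galgS; apply: leq_trans (ik k).
pose P (a : nat -> F^o) j : lin_maps M N := \sum_(k < j) (a k : F) *: w k.
pose val a x m : N := \sum_(k \in [set: nat]) (a k : F) *: app (homs_act x (w k)) m.
have appL (m : M) : linear (fun h : lin_maps M N => app h m) by move=> c h h'; apply: app_lin.
have PE a j x m : app (homs_act x (P a j)) m =
    \sum_(k < j) (a k : F) *: app (homs_act x (w k)) m.
  rewrite /P (lin_sum (@homs_linear F K M N x)) (lin_sum (appL m)).
  by apply: eq_bigr => k _; rewrite (linZ (@homs_linear F K M N x)) (linZ (appL m)).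
have valE a x m : K x -> exists j, forall j', (j <= j')%N ->
    val a x m = app (homs_act x (P a j')) m.
  move=> Kx; have [j jP] := small x m Kx; exists j => j' jj'.
  rewrite /val (@fsbig_bound _ N _ j') => [|k jk]; last first.
    by rewrite jP ?scaler0 //; apply: leq_trans jk.
  by rewrite PE.
have valL a x : K x -> linear (val a x).
  move=> Kx c m m'; have [j1 e1] := valE a x m Kx; have [j2 e2] := valE a x m' Kx.
  have [j3 e3] := valE a x (c *: m + m') Kx; pose j := (j1 + j2 + j3)%N.
  by rewrite (e1 j) ?(e2 j) ?(e3 j) ?(app_linear (homs_act x _)) //; rewrite /j; lia.
have /choice[phi phiE] (q : (nat -> F^o) * glinf F) : exists h : lin_maps M N,
    if `[< K q.2 >] then forall m, app h m = val q.1 q.2 m else h = 0.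
  case: asboolP => [Kx|_]; last by exists 0.
  by have [h hE] := lin_map_of (valL q.1 q.2 Kx); exists h.
have pE a x m : K x -> app (phi (a, x)) m = val a x m.
  by move=> Kx; have := phiE (a, x); rewrite /= asboolT.
have p0 a x : ~ K x -> phi (a, x) = 0 by move=> Kx; have := phiE (a, x); rewrite /= asboolF.
exists (fun a x => phi (a, x)); split.
- move=> a; split=> [x|c x y Kx Ky|x y Kx Ky]; first exact: p0.
    apply: lin_mapsP => m; have Kxy : K (c *: x + y) := KS.1.2 c x y Kx Ky.
    rewrite app_lin !pE //.
    have [j1 e1] := valE a x m Kx; have [j2 e2] := valE a y m Ky.
    have [j3 e3] := valE a _ m Kxy; pose j := (j1 + j2 + j3)%N.
    by rewrite (e1 j) ?(e2 j) ?(e3 j) -?app_lin ?homs_lin //; rewrite /j; lia.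
  apply: lin_mapsP => m; have Kxy : K (glbr x y) := KS.2 x y Kx Ky.
  rewrite app_sub !homs_actE !pE //.
  have [j1 e1] := valE a x m Kx; have [j2 e2] := valE a y m Ky.
  have [j3 e3] := valE a _ m Kxy; have [j4 e4] := valE a x (lact y m) Kx.
  have [j5 e5] := valE a y (lact x m) Ky; pose j := (j1 + j2 + j3 + j4 + j5)%N.
  rewrite (e1 j) ?(e2 j) ?(e3 j) ?(e4 j) ?(e5 j) -?homs_actE -?app_sub ?homs_br //;
    rewrite /j; lia.
- move=> c a a'; apply/funext => x; rewrite -[RHS]/(c *: phi (a, x) + phi (a', x)).
  have [Kx|nK] := pselect (K x); last by rewrite !p0 // scaler0 addr0.
  apply: lin_mapsP => m; rewrite app_lin !pE //.
  have [j1 e1] := valE a x m Kx; have [j2 e2] := valE a' x m Kx.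
  have [j3 e3] := valE (c *: a + a') x m Kx; pose j := (j1 + j2 + j3)%N.
  rewrite (e1 j) ?(e2 j) ?(e3 j); try by rewrite /j; lia.
  rewrite -app_lin -homs_linear; congr (app (homs_act x _) m).
  rewrite /P scaler_sumr -big_split; apply: eq_bigr => k _ /=.
  by rewrite scalerA -scalerDl.
move=> a [h hE].
have dE x m : K x -> val a x m = app (homs_act x h) m.
  by move=> Kx; rewrite -pE //; have := hE x; rewrite asboolT // => ->.
(* If h bounds the infinite sum, h minus the j-th partial sum commutes at v with b_(i_j), because
   the later w_k do; so u_j is singular at level i_j. For j at least l it also lies in step n_j, so
   it vanishes, and u_k - u_(k+1) = a_k f_k forces a_k = 0. *)
pose u j : N := app h v - \sum_(k < j) (a k : F) *: f k.
have uE j : u j = app (h - P a j) v.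
  rewrite app_sub (lin_sum (appL v)); congr (_ - _); apply: eq_bigr => k _.
  by rewrite (linZ (appL v)) wE.
have uS j : S (i j) (u j).
  move=> x bx c xv; have xi := borel_sub bB bx; have Kx := galg_ginf xi.
  have [j' vE] := valE a x v Kx.
  have : app (homs_act x (h - P a j)) v = 0.
    rewrite -[h - _]addrC -scaleN1r homs_linear app_lin -dE // scaleN1r addrC.
    rewrite (vE (maxn j j') (leq_maxr _ _)) !PE.
    rewrite (big_ord_widen _ (fun k => (a k : F) *: app (homs_act x (w k)) v) (leq_maxl j j')).
    rewrite (bigID (fun k : 'I_(maxn j j') => (k < j)%N)) /= addrC addKr.
    apply: big1 => k; rewrite -leqNgt => jk.
    rewrite wK ?subrr ?scaler0 //.
    by apply: galgS xi; apply: im.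
  rewrite homs_actE uE xv (linZ (app_linear _)) => /eqP.
  by rewrite subr_eq0 => /eqP.
have [l hl] := Fex (app h v); exists l => k lk.
have u0 j : (l <= j)%N -> u j = 0.
  move=> lj; apply: (Fi j) (uS j); apply: lsubB => //.
    apply: filtrationS FF _ _ hl; have [jn _ _] := ni j; exact: leq_trans jn.
  apply: lsub_sum => // k' _; apply: lsubZ => //; apply: filtrationS FF _ _ (Ff k').
  by apply: nm; apply: ltn_ord.
have : u k.+1 = u k - (a k : F) *: f k by rewrite /u big_ord_recr opprD addrA.
rewrite (u0 k lk) (u0 k.+1 (leqW lk)) sub0r => /esym/eqP.
rewrite oppr_eq0 scaler_eq0 => /orP[/eqP//|/eqP f0].
by have [_ []] := fS k.
Qed.
End CocycleFamily.

(** * Cardinality *)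

(** The node at depth k of the branch s of the binary tree, numbered in binary with a leading digit
    1. Distinct branches share finitely many nodes, so branches form the almost disjoint family. *)
Fixpoint prefix_code (s : nat -> bool) (k : nat) : nat :=
  if k is k'.+1 then ((prefix_code s k').*2 + s k')%N else 1%N.

Lemma prefix_code_gt s k : (k < prefix_code s k)%N.
Proof. by elim: k => //= k IH; lia. Qed.

Lemma prefix_code_inj s s' k j : prefix_code s k = prefix_code s' j ->
  k = j /\ forall i, (i < k)%N -> s i = s' i.
Proof.
elim: k j => [|k IH] [|j] //=.
- by have := prefix_code_gt s' j; lia.
- by have := prefix_code_gt s k; lia.
move=> e; have [/IH[-> h] sk] : prefix_code s k = prefix_code s' j /\ s k = s' j.
  by move: e; case: (s k) (s' j) => -[] e; split=> //; lia.
split=> // i; rewrite ltnS leq_eqVlt => /orP[/eqP->//|]; exact: h.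
Qed.

Section AlmostDisjoint.
Variables (F : fieldType) (X : lmodType F) (Psi : (nat -> F^o) -> X).
Hypothesis PsiL : linear Psi.
Hypothesis Psi0 : forall a, Psi a = 0 -> exists n, forall k, (n <= k)%N -> a k = 0.

Lemma independent_family : exists e : (nat -> bool) -> X,
  injective e /\ independent (range e).
Proof.
pose a (s : nat -> bool) : nat -> F^o := fun m => (`[< exists k, m = prefix_code s k >])%:R.
(* Images of sequences that vanish far out along the branch s. This subspace contains the vectors of
   all other branches but not that of s, whose indicator is 1 all along s while the kernel of [Psi]
   contains finitely supported sequences only. *)
pose T s : set X := [set x | exists d, x = Psi d /\
  exists n, forall k, (n <= k)%N -> d (prefix_code s k) = 0].
have TL s : lsubspace (T s).
  split; first by exists 0; rewrite (lin0 PsiL); split=> //; exists 0%N.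
  move=> c _ _ [d [-> [n dn]]] [d' [-> [n' dn']]]; exists (c *: d + d').
  rewrite PsiL; split=> //; exists (maxn n n') => k; rewrite geq_max => /andP[nk nk'].
  by rewrite -[LHS]/(c *: (d _) + d' _) dn // dn' // scaler0 addr0.
have Tne s s' : s <> s' -> T s (Psi (a s')).
  move=> ss'; exists (a s'); split=> //.
  have [i si] : exists i, s i <> s' i.
    by apply: contrapT => h; apply: ss'; apply/funext => i; apply: contrapT => si; apply: h; exists i.
  exists i.+1 => k ik; rewrite /a asboolF // => -[j /prefix_code_inj[_ h]].
  exact/si/h.
have nT s : ~ T s (Psi (a s)).
  move=> [d [dE [n dn]]].
  have : Psi (a s - d) = 0 by rewrite (linB PsiL) dE subrr.
  move=> /Psi0[m h]; set k := maxn n m.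
  have /eqP : a s (prefix_code s k) - d (prefix_code s k) = 0 := h (prefix_code s k) (leq_trans (leq_maxr n m) (ltnW (prefix_code_gt s k))).
  rewrite dn ?leq_maxl // subr0 /a asboolT; last by exists k.
  by rewrite oner_eq0.
exists (fun s => Psi (a s)); split.
  by move=> s s' e; apply: contrapT => /Tne; rewrite -e; apply: nT.
move=> _ [s _ <-] sp; apply: (nT s); apply: sp => // _ [[s' _ <-] ne]; apply: Tne.
by move=> ss'; apply: ne; rewrite /= ss'.
Qed.
End AlmostDisjoint.

Lemma real_cut_inj (R : realType) (x y : R) :
  (forall q : rat, (ratr q < x) = (ratr q < y)) -> x = y.
Proof.
move=> h; apply/eqP; rewrite eq_le !leNgt; apply/andP; split; apply/negP => xy.
  have [q] := rat_in_itvoo xy; rewrite in_itv /= => /andP[yq qx].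
  by move: qx; rewrite h => /(lt_trans yq); rewrite ltxx.
have [q] := rat_in_itvoo xy; rewrite in_itv /= => /andP[yq qx].
by move: qx; rewrite -h => /(lt_trans yq); rewrite ltxx.
Qed.

(** A complex number is coded by the rational cuts of its real and imaginary parts, so a countable
    family of them becomes a subset of a countable set. *)
Lemma complex_cut (R : realType) (T : Type) : exists f : (T -> R[i]) -> set (T * (bool * rat)),
  injective f.
Proof.
exists (fun u : T -> R[i] => [set p : T * (bool * rat) | ratr p.2.2 < (if p.2.1 then @complex.Re R else @complex.Im R) (u p.1)]).
move=> u v /seteqP[uv vu]; apply/funext => k.
have E c q : (ratr q < (if c then @complex.Re R else @complex.Im R) (u k)) =
    (ratr q < (if c then @complex.Re R else @complex.Im R) (v k)).
  by apply/idP/idP => [/(uv (k, (c, q)))|/(vu (k, (c, q)))].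
have := real_cut_inj (E true); have := real_cut_inj (E false).
by case: (u k) (v k) => [x y] [x' y'] /= -> ->.
Qed.

Section Coordinates.
Variables (F : numClosedFieldType) (t : classical_type).
Local Notation K := (@ginf F t).

Lemma unitary_frame (M : lieModule K) : unitary_filtered M ->
  exists (B : M -> M -> F) (u : nat -> nat -> M), posform B /\
  forall m, exists n d, m = \sum_(s < d) B m (u n s) *: u n s.
Proof.
move=> [B [Fil [[Bp _] [FL _ Fex Ff _]]]].
have /choice[u uP] n : exists u : nat -> M, exists d, forall z, Fil n z ->
    z = \sum_(s < d) B z (u s) *: u s.
  by have [d [u [_ _ uE]]] := orthonormal_basis Bp (FL n) (Ff n); exists u, d.
exists B, u; split=> // m; have [n nm] := Fex m; have [d dE] := uP n.
by exists n, d; apply: dE.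
Qed.

Lemma galg_frame : exists e : nat -> nat -> glinf F,
  forall x, K x -> exists i d, (forall s, (s < d)%N -> K (e i s)) /\
    exists c : nat -> F, x = \sum_(s < d) c s *: e i s.
Proof.
have /choice[e eP] i : exists e : nat -> glinf F, exists d,
    (forall s, (s < d)%N -> galg t i (e s)) /\
    forall y, galg t i y -> exists c : nat -> F, y = \sum_(s < d) c s *: e s.
  by have [d [e [eg eE _]]] := casimir_basis F t i; exists e, d.
exists e => x [i _ xi]; have [d [eg eE]] := eP i; exists i, d; split.
  by move=> s /eg; apply: galg_ginf.
exact: eE.
Qed.

(** The coordinates are the matrix coefficients of the values of p, for the countably many frame
    vectors of g, M and N; each frame vector carries two indices. *)
Lemma cocycle_coordinates (M N : lieModule K) :
  unitary_filtered M -> unitary_filtered N ->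
  exists f : (glinf F -> lin_maps M N) -> (nat * nat) * (nat * nat) * (nat * nat) -> F,
  forall p q, cocycle p -> cocycle q -> f p = f q -> p = q.
Proof.
move=> /unitary_frame[B0 [u [_ uE]]] /unitary_frame[B [w [Bp wE]]].
have [e eE] := galg_frame; have KS := ginf_subalgebra F t; have Bf := Bp.1.
exists (fun p k => B (app (p (e k.1.1.1 k.1.1.2)) (u k.1.2.1 k.1.2.2)) (w k.2.1 k.2.2)).
move=> p q [p0 pL _] [q0 qL _] pq.
have pqe i s : p (e i s) = q (e i s).
  apply: lin_mapsP => m; have [n [d ->]] := uE m.
  rewrite !(lin_sum (app_linear _)); apply: eq_bigr => r _.
  rewrite !(linZ (app_linear _)); congr (_ *: _).
  apply/eqP; rewrite -subr_eq0; apply/eqP; set z := _ - _.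
  have [k [d' ->]] := wE z; apply: big1 => l _.
  have /eqP := congr1 (fun f => f ((i, s), (n, r : nat), (k, l : nat))) pq.
  by rewrite /= -subr_eq0 -(formBl Bf) => /eqP; rewrite -/z => ->; rewrite scale0r.
apply/funext => x; have [Kx|nK] := pselect (K x); last by rewrite p0 // q0.
have [i [d [eK [c ->]]]] := eE x Kx.
rewrite (additive_on_sum KS c pL eK) (additive_on_sum KS c qL eK).
by apply: eq_bigr => s _; rewrite pqe.
Qed.
End Coordinates.

(** Cantor-Bernstein: f gives the upper bound, and the family e inside B the lower one. *)
Lemma power_set_card (U : choiceType) (T : countType) (B : set U) (e : (nat -> bool) -> U)
    (f : U -> set T) :
  injective e -> range e `<=` B -> injective f -> (B #= [set: set int])%card.
Proof.
move=> eI eB fI; apply/card_eqPle; split.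
  apply/pcard_injP.
  exists (fun x => [set Posz (pickle k) | k in f x]) => x y _ _ xy; apply: fI.
  have mono a b' : [set Posz (pickle k) | k in f a] = [set Posz (pickle k) | k in f b'] ->
      f a `<=` f b'.
    move=> ab k ak; have : [set Posz (pickle k) | k in f b'] (Posz (pickle k)).
      by rewrite -ab; exists k.
    by move=> [k' bk' [] /(pcan_inj (@pickleK T)) <-].
  by apply/seteqP; split; apply: mono.
pose d (A : set int) : nat -> bool := fun n => if unpickle n is Some z then `[< A z >] else false.
have dI : injective d.
  move=> A A' AA'; apply/funext => z; apply/propext.
  have := congr1 (@^~ (pickle z)) AA'; rewrite /d pickleK => e'.
  by split=> /asboolP; [rewrite e'|rewrite -e'] => /asboolP.
have /card_eqPle[_ le] : (range (e \o d) #= [set: set int])%card.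
  by apply: inj_card_eq => x y _ _ /eI/dI.
apply: card_le_trans le _; apply: subset_card_le => _ [A _ <-].
by apply: eB; exists (d A).
Qed.

Theorem lemma6p20 (R : realType) (t : classical_type)
    (h b : nat -> set (glinf R[i])) (hb : nested_borels t h b)
    (la mu : weight (\bigcup_i h i)) (hla : Theta t b la) (hmu : Theta t b mu)
    (Vla Vmu : lieModule (@ginf R[i] t))
    (hVla : is_V b la Vla) (hVmu : is_V b mu Vmu) :
  exists X : ext1_space Vmu Vla,
    ((exists x : X, x <> 0) <-> wlt t b mu la) /\
    (wlt t b mu la -> dim_is X [set: set int]).
Proof.
have [v vmu] := is_V_vector hVmu.
have [w wla] := is_V_vector hVla.
have [v0 _ _ vT] := vmu; have [w0 _ _ wT] := wla.
have [MT _] := hVmu; have [NT _] := hVla.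
have MU := simple_tensor_unitary MT; have NU := simple_tensor_unitary NT.
have bv := hw_bv hb vmu.
have [X [psi [psiL [psi0 psi_onto split iota]]]] := ext1_model (ginf_subalgebra _ t) Vmu Vla.
have nlt : ~ wlt t b mu la -> forall x : X, x = 0.
  move=> nlt x; have [E <-] := ext1_surj x; apply: split.
  have [i1 st] := not_wlt_stationary hb MU NU vmu wla NT nlt.
  exact: (extension_splits (nb_borel hb) MU NU v0 bv vT E st).
have fam : wlt t b mu la -> exists phi : (nat -> R[i]^o) -> glinf R[i] -> lin_maps Vmu Vla,
  [/\ forall a, cocycle (phi a),
    forall c a a', phi (c *: a + a') = c *: phi a + phi a' &
    forall a, coboundary (phi a) -> exists n, forall k, (n <= k)%N -> a k = 0].
  move=> [le ne]; apply: (cocycle_family (nb_borel hb) (nb_borelS hb) MU NU v0 bv vT).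
    exact: (singular_of_wle hb NU vmu wla le).
  move=> z zS; apply: contrapT => z0; apply: ne.
  exact: (global_singular hb NU vmu wla z0 zS).
have ind : wlt t b mu la -> exists e : (nat -> bool) -> X, injective e /\ independent (range e).
  move=> /fam[phi [phiZ phiL phi0]].
  apply: (@independent_family _ X (fun a => psi (phi a))).
    by move=> c a a'; rewrite phiL psiL.
  by move=> a /psi0/phi0; apply.
exists X; split; first split.
- by move=> [x x0]; apply: contrapT => /nlt/(_ x).
(* Any member of the family will do, since an independent set does not contain 0. *)
- move=> /ind[e [_ eI]]; exists (e (fun=> true)) => e0.
  have eR : range e (e (fun=> true)) by exists (fun=> true).
  by apply: (eI _ eR); rewrite e0; case: (lspan_lsub (range e `\ (0 : X))).
move=> /ind[e [einj eI]]; have [B [eB BI BT]] := independent_extend eI.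
exists B; split; first exact: independent_basis.
have [io [ioI ioZ]] := iota; have [cf cfI] := cocycle_coordinates MU NU.
have [g gI] := complex_cut R (nat * nat * (nat * nat) * (nat * nat))%type.
apply: (power_set_card (f := fun x => g (cf (io x))) einj eB) => x y /gI xy.
by apply/ioI/cfI.
Qed.
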